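(* Let $k\in\mathbb N$. Let $0<c\le\infty$ and let $f\in C((-c,c),\mathbb R)$ satisfy: ($f_1$) $f$ is odd, $f(0)=0$, and there exist $0<b<\beta<c$ such that $f(s)>0$ for $s>b$, $f(s)\le 0$ and $f(s)\not\equiv 0$ for $s\in[0,b]$, and $F(\beta)=0$, where $F(s):=\int_0^s f(t)\,dt$; ($f_2$) $f$ is continuously differentiable in $(0,c)$ and $f'\in L^1(0,1)$. Let $q$ satisfy: ($q_1$) $q\in C^1(\mathbb R^+;\mathbb R^+)$, $q\ge 0$, $q(0)=0$ and $q'>0$ on $(0,\infty)$; ($q_2$) $q'/q$ is strictly decreasing on $(0,\infty)$; ($q_4$) $\frac1q\in L^1(1,\infty)\setminus L^1(0,1)$ and the function $h(r):=q(r)\int_r^\infty\frac{ds}{q(s)}$ satisfies: $h'(r)$ is strictly positive and nonincreasing for all $r>0$, with $\ell_\infty:=\lim_{r\to\infty}h'(r)>0$. Assume in addition: ($q_6$) (i) the function $G(r):=\frac{q'(r)}{q(r)h(r)}\int_0^r h(s)\,ds-\frac12$ is nonnegative and satisfies $\overline G:=\sup_{r>0}G(r)<\infty$, and (ii) $\frac{G(r)h(r)}{\left(\int_0^r h(s)\,ds\right)^{1/2}}$ is nondecreasing in $(0,\infty)$; ($q_7$) there exist $a\in(0,1)$ and $C$ with $\overline G\le C\le 1$ such that $h^{1-a}(r)(C-G(r))$ is nondecreasing; ($f_7$) $\left(\frac{F}{f}\right)'(s)\ge C$ for all $s>\beta$, with the same constant $C$ as in ($q_7$). Then the problem $$(q\,u')'+q(r)f(u)=0,\quad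 r>0,\qquad u'(0)=0,\qquad \lim_{r\to+\infty}u(r)=0,$$ has at most one solution satisfying $u(0)>0$ which has exactly $k$ sign changes in $(0,\infty)$.
   Context: $'$ denotes $\frac{d}{dr}$ for functions of $r$ (and $\frac{d}{ds}$ for functions of $s$). $\mathbb R^+=[0,\infty)$. Conditions on $f$ for large $s$ (such as $s>b$ or $s>\beta$) are understood for $s<c$. A solution $u=u(r)$, $r\ge0$, is a classical solution with values in $(-c,c)$. The condition $\frac1q\in L^1(1,\infty)\setminus L^1(0,1)$ means that $1/q$ is integrable on $(1,\infty)$ and not integrable on $(0,1)$. *)

(* Defs.v *)
From HB Require Import structures.
From mathcomp Require Import all_boot all_order all_algebra.
From mathcomp Require Import all_classical all_reals all_analysis.

Set Implicit Arguments.
Unset Strict Implicit.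
Unset Printing Implicit Defensive.

Import Order.TTheory GRing.Theory Num.Theory.
Import numFieldNormedType.Exports.

Local Open Scope ring_scope.
Local Open Scope classical_set_scope.

(** Functions on [0, +oo[ are total functions [R -> R] whose values on
    negative reals are irrelevant. Hence the derivative at 0 is one-sided,
    whereas at r > 0 it is the library derivative. *)
Definition C1_Rplus (R : realType) (g dg : R -> R) : Prop :=
  [/\ {within `[0, +oo[%classic, continuous dg},
      forall r : R, 0 < r -> is_derive r 1 g (dg r) &
      (g r - g 0) / r @[r --> 0^'+] --> dg 0].

(** The domain ]-c, c[ of f, where c may be +oo. *)
Definition dom (R : realType) (c : \bar R) : set R :=
  [set s | (`|s|%:E < c)%E].

(** The interval is empty for s < 0; F is only evaluated at s >= 0. *)
Definition F (R : realType) (f : R -> R) (s : R) : R :=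
  \int[@lebesgue_measure R]_(t in `[0, s]) f t.

Definition cond_f1 (R : realType) (c : \bar R) (f : R -> R) (b beta : R) :
    Prop :=
  [/\ forall s : R, dom c s -> f (- s) = - f s,
      f 0 = 0,
      [/\ 0 < b, b < beta & (beta%:E < c)%E],
      [/\ forall s : R, b < s -> dom c s -> 0 < f s,
          forall s : R, 0 <= s <= b -> f s <= 0 &
          exists2 s : R, 0 <= s <= b & f s != 0] &
      F f beta = 0].

(** For c < 1, integrability on ]0, 1[ is meant on the part of ]0, 1[ where
    f is defined. *)
Definition cond_f2 (R : realType) (c : \bar R) (f : R -> R) : Prop :=
  [/\ forall s : R, 0 < s -> dom c s -> derivable f s 1,
      forall s : R, 0 < s -> dom c s -> {for s, continuous (derive1 f)} &
      (@lebesgue_measure R).-integrable (`]0, 1[ `&` dom c)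
        (EFin \o derive1 f)].

Definition cond_f7 (R : realType) (c : \bar R) (f : R -> R) (beta C : R) :
    Prop :=
  forall s : R, beta < s -> dom c s -> C <= derive1 (fun t => F f t / f t) s.

Definition cond_q1 (R : realType) (q : R -> R) : Prop :=
  [/\ exists dq, C1_Rplus q dq,
      forall r : R, 0 <= r -> 0 <= q r,
      q 0 = 0 &
      forall r : R, 0 < r -> 0 < derive1 q r].

Definition cond_q2 (R : realType) (q : R -> R) : Prop :=
  forall r s : R, 0 < r -> r < s -> derive1 q s / q s < derive1 q r / q r.

Definition h (R : realType) (q : R -> R) (r : R) : R :=
  q r * \int[@lebesgue_measure R]_(s in `]r, +oo[) (q s)^-1.

Definition cond_q4 (R : realType) (q : R -> R) : Prop :=
  [/\ (@lebesgue_measure R).-integrable `]1, +oo[ (fun r => ((q r)^-1)%:E),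
      ~ (@lebesgue_measure R).-integrable `]0, 1[ (fun r => ((q r)^-1)%:E),
      forall r : R, 0 < r -> 0 < derive1 (h q) r,
      forall r s : R, 0 < r -> r <= s -> derive1 (h q) s <= derive1 (h q) r &
      exists2 l : R, 0 < l & derive1 (h q) r @[r --> +oo] --> l].

Definition H (R : realType) (q : R -> R) (r : R) : R :=
  \int[@lebesgue_measure R]_(s in `]0, r[) h q s.

Definition G (R : realType) (q : R -> R) (r : R) : R :=
  derive1 q r / (q r * h q r) * H q r - 2^-1.

Definition Gbar (R : realType) (q : R -> R) : \bar R :=
  ereal_sup [set (G q r)%:E | r in `]0, +oo[].

Definition cond_q6 (R : realType) (q : R -> R) : Prop :=
  [/\ forall r : R, 0 < r -> 0 <= G q r,
      (Gbar q < +oo)%E &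
      forall r s : R, 0 < r -> r <= s ->
        G q r * h q r / Num.sqrt (H q r) <= G q s * h q s / Num.sqrt (H q s)].

Definition cond_q7 (R : realType) (q : R -> R) (C : R) : Prop :=
  exists a : R,
    [/\ 0 < a < 1,
        (Gbar q <= C%:E)%E /\ C <= 1 &
        forall r s : R, 0 < r -> r <= s ->
          h q r `^ (1 - a) * (C - G q r) <= h q s `^ (1 - a) * (C - G q s)].

(** Since q is C^1 and positive on ]0, +oo[ and f(u) is continuous, the
    differentiability of q u' makes u twice continuously differentiable
    there. *)
Definition is_solution (R : realType) (c : \bar R) (f q u : R -> R) : Prop :=
  [/\ exists2 du, C1_Rplus u du & du 0 = 0,
      forall r : R, 0 <= r -> dom c (u r),
      forall r : R, 0 < r -> derivable (q \* derive1 u) r 1,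
      forall r : R, 0 < r -> derive1 (q \* derive1 u) r + q r * f (u r) = 0 &
      u r @[r --> +oo] --> (0 : R)].

Definition at_least_sign_changes (R : realType) (u : R -> R) (k : nat) : Prop :=
  exists x : nat -> R,
    [/\ 0 < x 0%N,
        forall i, (i < k)%N -> x i < x i.+1 &
        forall i, (i < k)%N -> u (x i) * u (x i.+1) < 0].

Definition exactly_sign_changes (R : realType) (u : R -> R) (k : nat) : Prop :=
  at_least_sign_changes u k /\ ~ at_least_sign_changes u k.+1.

(* Main.v *)
Require Import Defs.
From HB Require Import structures.
From mathcomp Require Import all_boot all_order all_algebra.
From mathcomp Require Import all_classical all_reals all_analysis.
From mathcomp Require Import measurable_realfun.
From mathcomp Require Import ring lra.

Set Implicit Arguments.
Unset Strict Implicit.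
Unset Printing Implicit Defensive.

Import Order.TTheory GRing.Theory Num.Theory.
Import numFieldNormedType.Exports.

Local Open Scope ring_scope.
Local Open Scope classical_set_scope.

(** The energy u'^2 / 2 + F(|u|) of a solution decreases and tends to a
    nonnegative limit, so it is positive until the solution becomes identically
    0. Until then, |u| > beta at the critical points; so a solution
    with k sign changes consists of k monotone branches, each joining a height
    beyond beta to a height beyond - beta or conversely, followed by a monotone
    branch that tends to 0 ([branch_dichotomy], [nodes_of_changes]). Since f is
    odd, a reflection at each turn makes every branch increasing, and on each of
    them r and P = u' are functions of the height s.

    Let u_1 and u_2 be two solutions with u_1(0) < u_2(0). The claim is that
    u_2 is steeper than u_1 at the same height on every branch: P1 < P2. Which
    of the two is late is not known, and it may change once on a branch: as long
    as P1 < P2, the gap r1 - r2 increases with s. While r1 <= r2, the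
    inequality P1 < P2 persists because q' / q decreases
    ([velocity_gap_pos]). While r1 >= r2 a finer quantity is needed:
    - where F >= 0, Q = H (P^2 / 2 + F) + h P F / f. The gap Q2 - Q1 does not
      decrease while P1 <= P2 and h1 P1 <= h2 P2 ([Qb_slope_le]; this uses
      (F / f)' >= C >= G, and that G and h (C - G) are nondecreasing), and
      Q1 < Q2 prevents h1 P1 = h2 P2 ([outer_stage]);
    - where F <= 0, W = sqrt (H (P^2 + 2 F)). The gap W2 - W1 does not decrease
      ([W_slope_le]; this uses that G h / sqrt H is nondecreasing), and
      W1 < W2 implies P1 < P2 ([inner_stage]).
    At the heights - beta and beta, where F = 0, one has Q = W^2 / 2, and the
    two comparisons can be chained.

    It follows that u_1 turns at a smaller height than u_2
    ([turning_step]). While u_2 goes further, turns and comes back to that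
    height, Q does not decrease, because Q plus a primitive of F / f taken at
    |u| is nondecreasing in r ([Qr_return]). So Q1 < Q2 at the beginning of the
    next branch, and the argument is repeated ([nodes_comparison]). On the last
    branch P2 and W2 tend to 0 at height 0, whereas P2 - P1 or W2 - W1 is
    bounded below by a positive constant ([not_both_decay]): a contradiction.

    Hence u_1(0) = u_2(0), and the initial value problem has a unique solution
    ([sol_unique]): where u <> 0 the function f is locally Lipschitz, where
    u = 0 and u' <> 0 the unknowns u and the energy satisfy a Lipschitz system,
    and u = u' = 0 forces u = 0 from there on. *)

(** * Calculus on intervals *)

Section calculus.
Context {R : realType}.
Implicit Types (f g df dg : R -> R) (a b x y z r s t T eps K : R).

Lemma is_derive1D f g x a b : is_derive x 1 f a -> is_derive x 1 g b ->
  is_derive x 1 (fun t => f t + g t) (a + b).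
Proof. by move=> fa gb; exact: (is_deriveD fa gb). Qed.

Lemma is_derive1N f x a : is_derive x 1 f a ->
  is_derive x 1 (fun t => - f t) (- a).
Proof. by move=> fa; exact: (is_deriveN fa). Qed.

Lemma is_derive1B f g x a b : is_derive x 1 f a -> is_derive x 1 g b ->
  is_derive x 1 (fun t => f t - g t) (a - b).
Proof. by move=> fa gb; exact: (is_deriveB fa gb). Qed.

Lemma is_derive1M f g x a b : is_derive x 1 f a -> is_derive x 1 g b ->
  is_derive x 1 (fun t => f t * g t) (a * g x + f x * b).
Proof.
move=> fa gb; have := is_deriveM fa gb.
by rewrite /GRing.scale /= addrC [g x * a]mulrC.
Qed.

Lemma is_derive1Z f x k a : is_derive x 1 f a ->
  is_derive x 1 (fun t => k * f t) (k * a).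
Proof. by move=> fa; exact: (is_deriveZ k fa). Qed.

Lemma is_derive1X2 f x a : is_derive x 1 f a ->
  is_derive x 1 (fun t => f t ^+ 2) (2 * f x * a).
Proof.
move=> fa; apply: (is_derive_eq (is_derive1M fa fa)); ring.
Qed.

Lemma is_derive1V f x a : f x != 0 -> is_derive x 1 f a ->
  is_derive x 1 (fun t => (f t)^-1) (- a / f x ^+ 2).
Proof.
move=> f0 fa; have := is_deriveV f0 fa.
by rewrite /GRing.scale /= mulNr mulrC mulNr.
Qed.

Lemma is_derive1_continuous f x a : is_derive x 1 f a -> {for x, continuous f}.
Proof. by case=> + _; move/derivable1_diffP/differentiable_continuous. Qed.

Lemma withinD f g (A : set R) : {within A, continuous f} ->
  {within A, continuous g} -> {within A, continuous (fun x => f x + g x)}.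
Proof. by move=> fc gc x; apply: cvgD; [exact: fc|exact: gc]. Qed.

Lemma withinN f (A : set R) : {within A, continuous f} ->
  {within A, continuous (fun x => - f x)}.
Proof. by move=> fc x; apply: cvgN; exact: fc. Qed.

Lemma withinM f g (A : set R) : {within A, continuous f} ->
  {within A, continuous g} -> {within A, continuous (fun x => f x * g x)}.
Proof. by move=> fc gc x; apply: cvgM; [exact: fc|exact: gc]. Qed.

Lemma mulrD_le_sumsq x y : x * (x + y) <= 2 * (x ^+ 2 + y ^+ 2).
Proof. by have := (sqr_ge0 (x - y), sqr_ge0 x, sqr_ge0 y) => -[[]]; nra. Qed.

Lemma withinMin f g (A : set R) : {within A, continuous f} ->
  {within A, continuous g} ->
  {within A, continuous (fun x => Num.min (f x) (g x))}.
Proof.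
move=> fc gc x; exact: (@continuous_min R (subspace A) f g x (fc x) (gc x)).
Qed.

Lemma within_cst (k : R) (A : set R) : {within A, continuous (fun _ : R => k)}.
Proof. by apply: continuous_subspaceT => x; exact: cvg_cst. Qed.

Lemma is_derive1_expRM (k x : R) :
  is_derive x 1 (fun t => expR (k * t)) (expR (k * x) * k).
Proof.
apply: is_derive1_comp; have := is_derive1Z k (is_derive_id x (1 : R)).
by rewrite mulr1.
Qed.

Lemma is_derive_within f df (A : set R) :
  (forall x, A x -> is_derive x 1 f (df x)) -> {within A, continuous f}.
Proof.
move=> fd; apply/continuous_in_subspaceT => x; rewrite inE => /fd.
exact: is_derive1_continuous.
Qed.

Lemma le_of_deriv_ge0 f df a b : a <= b -> {within `[a, b], continuous f} ->
  (forall x, a < x < b -> is_derive x 1 f (df x)) ->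
  (forall x, a < x < b -> 0 <= df x) -> f a <= f b.
Proof.
rewrite le_eqVlt => /predU1P[-> //|ab] fc fd df0.
have fd' x : x \in `]a, b[%R -> is_derive x 1 f (df x).
  by rewrite in_itv; exact: fd.
have [x xab /eqP] := MVT ab fd' fc.
rewrite subr_eq => /eqP ->; rewrite lerDr mulr_ge0 ?subr_ge0 ?(ltW ab)//.
by apply: df0; rewrite in_itv in xab.
Qed.

Lemma lt_of_deriv_gt0 f df a b : a < b -> {within `[a, b], continuous f} ->
  (forall x, a < x < b -> is_derive x 1 f (df x)) ->
  (forall x, a < x < b -> 0 < df x) -> f a < f b.
Proof.
move=> ab fc fd df0; have fd' x : x \in `]a, b[%R -> is_derive x 1 f (df x).
  by rewrite in_itv; exact: fd.
have [x xab /eqP] := MVT ab fd' fc.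
rewrite subr_eq => /eqP ->; rewrite ltrDr mulr_gt0 ?subr_gt0//.
by apply: df0; rewrite in_itv in xab.
Qed.

Lemma within_segment_dist g a b z : {within `[a, b], continuous g} ->
  a <= z <= b -> forall e : R, 0 < e ->
  exists2 d : R, 0 < d & forall x, a <= x <= b -> `|x - z| < d -> `|g x - g z| < e.
Proof.
move=> gc azb e e0.
have : g x @[x --> within `[a, b] (nbhs z)] --> g z.
  by have := gc z; rewrite /continuous_at nbhs_subspace_in//= in_itv.
move/cvgrPdist_lt => /(_ _ e0); rewrite near_withinE => -[d /= d0 dP].
exists d => // x xab xz; rewrite distrC; apply: dP => //=.
by rewrite distrC.
Qed.

(** The infimum of the points where g <= 0: continuity forces g = 0 there. This
    turns every persistence statement below into a contradiction at one
    point. *)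
Lemma first_zero g a b : a <= b -> {within `[a, b], continuous g} ->
  0 < g a -> g b <= 0 ->
  exists z, [/\ a < z <= b, g z = 0 & forall x, a <= x < z -> 0 < g x].
Proof.
move=> ab gc ga gb.
pose S := [set x | a <= x <= b /\ g x <= 0].
have Sb : S b by rewrite /S /= ab lexx.
have hS : has_inf S by split; [exists b|exists a => x [/andP[]]].
set z := inf S.
have zb : z <= b by apply: ge_inf => //; case: hS.
have az : a <= z by apply: lb_le_inf; [exists b|move=> x [/andP[]]].
have before x : a <= x < z -> 0 < g x.
  move=> /andP[ax xz]; rewrite ltNge; apply/negP => gx.
  suff /(ge_inf (proj2 hS)) : S x by rewrite leNgt xz.
  by split => //; rewrite ax (ltW (lt_le_trans xz zb)).
have cont := within_segment_dist gc (introT andP (conj az zb)).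
have gz0 : g z <= 0.
  rewrite leNgt; apply/negP => gz; have [d d0 dP] := cont _ gz.
  have [x [xab gx] xz] := inf_lt (proj1 hS) (ltac:(by rewrite ltrDl) : z < z + d).
  have zx : z <= x by apply: ge_inf => //; case: hS.
  have := dP x xab; rewrite ger0_norm ?subr_ge0// ltrBlDl => /(_ xz).
  by rewrite ler0_norm ?subr_le0 ?(le_trans gx)// ?ltW//; lra.
have az' : a < z by rewrite lt_neqAle az andbT; apply/eqP => E; move: ga; rewrite E ltNge gz0.
exists z; split; rewrite ?az' ?zb//.
apply/eqP; rewrite eq_le gz0/= leNgt; apply/negP => gz.
have [d d0 dP] := cont (- g z) ltac:(by rewrite oppr_gt0).
pose x := Num.max a (z - d / 2).
have xz : x < z by rewrite gt_max az' /=; lra.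
have ax : a <= x by rewrite le_max lexx.
have gx := before x ltac:(by rewrite ax).
have := dP x ltac:(by rewrite ax (ltW (lt_le_trans xz zb))).
have : z - d / 2 <= x by rewrite le_max lexx orbT.
rewrite ltr0_norm ?subr_lt0// ger0_norm => [? /(_ _)H|]; last by lra.
by have := H ltac:(lra); lra.
Qed.

(** Linear differential inequalities propagate positivity and vanishing: the
    function is multiplied by a suitable exponential. *)
Lemma gronwall_pos (d dd : R -> R) K a b : a <= b -> {within `[a, b], continuous d} ->
  (forall x, a < x < b -> is_derive x 1 d (dd x)) ->
  (forall x, a < x < b -> - K * d x <= dd x) -> 0 < d a -> 0 < d b.
Proof.
move=> ab dc dP ddP da.
have H : d a * expR (K * a) <= d b * expR (K * b).
  apply: (le_of_deriv_ge0 (f := fun x => d x * expR (K * x))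
    (df := fun x => dd x * expR (K * x) + d x * (expR (K * x) * K)) ab).
  - apply: withinM => //; apply: is_derive_within => x _.
  - move=> x xab; apply: is_derive1M; first exact: dP.
    exact: is_derive1_expRM.
  - move=> x /ddP; have := expR_gt0 (K * x); nra.
by have := expR_gt0 (K * a); have := expR_gt0 (K * b); nra.
Qed.

Lemma gronwall_zero (m dm : R -> R) K a b : a <= b -> {within `[a, b], continuous m} ->
  (forall x, a < x < b -> is_derive x 1 m (dm x)) ->
  (forall x, a < x < b -> dm x <= K * m x) ->
  (forall x, a <= x <= b -> 0 <= m x) -> m a = 0 -> m b = 0.
Proof.
move=> ab mc mP dmP m0 ma; apply/eqP; rewrite eq_le m0 ?ab ?lexx// andbT.
have H : - m a * expR (- K * a) <= - m b * expR (- K * b).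
  apply: (le_of_deriv_ge0 (f := fun x => - m x * expR (- K * x)) (df := fun x =>
    - dm x * expR (- K * x) + - m x * (expR (- K * x) * - K)) ab).
  - apply: withinM; first exact: withinN.
    by apply: is_derive_within => x _.
  - move=> x xab; apply: is_derive1M; first by apply: is_derive1N; exact: mP.
    exact: is_derive1_expRM.
  - move=> x /dmP; have := expR_gt0 (- K * x); nra.
by have := expR_gt0 (- K * b); move: H; rewrite ma; nra.
Qed.

Lemma within_comp (A : set R) (v g : R -> R) : {within A, continuous v} ->
  (forall x, A x -> {for v x, continuous g}) ->
  {within A, continuous (g \o v)}.
Proof.
move=> vc gc; apply/subspace_continuousP => x xA.
apply: cvg_comp; first exact: (proj1 (subspace_continuousP _ _) vc x xA).
exact: gc.
Qed.

Lemma within_segment_of_ray (g : R -> R) r s : 0 <= r -> {within `[0, +oo[, continuous g} ->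
  {within `[r, s], continuous g}.
Proof.
move=> a0; apply: continuous_subspaceW => x /=.
by rewrite !in_itv /= andbT => /andP[/(le_trans a0)].
Qed.

Lemma cvg_right0 (g : R -> R) T : 0 <= T -> {within `[0, +oo[, continuous g} ->
  g r @[r --> T^'+] --> g T.
Proof.
move=> T0 gc; apply/cvgrPdist_lt => eps eps0.
have TT1 : T <= T <= T + 1 by rewrite lexx; lra.
have [d d0 dP] := within_segment_dist (within_segment_of_ray T0 gc) TT1 eps0.
near=> r; have Tr : T < r by near: r; exact: nbhs_right_gt.
have r1 : r <= T + 1 by near: r; apply: nbhs_right_ltW; lra.
have rd : r < T + d by near: r; apply: nbhs_right_lt; lra.
rewrite distrC; apply: dP; first by rewrite ltW.
by rewrite gtr0_norm; lra.
Unshelve. all: by end_near. Qed.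

Lemma cvg_left0 (g : R -> R) T : 0 < T -> {within `[0, +oo[, continuous g} ->
  g r @[r --> T^'-] --> g T.
Proof.
move=> T0 gc; apply/cvgrPdist_lt => eps eps0.
have TT : 0 <= T <= T by rewrite lexx ltW.
have [d d0 dP] := within_segment_dist (within_segment_of_ray (lexx 0) gc) TT eps0.
near=> r; have rT : r < T by near: r; exact: nbhs_left_lt.
have r0 : 0 <= r by near: r; apply: nbhs_left_ge.
have rd : T - d < r by near: r; apply: nbhs_left_gt; lra.
rewrite distrC; apply: dP; first by rewrite r0 ltW.
by rewrite ltr0_norm; lra.
Unshelve. all: by end_near. Qed.

(** One-sided continuity, in the form needed to propagate an equality to the
    right of a point that may be 0. *)
Lemma within_ball_right (g : R -> R) z eps : 0 <= z ->
  {within `[0, +oo[, continuous g} -> 0 < eps ->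
  exists2 d : R, 0 < d & forall r, z <= r <= z + d -> `|g r - g z| < eps.
Proof.
move=> z0 gc eps0.
have zz : z <= z <= z + 1 by rewrite lexx; lra.
have [d d0 dP] := within_segment_dist (within_segment_of_ray z0 gc) zz eps0.
have m1 : Num.min (d / 2) 1 <= d / 2 by rewrite ge_min lexx.
have m2 : Num.min (d / 2) 1 <= 1 by rewrite ge_min lexx orbT.
exists (Num.min (d / 2) 1) => [|r /andP[zr rz]].
  by rewrite lt_min ltr01 divr_gt0.
apply: dP; first by apply/andP; split; lra.
by rewrite ger0_norm; lra.
Qed.

End calculus.

(** * The hypotheses in the form used below *)

Section hypotheses.
Context {R : realType}.
Implicit Types (s t : R) (c : \bar R) (f q dq : R -> R).

Lemma dom_right c s : 0 <= s -> dom c s -> exists2 s' : R, s < s' & dom c s'.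
Proof.
move=> s0; rewrite /dom /=; case: c => [x| |] //.
- rewrite !lte_fin ger0_norm// => sx; exists ((s + x) / 2); first lra.
  by rewrite /= lte_fin ger0_norm; lra.
- by move=> _; exists (s + 1); [lra|rewrite /= ltry].
Qed.

Lemma dom_le c s t : `|s| <= `|t| -> dom c t -> dom c s.
Proof. by move=> st; apply: le_lt_trans; rewrite lee_fin. Qed.

(** F is an integral over [0, s], so it is 0 at negative heights; the energy
    needs the even extension, which is the primitive of the odd function f. *)
Definition Fe (f : R -> R) (s : R) : R := F f `|s|.

(** The odd extension of F / f; below, dkap stands for its derivative. *)
Definition kap (f : R -> R) (s : R) : R := Fe f s / f s.

(** The weight enters the comparison only through monotonicity properties of
    q' / q, h, H, G and their combinations, and through the decay of
    h / q, the integral of 1 / q over [r, +oo[. *)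
Record weight (q dq : R -> R) (C : R) : Prop := Weight {
  q_gt0 : forall r : R, 0 < r -> 0 < q r;
  q_deriv : forall r : R, 0 < r -> is_derive r 1 q (dq r);
  dq_gt0 : forall r : R, 0 < r -> 0 < dq r;
  dlogq_noninc : forall r s : R, 0 < r -> r <= s -> dq s / q s <= dq r / q r;
  h_gt0 : forall r : R, 0 < r -> 0 < h q r;
  h_deriv : forall r : R, 0 < r -> is_derive r 1 (h q) (dq r / q r * h q r - 1);
  h_nondec : forall r s : R, 0 < r -> r <= s -> h q r <= h q s;
  H_gt0 : forall r : R, 0 < r -> 0 < H q r;
  H_deriv : forall r : R, 0 < r -> is_derive r 1 (H q) (h q r);
  H_nondec : forall r s : R, 0 < r -> r <= s -> H q r <= H q s;
  h2H_noninc : forall r s : R, 0 < r -> r <= s ->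
    h q s ^+ 2 * H q r <= h q r ^+ 2 * H q s;
  G_eq : forall r : R, 0 < r -> dq r / q r * H q r = h q r * (G q r + 2^-1);
  G_ge0 : forall r : R, 0 < r -> 0 <= G q r;
  G_leC : forall r : R, 0 < r -> G q r <= C;
  GhH_nondec : forall r s : R, 0 < r -> r <= s ->
    G q r * h q r / Num.sqrt (H q r) <= G q s * h q s / Num.sqrt (H q s);
  G_nondec : forall r s : R, 0 < r -> r <= s -> G q r <= G q s;
  hCG_nondec : forall r s : R, 0 < r -> r <= s ->
    h q r * (C - G q r) <= h q s * (C - G q s);
  q_within : {within `[0, +oo[, continuous q};
  H_at0 : H q 0 = 0;
  H_within : {within `[0, +oo[, continuous (H q)};
  H_le_h2 : exists2 A : R, 0 < A & forall r : R, 0 < r -> H q r <= A * h q r ^+ 2;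
  h_le_q : forall eps : R, 0 < eps -> exists2 r0 : R, 0 < r0 &
    forall r : R, r0 <= r -> h q r <= eps * q r }.

(** f may fail to be Lipschitz at 0, where only its primitive is C^1. *)
Record nonlinearity (c : \bar R) (f dkap : R -> R) (b beta C : R) : Prop :=
  Nonlinearity {
  b_gt0 : 0 < b;
  b_beta : b < beta;
  beta_dom : dom c beta;
  f_odd : forall s : R, dom c s -> f (- s) = - f s;
  f_continuous : forall s : R, dom c s -> {for s, continuous f};
  f_gt0 : forall s : R, b < s -> dom c s -> 0 < f s;
  f_le0 : forall s : R, 0 <= s <= b -> f s <= 0;
  Fe_deriv : forall s : R, dom c s -> is_derive s 1 (Fe f) (f s);
  Fe_le0 : forall s : R, `|s| <= beta -> Fe f s <= 0;
  Fe_beta : forall s : R, `|s| = beta -> Fe f s = 0;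
  Fe_gt0 : forall s : R, beta < `|s| -> dom c s -> 0 < Fe f s;
  kap_deriv : forall s : R, b < `|s| -> dom c s -> is_derive s 1 (kap f) (dkap s);
  dkap_geC : forall s : R, beta < `|s| -> dom c s -> C <= dkap s;
  Fe_0 : Fe f 0 = 0;
  f_lipschitz : forall s : R, s != 0 -> dom c s -> exists K d : R,
    [/\ 0 < K, 0 < d & forall x y : R, `|x - s| < d -> `|y - s| < d ->
      `|f x - f y| <= K * `|x - y|] }.

Lemma Fe_even f s : Fe f (- s) = Fe f s.
Proof. by rewrite /Fe normrN. Qed.

End hypotheses.

(** * Branches *)

Section shooting.
Context {R : realType}.
Variables (c : \bar R) (f dkap q dq : R -> R) (b beta C : R).
Hypotheses (wq : weight q dq C) (nf : nonlinearity c f dkap b beta C).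

Local Notation "'h_" := (Defs.h q).
Local Notation "'H_" := (Defs.H q).
Local Notation "'G_" := (Defs.G q).

(** An increasing branch of a solution u, parametrized by its height s: r is
    the inverse of u and P = u' o r. The equation becomes r' = 1 / P and
    P' = - q' / q - f / P; the last inequality says that the energy is
    positive. *)
Definition branch_at (r P : R -> R) (s : R) : Prop :=
  [/\ [/\ dom c s, 0 < r s, 0 < P s & 0 < P s ^+ 2 + 2 * Fe f s],
      is_derive s 1 r (P s)^-1 &
      is_derive s 1 P (- (dq (r s) / q (r s)) - f s / P s)].

(** H times the energy, corrected by h u' F / f. With x = h P its derivative is
    x ((F / f)' - G) - F / f; the last term depends on the height only and
    cancels when two branches are compared. *)
Definition Qb (r P : R -> R) (s : R) : R :=
  'H_ (r s) * (P s ^+ 2 / 2 + Fe f s) + 'h_ (r s) * P s * kap f s.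

(** Twice H times the energy. Its square root, the function Wb, replaces Qb at the
    heights where F <= 0; both are equivalent at the heights where F = 0. *)
Definition W2b (r P : R -> R) (s : R) : R := 'H_ (r s) * (P s ^+ 2 + 2 * Fe f s).

Definition Wb (r P : R -> R) (s : R) : R := Num.sqrt (W2b r P s).

Definition flux (r P : R -> R) (s : R) : R := 'h_ (r s) * P s.

Lemma is_derive_comp_branch (g : R -> R) r P s a : branch_at r P s ->
  is_derive (r s) 1 g a -> is_derive s 1 (fun t => g (r t)) (a / P s).
Proof. by move=> [_ rD _] gD; exact: is_derive1_comp. Qed.

Lemma Qb_deriv r P s : branch_at r P s -> b < `|s| ->
  is_derive s 1 (Qb r P)
    ('h_ (r s) * P s * (dkap s - 'G_ (r s)) - kap f s).
Proof.
move=> bs bs'; have [[sc r0 P0 I0] rD PD] := bs.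
have HD := is_derive_comp_branch bs (H_deriv wq r0).
have hD := is_derive_comp_branch bs (h_deriv wq r0).
have FD := Fe_deriv nf sc.
have KD := kap_deriv nf bs' sc.
have D := is_derive1D (is_derive1M HD (is_derive1D
  (is_derive1M (is_derive1X2 PD) (is_derive_cst (2^-1 : R) s (1 : R))) FD))
  (is_derive1M (is_derive1M hD PD) KD).
apply: (is_derive_eq D).
have HG := G_eq wq r0.
have fn : f s != 0.
  have [s0|s0] := leP 0 s.
    by rewrite gt_eqF// (f_gt0 nf)//; rewrite ger0_norm in bs'.
  have := f_gt0 nf (s := - s); rewrite ltr0_norm in bs' => //.
  rewrite (f_odd nf sc) /dom /= normrN => /(_ bs' sc).
  by rewrite oppr_gt0 => /lt_eqF ->.
set a := dq (r s) / q (r s) in HG *.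
transitivity ('h_ (r s) / P s * (P s ^+ 2 / 2 + Fe f s)
   - P s * (a * 'H_ (r s)) + ('h_ (r s) * P s * dkap s - kap f s
   - 'h_ (r s) * (Fe f s / P s))).
  rewrite /kap.
  have E : forall (h P F H a f k : R), f != 0 -> P != 0 ->
    h / P * (P ^+ 2 / 2 + F) + H * (2 * P * (- a - f / P) / 2 + P ^+ 2 * 0 + f) +
    (((a * h - 1) / P * P + h * (- a - f / P)) * (F / f) + h * P * k) =
    h / P * (P ^+ 2 / 2 + F) - P * (a * H) + (h * P * k - F / f - h * (F / P)).
    by move=> h p F H a' f' k f0 P0'; field; rewrite ?f0 ?P0'.
  apply: E => //; by rewrite gt_eqF.
rewrite HG; field.
by rewrite gt_eqF.
Qed.

Lemma W2b_deriv r P s : branch_at r P s ->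
  is_derive s 1 (W2b r P)
    (2 * 'h_ (r s) * (Fe f s / P s - 'G_ (r s) * P s)).
Proof.
move=> bs; have [[sc r0 P0 I0] rD PD] := bs.
have HD := is_derive_comp_branch bs (H_deriv wq r0).
have FD := Fe_deriv nf sc.
have D := is_derive1M HD (is_derive1D (is_derive1X2 PD) (is_derive1Z 2 FD)).
apply: (is_derive_eq D).
have HG := G_eq wq r0.
set a := dq (r s) / q (r s) in HG *.
transitivity ('h_ (r s) / P s * (P s ^+ 2 + 2 * Fe f s)
   - 2 * P s * (a * 'H_ (r s))).
  by field; rewrite gt_eqF.
rewrite HG; field.
by rewrite gt_eqF.
Qed.

(** * Comparison of two branches at the same height *)

Section pair.
Variables r1 P1 r2 P2 : R -> R.
Implicit Types s t z : R.

Local Notation x1 := (flux r1 P1).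
Local Notation x2 := (flux r2 P2).
Local Notation Q1 := (Qb r1 P1).
Local Notation Q2 := (Qb r2 P2).
Local Notation W1 := (Wb r1 P1).
Local Notation W2 := (Wb r2 P2).

Definition pair_on (s0 s1 : R) : Prop :=
  forall s : R, s0 <= s <= s1 -> branch_at r1 P1 s /\ branch_at r2 P2 s.

Lemma pair_onS s0 s1 t0 t1 : s0 <= t0 -> t1 <= s1 ->
  pair_on s0 s1 -> pair_on t0 t1.
Proof.
move=> h0 h1 pr s /andP[t0s st1]; apply: pr.
by rewrite (le_trans h0)//= (le_trans st1).
Qed.

Lemma pair_on_oo s0 s1 s : s0 < s < s1 -> s0 <= s <= s1.
Proof. by move=> /andP[/ltW -> /ltW ->]. Qed.

(** The steeper branch gains time: r1' - r2' = 1 / P1 - 1 / P2. *)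
Lemma time_gap_nondec s0 s1 : s0 <= s1 -> pair_on s0 s1 ->
  (forall s : R, s0 < s < s1 -> P1 s <= P2 s) -> r1 s0 - r2 s0 <= r1 s1 - r2 s1.
Proof.
move=> s01 pr P12.
apply: (@le_of_deriv_ge0 R (fun s => r1 s - r2 s)
  (fun s => (P1 s)^-1 - (P2 s)^-1) _ _ s01).
- apply: (@is_derive_within _ _ (fun s => (P1 s)^-1 - (P2 s)^-1)) => s.
  rewrite /= in_itv /= => /pr[[_ D1 _] [_ D2 _]]; exact: is_derive1B.
- by move=> s /pair_on_oo /pr[[_ D1 _] [_ D2 _]]; exact: is_derive1B.
- move=> s ss; have [[[_ _ p1 _] _ _] [[_ _ p2 _] _ _]] := pr _ (pair_on_oo ss).
  by rewrite subr_ge0 lef_pV2// P12.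
Qed.

Let dd s := (- (dq (r2 s) / q (r2 s)) - f s / P2 s) -
            (- (dq (r1 s) / q (r1 s)) - f s / P1 s).

Let dD s0 s1 s : pair_on s0 s1 -> s0 <= s <= s1 ->
  is_derive s 1 (fun s => P2 s - P1 s) (dd s).
Proof. by move=> pr /pr[[_ _ D1] [_ _ D2]]; exact: is_derive1B. Qed.

Let dd_ge s0 s1 s : pair_on s0 s1 -> s0 <= s <= s1 -> r1 s <= r2 s ->
  f s / (P1 s * P2 s) * (P2 s - P1 s) <= dd s.
Proof.
move=> pr /pr[[[_ r1p p1 _] _ _] [[_ r2p p2 _] _ _]] r12.
have H := dlogq_noninc wq r1p r12.
have -> : f s / (P1 s * P2 s) * (P2 s - P1 s) = f s / P1 s - f s / P2 s.
  by field; rewrite !gt_eqF.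
rewrite /dd; lra.
Qed.

(** The term - q' / q is larger for the later branch as q' / q decreases, so
    that (P2 - P1)' >= f (P2 - P1) / (P1 P2), and Gronwall applies on a
    segment. *)
Lemma velocity_gap_pos s0 s1 : s0 <= s1 -> pair_on s0 s1 ->
  (forall s : R, s0 <= s <= s1 -> r1 s <= r2 s) -> P1 s0 < P2 s0 -> P1 s1 < P2 s1.
Proof.
move=> s01 pr r12 P0; rewrite ltNge; apply/negP => Ps1.
have dc t0 t1 : s0 <= t0 -> t1 <= s1 ->
    {within `[t0, t1], continuous (fun s => P2 s - P1 s)}.
  move=> h0 h1; apply: (@is_derive_within _ _ dd) => s.
  by rewrite /= in_itv /= => ss; apply: (dD (pair_onS h0 h1 pr)).
have [||z [/andP[sz zs] dz dpos]] := first_zero s01 (dc _ _ (lexx _) (lexx _)).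
- by rewrite subr_gt0.
- by rewrite subr_le0.
have pz : pair_on s0 z by exact: pair_onS pr.
pose phi s := f s * ((P1 s)^-1 * (P2 s)^-1).
have phic : {within `[s0, z], continuous phi}.
  apply: withinM.
    apply/continuous_in_subspaceT => s; rewrite inE /= in_itv /=.
    by move=> /pz[[[sc _ _ _] _ _] _]; exact: f_continuous nf _ sc.
  apply: withinM.
    apply: (@is_derive_within _ _ (fun s =>
      - (- (dq (r1 s) / q (r1 s)) - f s / P1 s) / P1 s ^+ 2)) => s.
    rewrite /= in_itv /= => /pz[[[_ _ p _] _ D] _].
    by apply: is_derive1V => //; rewrite gt_eqF.
  apply: (@is_derive_within _ _ (fun s =>
    - (- (dq (r2 s) / q (r2 s)) - f s / P2 s) / P2 s ^+ 2)) => s.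
  rewrite /= in_itv /= => /pz[_ [[_ _ p _] _ D]].
  by apply: is_derive1V => //; rewrite gt_eqF.
have [m _ mP] := EVT_min (ltW sz) phic.
suff : 0 < P2 z - P1 z by rewrite dz ltxx.
apply: (@gronwall_pos R (fun s => P2 s - P1 s) dd (- phi m) _ _ (ltW sz)).
- exact: dc.
- by move=> s /pair_on_oo; exact: dD.
- move=> s ss; have ss' := pair_on_oo ss.
  have r12s : r1 s <= r2 s.
    by move: ss' => /andP[? ?]; apply: r12; apply/andP; split => //; lra.
  apply: le_trans (dd_ge pz ss' r12s); rewrite opprK.
  have -> : f s / (P1 s * P2 s) = phi s by rewrite /phi invfM.
  apply: ler_wpM2r; last by apply: mP; rewrite in_itv.
  by apply/ltW/dpos; move: ss => /andP[/ltW -> ->].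
- by rewrite subr_gt0.
Qed.

(** The same differential inequality, when f >= 0. *)
Lemma velocity_gap_nondec s0 s1 : s0 <= s1 -> pair_on s0 s1 ->
  (forall s : R, s0 <= s <= s1 -> [/\ r1 s <= r2 s, P1 s <= P2 s & 0 <= f s]) ->
  P2 s0 - P1 s0 <= P2 s1 - P1 s1.
Proof.
move=> s01 pr Hs.
apply: (@le_of_deriv_ge0 R (fun s => P2 s - P1 s) dd _ _ s01).
- apply: (@is_derive_within _ _ dd) => s.
  by rewrite /= in_itv /= => ss; apply: (dD pr).
- by move=> s /pair_on_oo; exact: dD.
- move=> s /pair_on_oo ss; have [r12 P12 f0] := Hs _ ss.
  apply: le_trans (dd_ge pr ss r12).
  have [[[_ _ p1 _] _ _] [[_ _ p2 _] _ _]] := pr _ ss.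
  by apply: mulr_ge0; [apply: divr_ge0 => //; rewrite mulr_ge0 ?ltW|rewrite subr_ge0].
Qed.

(** (h P)^2 = (h^2 / H) (H P^2) and h^2 / H is nonincreasing. *)
Lemma flux_lt_of_HP2 s : branch_at r1 P1 s -> branch_at r2 P2 s ->
  r2 s <= r1 s -> 'H_ (r1 s) * P1 s ^+ 2 < 'H_ (r2 s) * P2 s ^+ 2 ->
  x1 s < x2 s.
Proof.
move=> [[_ r1p p1 _] _ _] [[_ r2p p2 _] _ _] r21 HP.
rewrite ltNge; apply/negP => x21.
have h1 := h_gt0 wq r1p; have h2 := h_gt0 wq r2p.
have H1 := H_gt0 wq r1p; have H2 := H_gt0 wq r2p.
have hH := h2H_noninc wq r2p r21.
have x2p : 0 <= x2 s by rewrite mulr_ge0 ?ltW.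
have xx : x2 s ^+ 2 <= x1 s ^+ 2 by rewrite ler_pXn2r ?nnegrE// (le_trans x2p).
have A : 'H_ (r2 s) * 'h_ (r1 s) ^+ 2 * x2 s ^+ 2 <=
         'H_ (r1 s) * 'h_ (r2 s) ^+ 2 * x1 s ^+ 2.
  apply: ler_pM; [|exact: sqr_ge0| |exact: xx].
    by rewrite mulr_ge0 ?sqr_ge0 ?(ltW H2).
  by rewrite mulrC [leRHS]mulrC.
have hh : 0 < 'h_ (r1 s) ^+ 2 * 'h_ (r2 s) ^+ 2 by rewrite mulr_gt0 ?exprn_gt0.
move: HP; rewrite -(ltr_pM2l hh) ltNge => /negP; apply.
have -> : 'h_ (r1 s) ^+ 2 * 'h_ (r2 s) ^+ 2 * ('H_ (r2 s) * P2 s ^+ 2) =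
  'H_ (r2 s) * 'h_ (r1 s) ^+ 2 * x2 s ^+ 2 by rewrite /flux; ring.
have -> : 'h_ (r1 s) ^+ 2 * 'h_ (r2 s) ^+ 2 * ('H_ (r1 s) * P1 s ^+ 2) =
  'H_ (r1 s) * 'h_ (r2 s) ^+ 2 * x1 s ^+ 2 by rewrite /flux; ring.
exact: A.
Qed.

Lemma flux_lt_of_velocity s : branch_at r1 P1 s -> branch_at r2 P2 s ->
  r1 s <= r2 s -> P1 s < P2 s -> x1 s < x2 s.
Proof.
move=> [[_ r1p p1 _] _ _] [[_ r2p p2 _] _ _] r12 P12.
have hh := h_nondec wq r1p r12; have h2 := h_gt0 wq r2p.
apply: (@le_lt_trans _ _ ('h_ (r2 s) * P1 s)); first by rewrite ler_wpM2r// ltW.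
by rewrite ltr_pM2l.
Qed.

Lemma velocity_lt_of_flux s : branch_at r1 P1 s -> branch_at r2 P2 s ->
  r2 s <= r1 s -> x1 s < x2 s -> P1 s < P2 s.
Proof.
move=> [[_ r1p p1 _] _ _] [[_ r2p p2 _] _ _] r21 x12.
have hh := h_nondec wq r2p r21; have h2 := h_gt0 wq r2p.
rewrite -(ltr_pM2l h2); apply: le_lt_trans x12.
by rewrite ler_wpM2r// ltW.
Qed.

(** If branch 1 is ahead in time, h (C - G) is smaller for it; if it is late, G
    is larger for it. Both work in the same direction because
    (F / f)' >= C >= G. *)
Lemma Qb_slope_le s : branch_at r1 P1 s -> branch_at r2 P2 s ->
  beta < `|s| -> P1 s <= P2 s -> x1 s <= x2 s ->
  x1 s * (dkap s - 'G_ (r1 s)) <= x2 s * (dkap s - 'G_ (r2 s)).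
Proof.
move=> [[sc r1p p1 _] _ _] [[_ r2p p2 _] _ _] bs P12 x12.
have kC := dkap_geC nf bs sc.
have G1 := G_leC wq r1p; have G2 := G_leC wq r2p.
have h1 := h_gt0 wq r1p; have h2 := h_gt0 wq r2p.
have x1p : 0 < x1 s by rewrite mulr_gt0.
have [r12|/ltW r21] := leP (r1 s) (r2 s).
  have hC := hCG_nondec wq r1p r12.
  have e1 : x1 s * (dkap s - C) <= x2 s * (dkap s - C).
    by rewrite ler_wpM2r// subr_ge0.
  have e2 : P1 s * ('h_ (r1 s) * (C - 'G_ (r1 s))) <=
            P2 s * ('h_ (r2 s) * (C - 'G_ (r2 s))).
    apply: ler_pM; [exact: ltW| |exact: P12|exact: hC].
    by rewrite mulr_ge0 ?subr_ge0// ltW.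
  by move: e1 e2; rewrite /flux; lra.
have GG := G_nondec wq r2p r21.
apply: (@le_trans _ _ (x1 s * (dkap s - 'G_ (r2 s)))).
  by apply: ler_wpM2l; [exact: ltW|lra].
by apply: ler_wpM2r => //; lra.
Qed.

(** Heights with F >= 0. While P1 < P2 and x1 < x2, the gap Q2 - Q1 does not
    decrease. At the first height where one of these inequalities fails,
    either r1 <= r2 there and before, and [velocity_gap_pos] gives P1 < P2, or
    r1 > r2, and then Q1 < Q2 excludes x1 = x2, so that both inequalities
    hold. *)
Lemma outer_stage s0 s1 : s0 <= s1 -> pair_on s0 s1 ->
  (forall s : R, s0 <= s <= s1 -> beta <= `|s|) ->
  (forall s : R, s0 < s < s1 -> beta < `|s|) ->
  P1 s0 < P2 s0 -> x1 s0 < x2 s0 -> Q1 s0 < Q2 s0 ->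
  [/\ P1 s1 < P2 s1, x1 s1 < x2 s1 & Q2 s0 - Q1 s0 <= Q2 s1 - Q1 s1].
Proof.
move=> s01 pr bs bs' P0 x0 Q0.
pose g s := Num.min (P2 s - P1 s) (x2 s - x1 s).
have bb := b_beta nf.
have g_gt0 s : (0 < g s) = (P1 s < P2 s) && (x1 s < x2 s).
  by rewrite /g lt_min !subr_gt0.
pose dQ s := x2 s * (dkap s - 'G_ (r2 s)) - kap f s -
             (x1 s * (dkap s - 'G_ (r1 s)) - kap f s).
have QD s : s0 <= s <= s1 -> is_derive s 1 (fun s => Q2 s - Q1 s) (dQ s).
  move=> ss; have [b1 b2] := pr _ ss; have bbs := lt_le_trans bb (bs _ ss).
  by apply: is_derive1B; exact: Qb_deriv.
have xD s : s0 <= s <= s1 -> is_derive s 1 (fun s => x2 s - x1 s)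
   ((dq (r2 s) / q (r2 s) * 'h_ (r2 s) - 1) / P2 s * P2 s +
    'h_ (r2 s) * (- (dq (r2 s) / q (r2 s)) - f s / P2 s) -
   ((dq (r1 s) / q (r1 s) * 'h_ (r1 s) - 1) / P1 s * P1 s +
    'h_ (r1 s) * (- (dq (r1 s) / q (r1 s)) - f s / P1 s))).
  move=> ss; have [b1 b2] := pr _ ss.
  have [[_ p1 _ _] _ D1] := b1; have [[_ p2 _ _] _ D2] := b2.
  apply: is_derive1B; apply: is_derive1M => //.
    exact: is_derive_comp_branch b2 (h_deriv wq p2).
  exact: is_derive_comp_branch b1 (h_deriv wq p1).
have gc t : t <= s1 -> {within `[s0, t], continuous g}.
  move=> ts1; apply: withinMin.
    apply: (@is_derive_within _ _ dd) => {}s; rewrite /= in_itv /= => /andP[? ?].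
    by apply: (dD pr); apply/andP; split => //; lra.
  apply: is_derive_within => {}s; rewrite /= in_itv /= => /andP[? ?].
  by apply: xD; apply/andP; split => //; lra.
(* The slope comparison needs both inequalities, that is g > 0. *)
have Qgain t : s0 <= t <= s1 -> (forall s : R, s0 <= s < t -> 0 < g s) ->
    Q2 s0 - Q1 s0 <= Q2 t - Q1 t.
  move=> /andP[s0t ts1] gp.
  have st s : s0 < s < t -> s0 <= s <= s1.
    by move=> /andP[? ?]; apply/andP; split; lra.
  apply: (@le_of_deriv_ge0 R (fun s => Q2 s - Q1 s) dQ _ _ s0t).
  - apply: (@is_derive_within _ _ dQ) => s; rewrite /= in_itv /= => /andP[? ?].
    by apply: QD; apply/andP; split => //; lra.
  - by move=> s /st; exact: QD.
  - move=> s ss; have [b1 b2] := pr _ (st _ ss).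
    have /andP[s0s st'] := ss; have := gp s.
    rewrite (ltW s0s) st' g_gt0 => /(_ isT)/andP[/ltW P12 /ltW x12].
    have bss : beta < `|s| by apply: bs'; rewrite s0s (lt_le_trans st').
    by have := Qb_slope_le b1 b2 bss P12 x12; rewrite /dQ; lra.
have g_pos t : s0 <= t <= s1 -> 0 < g t.
  move=> /andP[s0t ts1]; rewrite ltNge; apply/negP => gt.
  have [||z [/andP[s0z zt] gz gpos]] := first_zero s0t (gc _ ts1) => //.
    by rewrite g_gt0 P0.
  have zs1 := le_trans zt ts1.
  have zin : s0 <= z <= s1 by rewrite (ltW s0z).
  have [b1 b2] := pr _ zin.
  have P12 s : s0 <= s < z -> P1 s <= P2 s.
    by move=> /gpos; rewrite g_gt0 => /andP[/ltW].
  suff : 0 < g z by rewrite gz ltxx.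
  rewrite g_gt0; have [r12|/ltW r21] := leP (r1 z) (r2 z).
    suff Pz : P1 z < P2 z by rewrite Pz flux_lt_of_velocity.
    apply: (velocity_gap_pos (ltW s0z)) => //; first exact: pair_onS pr.
    move=> s /andP[s0s sz].
    have H := time_gap_nondec sz (pair_onS s0s zs1 pr).
    suff : r1 s - r2 s <= r1 z - r2 z by lra.
    apply: H => y /andP[sy yz]; apply: P12; rewrite yz andbT.
    by rewrite (le_trans s0s)// ltW.
  have Qz := Qgain _ zin gpos.
  suff xz : x1 z < x2 z by rewrite xz (velocity_lt_of_flux b1 b2).
  rewrite ltNge; apply/negP => x21.
  have xE : x1 z = x2 z.
    apply/eqP; rewrite eq_le x21 andbT -subr_ge0 -gz.
    by rewrite /g ge_min lexx orbT.
  have Fz : 0 <= Fe f z.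
    have := bs z zin; rewrite le_eqVlt => /predU1P[/esym/(Fe_beta nf) -> //|].
    by case: b1 => -[zc _ _ _] _ _ /(Fe_gt0 nf) /(_ zc)/ltW.
  suff : x1 z < x2 z by rewrite ltNge x21.
  apply: flux_lt_of_HP2 => //.
  have r2p : 0 < r2 z by case: b2 => -[].
  have HF : 'H_ (r2 z) * Fe f z <= 'H_ (r1 z) * Fe f z.
    by rewrite ler_wpM2r//; exact: (H_nondec wq r2p).
  have : Q1 z < Q2 z by lra.
  by move: xE; rewrite /Qb /flux => ->; lra.
have s1in : s0 <= s1 <= s1 by rewrite s01 lexx.
have := g_pos _ s1in; rewrite g_gt0 => /andP[-> ->]; split => //.
apply: Qgain => // s /andP[s0s ss1]; apply: g_pos.
by rewrite s0s ltW.
Qed.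

Lemma W2b_gt0 r P s : branch_at r P s -> 0 < W2b r P s.
Proof. by move=> [[_ r0 _ I0] _ _]; rewrite mulr_gt0// (H_gt0 wq r0). Qed.

(** W' = h (F / P - G P) / W. With F <= 0 the two parts of - W' are
    (h |F|) / (P W) and (G h / sqrt H) (P / sqrt (P^2 + 2 F)); for the later and
    less steep branch 1 each factor is larger. *)
Lemma W_slope_le s : branch_at r1 P1 s -> branch_at r2 P2 s ->
  `|s| <= beta -> r2 s <= r1 s -> P1 s <= P2 s ->
  W2b r1 P1 s <= W2b r2 P2 s ->
  'h_ (r1 s) * (Fe f s / P1 s - 'G_ (r1 s) * P1 s) / W1 s <=
  'h_ (r2 s) * (Fe f s / P2 s - 'G_ (r2 s) * P2 s) / W2 s.
Proof.
move=> b1 b2 bs r21 P12 W12.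
have [[_ r1p p1 I1] _ _] := b1; have [[_ r2p p2 I2] _ _] := b2.
have h1 := h_gt0 wq r1p; have h2 := h_gt0 wq r2p.
have H1 := H_gt0 wq r1p; have H2 := H_gt0 wq r2p.
have w1 : 0 < W1 s by rewrite sqrtr_gt0 W2b_gt0.
have w2 : 0 < W2 s by rewrite sqrtr_gt0 W2b_gt0.
have F0 := Fe_le0 nf bs.
have w12 : W1 s <= W2 s by rewrite ler_wsqrtr.
set A := - Fe f s; have A0 : 0 <= A by rewrite oppr_ge0.
have FA : Fe f s = - A by rewrite opprK.
(* Potential part: h increases with r, while P and W are larger for branch 2. *)
have e1 : 'h_ (r2 s) * A / (P2 s * W2 s) <= 'h_ (r1 s) * A / (P1 s * W1 s).
  apply: ler_pM.
  - by apply: mulr_ge0 => //; exact: ltW.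
  - by rewrite invr_ge0 mulr_ge0// ltW.
  - by apply: ler_wpM2r => //; exact: (h_nondec wq).
  rewrite lef_pV2 ?posrE ?mulr_gt0//.
  by apply: ler_pM => //; exact: ltW.
(* Kinetic part: P / sqrt (P^2 + 2 F) decreases with P when F <= 0. *)
have split_W r P : 0 < 'H_ (r s) -> 0 < P s ^+ 2 + 2 * Fe f s ->
    'h_ (r s) * 'G_ (r s) * P s / Num.sqrt (W2b r P s) =
    'G_ (r s) * 'h_ (r s) / Num.sqrt ('H_ (r s)) *
    (P s / Num.sqrt (P s ^+ 2 + 2 * Fe f s)).
  move=> Hp Ip; rewrite sqrtrM ?(ltW Hp)// invfM; ring.
have e2 : 'h_ (r2 s) * 'G_ (r2 s) * P2 s / W2 s <=
          'h_ (r1 s) * 'G_ (r1 s) * P1 s / W1 s.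
  rewrite /Wb !split_W//; apply: ler_pM.
  - by rewrite divr_ge0 ?sqrtr_ge0// mulr_ge0 ?(ltW h2)// (G_ge0 wq).
  - by rewrite divr_ge0 ?sqrtr_ge0 ?(ltW p2).
  - exact: (GhH_nondec wq).
  rewrite ler_pdivrMr ?sqrtr_gt0// mulrAC ler_pdivlMr ?sqrtr_gt0//.
  have E P I : 0 <= P -> P * Num.sqrt I = Num.sqrt (P ^+ 2 * I).
    by move=> P0; rewrite sqrtrM ?sqr_ge0// sqrtr_sqr ger0_norm.
  rewrite !E ?(ltW p1) ?(ltW p2)// ler_wsqrtr// FA.
  have : P1 s ^+ 2 <= P2 s ^+ 2 by rewrite ler_pXn2r ?nnegrE// ltW.
  by nra.
rewrite FA.
have -> : 'h_ (r1 s) * (- A / P1 s - 'G_ (r1 s) * P1 s) / W1 s =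
  - ('h_ (r1 s) * A / (P1 s * W1 s) + 'h_ (r1 s) * 'G_ (r1 s) * P1 s / W1 s).
  by field; rewrite !gt_eqF.
have -> : 'h_ (r2 s) * (- A / P2 s - 'G_ (r2 s) * P2 s) / W2 s =
  - ('h_ (r2 s) * A / (P2 s * W2 s) + 'h_ (r2 s) * 'G_ (r2 s) * P2 s / W2 s).
  by field; rewrite !gt_eqF.
by rewrite lerN2 lerD.
Qed.

Lemma W_deriv r P s : branch_at r P s ->
  is_derive s 1 (Wb r P)
    ('h_ (r s) * (Fe f s / P s - 'G_ (r s) * P s) / Wb r P s).
Proof.
move=> bs; have W0 := W2b_gt0 bs.
have D := is_derive1_comp (is_derive1_sqrt W0) (W2b_deriv bs).
apply: (is_derive_eq D).
have S0 : Num.sqrt (W2b r P s) != 0 by rewrite gt_eqF// sqrtr_gt0.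
move: S0; rewrite /Wb; move: (Num.sqrt _) (Fe _ _ / _ - _) ('h_ _) => x y z x0.
by field.
Qed.

Let dW s := 'h_ (r2 s) * (Fe f s / P2 s - 'G_ (r2 s) * P2 s) / W2 s -
            'h_ (r1 s) * (Fe f s / P1 s - 'G_ (r1 s) * P1 s) / W1 s.

Let WD s0 s1 s : pair_on s0 s1 -> s0 <= s <= s1 ->
  is_derive s 1 (fun s => W2 s - W1 s) (dW s).
Proof. by move=> pr /pr[b1 b2]; apply: is_derive1B; exact: W_deriv. Qed.

Lemma W_gap_nondec s0 s1 : s0 <= s1 -> pair_on s0 s1 ->
  (forall s, s0 < s < s1 -> [/\ `|s| <= beta, r2 s <= r1 s, P1 s <= P2 s &
    W1 s <= W2 s]) ->
  W2 s0 - W1 s0 <= W2 s1 - W1 s1.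
Proof.
move=> s01 pr Hs.
apply: (@le_of_deriv_ge0 R (fun s => W2 s - W1 s) dW _ _ s01).
- apply: (@is_derive_within _ _ dW) => s.
  by rewrite /= in_itv /= => ss; apply: (WD pr).
- by move=> s /pair_on_oo; exact: WD.
- move=> s ss; have [bs r21 P12 W12] := Hs _ ss.
  have [b1 b2] := pr _ (pair_on_oo ss).
  rewrite /dW subr_ge0; apply: W_slope_le => //.
  by move: W12; rewrite /Wb ler_sqrt// ltW// W2b_gt0.
Qed.

(** P^2 = W^2 / H - 2 F, and H is larger for the later branch. *)
Lemma velocity_lt_of_W s : branch_at r1 P1 s -> branch_at r2 P2 s ->
  `|s| <= beta -> r2 s <= r1 s -> W1 s < W2 s -> P1 s < P2 s.
Proof.
move=> b1 b2 bs r21 W12.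
have [[_ r1p p1 I1] _ _] := b1; have [[_ r2p p2 I2] _ _] := b2.
have HH := H_nondec wq r2p r21; have H2 := H_gt0 wq r2p.
have : W2b r1 P1 s < W2b r2 P2 s by rewrite -ltr_sqrt// W2b_gt0.
rewrite /W2b => H.
have : 'H_ (r2 s) * (P1 s ^+ 2 + 2 * Fe f s) <
       'H_ (r2 s) * (P2 s ^+ 2 + 2 * Fe f s).
  by apply: le_lt_trans H; rewrite ler_wpM2r// ltW.
rewrite ltr_pM2l// ltrD2r => PP.
by rewrite -(@ltr_pXn2r _ 2) ?nnegrE// ltW.
Qed.

Lemma W_lt_of_velocity s : branch_at r1 P1 s -> branch_at r2 P2 s ->
  r1 s <= r2 s -> P1 s < P2 s -> W1 s < W2 s.
Proof.
move=> b1 b2 r12 P12.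
have [[_ r1p p1 I1] _ _] := b1; have [[_ r2p p2 I2] _ _] := b2.
have HH := H_nondec wq r1p r12; have H2 := H_gt0 wq r2p.
rewrite ltr_sqrt; last exact: W2b_gt0.
apply: (@le_lt_trans _ _ ('H_ (r2 s) * (P1 s ^+ 2 + 2 * Fe f s))).
  by rewrite ler_wpM2r// ltW.
by rewrite ltr_pM2l// ltrD2r ltr_pXn2r ?nnegrE// ltW.
Qed.

(** Heights with F <= 0, by the first failure of P1 < P2 or W1 < W2. If r1 <= r2
    at that height then also before, and [velocity_gap_pos] applies; if
    r1 > r2, then r1 >= r2 on a segment ending there, on which W2 - W1 does
    not decrease. *)
Lemma inner_stage s0 s1 : s0 <= s1 -> pair_on s0 s1 ->
  (forall s, s0 <= s <= s1 -> `|s| <= beta) ->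
  P1 s0 < P2 s0 -> W1 s0 < W2 s0 -> P1 s1 < P2 s1 /\ W1 s1 < W2 s1.
Proof.
move=> s01 pr bs P0 W0.
pose g s := Num.min (P2 s - P1 s) (W2 s - W1 s).
have g_gt0 s : (0 < g s) = (P1 s < P2 s) && (W1 s < W2 s).
  by rewrite /g lt_min !subr_gt0.
have gc t : t <= s1 -> {within `[s0, t], continuous g}.
  move=> ts1; apply: withinMin.
    apply: (@is_derive_within _ _ dd) => {}s; rewrite /= in_itv /= => /andP[? ?].
    by apply: (dD pr); apply/andP; split => //; lra.
  apply: (@is_derive_within _ _ dW) => {}s; rewrite /= in_itv /= => /andP[? ?].
  by apply: (WD pr); apply/andP; split => //; lra.
suff : 0 < g s1 by rewrite g_gt0 => /andP[].
rewrite ltNge; apply/negP => gt.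
have [||z [/andP[s0z zs1] gz gpos]] := first_zero s01 (gc _ (lexx _)) => //.
  by rewrite g_gt0 P0.
have zin : s0 <= z <= s1 by rewrite (ltW s0z).
have [b1 b2] := pr _ zin.
have P12 s : s0 <= s < z -> P1 s <= P2 s.
  by move=> /gpos; rewrite g_gt0 => /andP[/ltW].
have gap s t : s0 <= s -> s <= t -> t <= z -> r1 s - r2 s <= r1 t - r2 t.
  move=> s0s st tz; apply: (time_gap_nondec st).
    by apply: (pair_onS s0s _ pr); rewrite (le_trans tz).
  move=> y /andP[sy yt]; apply: P12; rewrite (lt_le_trans yt tz) andbT.
  by rewrite (le_trans s0s)// ltW.
suff : 0 < g z by rewrite gz ltxx.
rewrite g_gt0; have [r12|r21] := leP (r1 z) (r2 z).
  suff Pz : P1 z < P2 z by rewrite Pz W_lt_of_velocity.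
  apply: (velocity_gap_pos (ltW s0z)) => //; first exact: pair_onS pr.
  by move=> s /andP[s0s sz]; have := gap _ _ s0s sz (lexx _); lra.
have [y [s0y yz ry]] : exists y, [/\ s0 <= y, y < z & r2 y <= r1 y].
  have rc : {within `[s0, z], continuous (fun s => r1 s - r2 s)}.
    apply: (@is_derive_within _ _ (fun s => (P1 s)^-1 - (P2 s)^-1)) => s.
    rewrite /= in_itv /= => /andP[s0s sz].
    have [|[_ D1 _] [_ D2 _]] := pr s; last exact: is_derive1B.
    by rewrite s0s (le_trans sz).
  have gap0 : 0 < r1 z - r2 z by rewrite subr_gt0.
  have [d d0 dP] := within_segment_dist rc
    (introT andP (conj (ltW s0z) (lexx z))) gap0.
  exists (Num.max s0 (z - d / 2)); split; first by rewrite le_max lexx.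
    by rewrite gt_max s0z /=; lra.
  have := dP (Num.max s0 (z - d / 2)); rewrite le_max lexx /= ge_max (ltW s0z) /=.
  have -> : z - d / 2 <= z by lra.
  move=> /(_ isT); rewrite ler0_norm; last first.
    by rewrite subr_le0 ge_max (ltW s0z) /=; lra.
  have : z - d / 2 <= Num.max s0 (z - d / 2) by rewrite le_max lexx orbT.
  move=> Hm /(_ ltac:(lra)); rewrite ltr_norml => /andP[].
  by set m := Num.max _ _; lra.
have ryz t : y <= t -> t <= z -> r2 t <= r1 t.
  by move=> yt tz; have := gap _ _ s0y yt tz; lra.
have W12 t : s0 <= t < z -> W1 t < W2 t.
  by move=> /gpos; rewrite g_gt0 => /andP[].
have Wz : W1 z < W2 z.
  have := W12 y; rewrite s0y yz => /(_ isT); rewrite -subr_gt0 => Wy.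
  rewrite -subr_gt0; apply: lt_le_trans Wy _.
  apply: (W_gap_nondec (ltW yz)); first exact: pair_onS pr.
  move=> t /andP[yt tz]; have s0t := le_trans s0y (ltW yt); split.
  - by apply: bs; rewrite s0t (le_trans (ltW tz)).
  - by apply: ryz; exact: ltW.
  - by apply: P12; rewrite s0t.
  - by apply/ltW/W12; rewrite s0t.
by rewrite Wz (velocity_lt_of_W b1 b2)// ?bs// ltW.
Qed.

(** The order between two branches, at a common height, that is restored after
    each turn. *)
Definition ahead s := [/\ P1 s < P2 s, x1 s < x2 s & Q1 s < Q2 s].

Lemma Qb_beta r P s : `|s| = beta -> Qb r P s = W2b r P s / 2.
Proof.
move=> sb; rewrite /Qb /W2b /kap (Fe_beta nf sb).
by rewrite mul0r !mulr0 !addr0 mulrA.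
Qed.

Lemma W2b_ltE s : branch_at r2 P2 s ->
  (W1 s < W2 s) = (W2b r1 P1 s < W2b r2 P2 s).
Proof. by move=> b2; rewrite /Wb ltr_sqrt// (W2b_gt0 b2). Qed.

Lemma ahead_inner s0 s1 : s0 < - beta -> - beta <= s1 <= beta ->
  pair_on s0 s1 -> ahead s0 -> P1 s1 < P2 s1 /\ W1 s1 < W2 s1.
Proof.
move=> s0b /andP[bs1 s1b] pr [P0 x0 Q0].
have b0 := b_gt0 nf; have bb := b_beta nf.
have nb s : s <= - beta -> `|s| = - s by move=> ?; rewrite ler0_norm//; lra.
have [Pb xb Qb'] : [/\ P1 (- beta) < P2 (- beta), x1 (- beta) < x2 (- beta) &
    Q2 s0 - Q1 s0 <= Q2 (- beta) - Q1 (- beta)].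
  apply: (outer_stage (ltW s0b)) => //; first exact: pair_onS pr.
    by move=> s /andP[_ sb]; rewrite nb//; lra.
  by move=> s /andP[_ sb]; rewrite nb//; lra.
apply: (inner_stage bs1) => //; first exact: pair_onS (ltW s0b) _ pr.
  by move=> s /andP[? ?]; rewrite ler_norml; apply/andP; split => //; lra.
have nbb : `|- beta| = beta by rewrite nb// opprK.
have [_ b2] := pr (- beta) ltac:(by rewrite (ltW s0b)).
by rewrite W2b_ltE//; move: Q0 Qb'; rewrite !(Qb_beta _ _ nbb); lra.
Qed.

(** The three stages [s0, - beta], [- beta, beta] and [beta, e[ are chained; at
    the heights - beta and beta, F = 0 makes Q1 < Q2 and W1 < W2 equivalent.
    The bound m is uniform so as to survive the limit s -> e. *)
Lemma ahead_outer s0 e : s0 < - beta -> beta < e ->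
  (forall s, s0 <= s < e -> branch_at r1 P1 s /\ branch_at r2 P2 s) ->
  ahead s0 ->
  exists2 m, 0 < m & forall s, beta <= s < e ->
    P1 s < P2 s /\ m <= Q2 s - Q1 s.
Proof.
move=> s0b be pr ah.
have b0 := b_gt0 nf; have bb := b_beta nf.
have pr' t : t < e -> pair_on s0 t.
  by move=> te s /andP[s0s st]; apply: pr; rewrite s0s (le_lt_trans st).
have prb := pr' _ be.
have [Pb Wb] := ahead_inner s0b (introT andP (conj (ltac:(lra) : - beta <= beta)
  (lexx beta))) prb ah.
have [b1 b2] := prb beta ltac:(apply/andP; split; lra).
have nbb : `|beta| = beta by rewrite ger0_norm//; lra.
have Qb : Q1 beta < Q2 beta.
  by rewrite !(Qb_beta _ _ nbb) ltr_pM2r// -W2b_ltE.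
have xb : x1 beta < x2 beta.
  have [r12|/ltW r21] := leP (r1 beta) (r2 beta).
    exact: (flux_lt_of_velocity b1 b2).
  apply: (flux_lt_of_HP2 b1 b2) => //.
  by move: Wb; rewrite W2b_ltE// /W2b (Fe_beta nf nbb) mulr0 !addr0.
exists (Q2 beta - Q1 beta) => [|s /andP[bs se]]; first by rewrite subr_gt0.
have prbs : pair_on beta s by apply: (pair_onS _ (lexx s) (pr' _ se)); lra.
by have [] := outer_stage bs prbs
  (ltac:(by move=> t /andP[bt _]; rewrite ger0_norm//; lra))
  (ltac:(by move=> t /andP[bt _]; rewrite ger0_norm//; lra)) Pb xb Qb.
Qed.

(** If r1 < r2 up to e, then P2 > P2 - P1, which does not decrease where f > 0,
    so that P2 cannot tend to 0. If r1 >= r2 near e, then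
    Q2 - Q1 <= H(r2) P2^2 / 2 + h(r2) P2 F / f, which tends to 0. *)
Lemma not_reach_rest_first s0 e T : s0 < - beta -> beta < e -> dom c e ->
  (forall s, s0 <= s < e -> branch_at r1 P1 s /\ branch_at r2 P2 s) ->
  ahead s0 ->
  (forall s, beta <= s < e -> r2 s <= T) ->
  ~ (forall eps, 0 < eps -> exists2 t, t < e & forall s, t < s < e -> P2 s < eps).
Proof.
move=> s0b be ec pr ah r2T lim.
have b0 := b_gt0 nf; have bb := b_beta nf.
have [m m0 mP] := ahead_outer s0b be pr ah.
have pr' t : t < e -> pair_on s0 t.
  by move=> te s /andP[s0s st]; apply: pr; rewrite s0s (le_lt_trans st).
have dome s : beta <= s <= e -> dom c s.
  move=> /andP[bs se]; apply: le_lt_trans ec.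
  by rewrite lee_fin !ger0_norm//; lra.
have [[s1 [/andP[bs1 s1e] rs1]]|r12] :=
  pselect (exists s, beta <= s < e /\ r2 s <= r1 s).
  have kc : {within `[beta, e], continuous (kap f)}.
    apply: (@is_derive_within _ _ dkap) => s; rewrite /= in_itv /= => bs.
    apply: (kap_deriv nf); last exact: dome.
    by rewrite ger0_norm; case/andP: bs => ? ?; lra.
  have [y _ yP] := EVT_max (ltW be) kc.
  have T0 : 0 < T.
    apply: lt_le_trans (r2T beta ltac:(by rewrite lexx)).
    by have [|_ [[]]] := pr beta => //; apply/andP; split; lra.
  pose M := Num.max 0 (kap f y).
  have M0 : 0 <= M by rewrite le_max lexx.
  pose A := 'H_ T + 'h_ T * M + 1.
  have hT := h_gt0 wq T0; have HT := H_gt0 wq T0.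
  have A0 : 0 < A by rewrite /A; nra.
  pose eps := Num.min 1 (m / (2 * A)).
  have eps0 : 0 < eps by rewrite lt_min ltr01 divr_gt0// mulr_gt0.
  have [t te tP] := lim _ eps0.
  pose s := (Num.max s1 t + e) / 2.
  have mt : t <= Num.max s1 t by rewrite le_max lexx orbT.
  have ms : s1 <= Num.max s1 t by rewrite le_max lexx.
  have me : Num.max s1 t < e by rewrite gt_max s1e.
  have se : s < e by rewrite /s; lra.
  have s1s : s1 <= s by rewrite /s; lra.
  have bs := le_trans bs1 s1s.
  have [P12 mQ] := mP s ltac:(by rewrite bs).
  have [b1 b2] := pr s ltac:(apply/andP; split; lra).
  have rs : r2 s <= r1 s.
    suff : r1 s1 - r2 s1 <= r1 s - r2 s by lra.
    apply: (time_gap_nondec s1s); first by apply: (pair_onS _ (lexx s) (pr' _ se)); lra.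
    move=> z /andP[s1z zs].
    by have [/ltW] := mP z ltac:(apply/andP; split; lra).
  have Peps : P2 s < eps by apply: tP; rewrite se andbT /s; lra.
  have [[_ r1p p1 _] _ _] := b1; have [[sc r2p p2 _] _ _] := b2.
  have HH := H_nondec wq r2p rs.
  have r2s := r2T s ltac:(by rewrite bs).
  have HT2 := H_nondec wq r2p r2s; have hT2 := h_nondec wq r2p r2s.
  have h1 := h_gt0 wq r1p; have h2 := h_gt0 wq r2p; have H2 := H_gt0 wq r2p.
  have H1 := H_gt0 wq r1p.
  have F0 : 0 <= Fe f s.
    move: bs; rewrite le_eqVlt => /predU1P[bE|bs].
      by rewrite (Fe_beta nf)// -bE ger0_norm// ltW// (lt_trans b0).
    apply/ltW/(Fe_gt0 nf) => //.
    by rewrite ger0_norm// ltW// (lt_trans _ bs)// (lt_trans b0).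
  have f0 : 0 < f s by apply: (f_gt0 nf) => //; exact: lt_le_trans bs.
  have k0 : 0 <= kap f s by rewrite divr_ge0// ltW.
  have kM : kap f s <= M.
    by rewrite le_max yP ?orbT// in_itv /= bs ltW.
  have e1 : P2 s < 1 by move: Peps; rewrite lt_min => /andP[].
  have e2 : P2 s * (2 * A) < m.
    by move: Peps; rewrite lt_min ltr_pdivlMr ?mulr_gt0// => /andP[].
  have x1k : 0 <= 'h_ (r1 s) * P1 s * kap f s by rewrite mulr_ge0// mulr_ge0// ltW.
  have HF : 'H_ (r2 s) * Fe f s <= 'H_ (r1 s) * Fe f s by rewrite ler_wpM2r.
  have HP1 : 0 <= 'H_ (r1 s) * P1 s ^+ 2 by rewrite mulr_ge0 ?sqr_ge0// ltW.
  have HP2 : 'H_ (r2 s) * P2 s ^+ 2 <= 'H_ T * P2 s.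
    apply: ler_pM; rewrite ?sqr_ge0 ?(ltW H2)//.
    by rewrite expr2 -[leRHS]mul1r ler_wpM2r// ltW.
  have x2k : 'h_ (r2 s) * P2 s * kap f s <= 'h_ T * P2 s * M.
    apply: ler_pM => //; first by rewrite mulr_ge0// ltW.
    by rewrite ler_wpM2r// ltW.
  have a1 : 0 <= 'H_ T * P2 s by rewrite mulr_ge0// ltW.
  have a2 : 0 <= 'h_ T * P2 s * M by rewrite mulr_ge0// mulr_ge0// ltW.
  by move: mQ; rewrite /Qb; rewrite /A in e2; lra.
have [m1 m10 m1P] : exists2 m1, 0 < m1 & forall s, beta <= s < e ->
    m1 <= P2 s - P1 s.
  exists (P2 beta - P1 beta).
    by have [|+ _] := mP beta; rewrite ?lexx// subr_gt0.
  move=> s /andP[bs se].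
  apply: (velocity_gap_nondec bs).
    by apply: (pair_onS _ (lexx s) (pr' _ se)); lra.
  move=> z /andP[bz zs]; split.
  - rewrite leNgt; apply/negP => r21; apply: r12; exists z.
    by rewrite bz (le_lt_trans zs se) ltW.
  - have [|/ltW //] := mP z; first by rewrite bz (le_lt_trans zs).
  - by apply/ltW/(f_gt0 nf); [lra|apply: dome; rewrite bz; lra].
have [t te tP] := lim _ m10.
pose s := (Num.max beta t + e) / 2.
have mt : t <= Num.max beta t by rewrite le_max lexx orbT.
have ms : beta <= Num.max beta t by rewrite le_max lexx.
have me : Num.max beta t < e by rewrite gt_max be.
have se : s < e by rewrite /s; lra.
have bs : beta <= s by rewrite /s; lra.
have [[[_ _ p1 _] _ _] _] := pr s ltac:(apply/andP; split; lra).
have := tP s ltac:(apply/andP; rewrite /s; split; lra).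
have := m1P s ltac:(by rewrite bs).
by lra.
Qed.

(** A decaying branch ends at height 0 with P2 -> 0 and W2 -> 0. This
    contradicts the growth of P2 - P1 on [- b, 0[, where f >= 0, if r1 < r2
    there, and the growth of W2 - W1 if r1 >= r2 at some point. *)
Lemma not_both_decay s0 : s0 < - beta ->
  (forall s, s0 <= s < 0 -> branch_at r1 P1 s /\ branch_at r2 P2 s) ->
  ahead s0 ->
  ~ (forall eps, 0 < eps -> exists2 t, t < 0 &
       forall s, t < s < 0 -> P2 s < eps /\ W2 s < eps).
Proof.
move=> s0b pr ah lim.
have b0 := b_gt0 nf; have bb := b_beta nf.
have pr' t : t < 0 -> pair_on s0 t.
  by move=> te s /andP[s0s st]; apply: pr; rewrite s0s (le_lt_trans st).
have inner s : - beta <= s < 0 -> P1 s < P2 s /\ W1 s < W2 s.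
  move=> /andP[bs se]; apply: (ahead_inner s0b _ (pr' _ se) ah).
  by apply/andP; split; lra.
have late t y : t < 0 -> y < 0 -> exists s, [/\ t < s, y <= s & s < 0].
  move=> t0 y0; exists (Num.max t y / 2).
  have : Num.max t y < 0 by rewrite gt_max t0.
  have : t <= Num.max t y by rewrite le_max lexx.
  have : y <= Num.max t y by rewrite le_max lexx orbT.
  by move=> *; split; lra.
have [[y [/andP[by' ye] ry]]|r12] :=
  pselect (exists s, - b <= s < 0 /\ r2 s <= r1 s).
  have [_ Wy] := inner y ltac:(apply/andP; split; lra).
  have m0 : 0 < W2 y - W1 y by rewrite subr_gt0.
  have [t t0 tP] := lim _ m0.
  have [s [ts ys se]] := late _ _ t0 ye.
  have prs : pair_on y s by apply: (pair_onS _ (lexx s) (pr' _ se)); lra.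
  have P12 z : y <= z <= s -> P1 z < P2 z /\ W1 z < W2 z.
    by move=> /andP[? ?]; apply: inner; apply/andP; split; lra.
  have [_ Ws] := tP s ltac:(by rewrite ts).
  suff : W2 y - W1 y <= W2 s - W1 s.
    by move=> /(lt_le_trans Ws); rewrite ltNge gerBl sqrtr_ge0.
  apply: (W_gap_nondec ys prs) => z /andP[yz zs].
  have [Pz Wz] := P12 z ltac:(by rewrite !ltW).
  split; [|  |exact: ltW|exact: ltW].
    rewrite ler_norml (ltW (lt_trans (lt_trans zs se) (lt_trans b0 bb))) andbT.
    by rewrite (le_trans _ (le_trans by' (ltW yz)))// lerN2 ltW.
  rewrite -subr_ge0; apply: (@le_trans _ _ (r1 y - r2 y)); first by rewrite subr_ge0.
  apply: (time_gap_nondec (ltW yz)); first exact: pair_onS (lexx y) (ltW zs) prs.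
  move=> w /andP[yw wz].
  by have [/ltW] := P12 w (introT andP (conj (ltW yw) (ltW (lt_trans wz zs)))).
have [Pb _] := inner (- b) ltac:(apply/andP; split; lra).
have m0 : 0 < P2 (- b) - P1 (- b) by rewrite subr_gt0.
have [t t0 tP] := lim _ m0.
have nb : - b < 0 by lra.
have [s [ts ys se]] := late _ _ t0 nb.
have [Ps _] := tP s ltac:(by rewrite ts).
have [[[_ _ p1 _] _ _] _] := pr s ltac:(apply/andP; split; lra).
suff : P2 (- b) - P1 (- b) <= P2 s - P1 s by lra.
apply: (velocity_gap_nondec ys).
  by apply: (pair_onS _ (lexx s) (pr' _ se)); lra.
move=> z /andP[bz zs]; have ze := le_lt_trans zs se; split.
- rewrite leNgt; apply/negP => r21; apply: r12; exists z.
  by rewrite bz ze ltW.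
- by have [] := inner z ltac:(apply/andP; split; lra); move=> /ltW.
- have zd : dom c (- z).
    apply: le_lt_trans (beta_dom nf); rewrite lee_fin normrN ler0_norm; last lra.
    by rewrite ger0_norm; lra.
  rewrite -[z]opprK (f_odd nf zd) oppr_ge0; apply: (f_le0 nf).
  by apply/andP; split; lra.
Qed.

End pair.

(** * Solutions *)

Implicit Types r s t y z S T : R.

(** At r = 0 the solution is only controlled through continuity from the
    right, hence the continuity on [0, +oo[ and the derivatives on r > 0. *)
Record sol (v dv : R -> R) : Prop := Sol {
  v_dom : forall r : R, 0 <= r -> dom c (v r);
  v_within : {within `[0, +oo[, continuous v};
  dv_within : {within `[0, +oo[, continuous dv};
  dv0 : dv 0 = 0;
  v_deriv : forall r : R, 0 < r -> is_derive r 1 v (dv r);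
  dv_deriv : forall r : R, 0 < r ->
    is_derive r 1 dv (- (dq r / q r) * dv r - f (v r));
  v_lim : v r @[r --> +oo] --> (0 : R) }.

Definition energy (v dv : R -> R) (r : R) : R := dv r ^+ 2 / 2 + Fe f (v r).

Section one_solution.
Variables v dv : R -> R.
Hypothesis sv : sol v dv.

Local Notation e := (energy v dv).

Lemma energy_deriv r : 0 < r ->
  is_derive r 1 e (- (dq r / q r) * dv r ^+ 2).
Proof.
move=> r0; have D1 := v_deriv sv r0; have D2 := dv_deriv sv r0.
have D3 := is_derive1_comp (Fe_deriv nf (v_dom sv (ltW r0))) D1.
have D := is_derive1D (is_derive1M (is_derive1X2 D2)
  (is_derive_cst (2^-1 : R) r (1 : R))) D3.
apply: (is_derive_eq D); rewrite mulr0 addr0.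
have E : forall x y w : R,
    2 * y * (- x * y - w) / 2 + w * y = - x * y ^+ 2 by move=> x y w; field.
exact: E.
Qed.

Lemma energy_within : {within `[0, +oo[, continuous e}.
Proof.
apply: withinD; last first.
  apply: (within_comp (g := Fe f)); first exact: v_within sv.
  move=> x; rewrite /= in_itv /= andbT => x0.
  exact: is_derive1_continuous (Fe_deriv nf (v_dom sv x0)).
have dc := dv_within sv.
by apply: withinM; [exact: (withinM dc dc)|exact: within_cst].
Qed.

Lemma energy_noninc r s : 0 <= r -> r <= s -> e s <= e r.
Proof.
move=> r0 rs; rewrite -lerN2.
apply: (@le_of_deriv_ge0 R (fun r => - e r) (fun r => - (- (dq r / q r) * dv r ^+ 2)) _ _ rs).
- by apply: withinN; apply: within_segment_of_ray r0 energy_within.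
- by move=> x /andP[rx _]; apply: is_derive1N; apply: energy_deriv; exact: le_lt_trans rx.
- move=> x /andP[rx _]; have x0 := le_lt_trans r0 rx.
  by rewrite mulNr opprK mulr_ge0 ?sqr_ge0// divr_ge0// ltW// ?(q_gt0 wq)// (dq_gt0 wq).
Qed.

Lemma eventually_small eps : 0 < eps -> exists2 r0, 0 < r0 & forall r, r0 <= r -> `|v r| < eps.
Proof.
move=> eps0; have /cvgrPdist_lt /(_ _ eps0) [M [_ MP]] := v_lim sv.
exists (Num.max 1 (M + 1)) => [|r]; first by rewrite lt_max ltr01.
rewrite ge_max => /andP[_ Mr]; have := MP r ltac:(lra).
by rewrite sub0r normrN.
Qed.

Lemma Fe_near0 eps : 0 < eps -> exists2 d : R, 0 < d &
  forall s : R, `|s| < d -> `|Fe f s| < eps.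
Proof.
move=> eps0.
have d0 : dom c 0.
  apply: le_lt_trans (beta_dom nf); rewrite lee_fin normr0; exact: normr_ge0.
have /cvgrPdist_lt /(_ _ eps0) [d /= dp dP] :=
  is_derive1_continuous (Fe_deriv nf d0).
exists d => // s sd; have /= := dP s; rewrite sub0r normrN => /(_ sd).
by rewrite (Fe_0 nf) sub0r normrN.
Qed.

(** The energy decreases, and F(v) -> 0. *)
Lemma energy_ge0 r : 0 <= r -> 0 <= e r.
Proof.
move=> r0; rewrite leNgt; apply/negP => er.
have er' : 0 < - e r by rewrite oppr_gt0.
have [d d0 dP] := Fe_near0 er'.
have [r1 r10 r1P] := eventually_small d0.
have m1 : r <= Num.max r r1 by rewrite le_max lexx.
have m2 : r1 <= Num.max r r1 by rewrite le_max lexx orbT.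
have := energy_noninc r0 m1; have := dP _ (r1P _ m2).
rewrite ltr_norml => /andP[]; have := sqr_ge0 (dv (Num.max r r1)).
have : e (Num.max r r1) = dv (Num.max r r1) ^+ 2 / 2 + Fe f (v (Num.max r r1)).
  by [].
by lra.
Qed.

(** The energy then stays 0, so its derivative - (q' / q) v'^2 vanishes, v is
    constant, and its limit is 0. *)
Lemma energy_eq0 r0 : 0 <= r0 -> e r0 = 0 ->
  forall r, r0 <= r -> v r = 0 /\ dv r = 0.
Proof.
move=> r00 e0.
have ez r : r0 <= r -> e r = 0.
  move=> rr; apply/eqP; rewrite eq_le energy_ge0 ?(le_trans r00)// andbT -e0.
  exact: energy_noninc.
have dvz r : r0 < r -> dv r = 0.
  move=> rr; have rp := le_lt_trans r00 rr.
  have D1 := energy_deriv rp.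
  have D2 : is_derive r 1 e 0.
    apply: near_eq_is_derive (is_derive_cst (0 : R) r (1 : R)).
    by near=> y; rewrite /= ez//; apply: ltW; near: y; exact: lt_nbhsr.
  have [_ E1] := D1; have [_ E2] := D2.
  have /eqP := etrans (esym E1) E2.
  rewrite mulf_eq0 oppr_eq0 sqrf_eq0 => /orP[|/eqP//].
  by rewrite gt_eqF// divr_gt0// ?(dq_gt0 wq) ?(q_gt0 wq).
have vc r s : r0 <= r -> r <= s -> v r = v s.
  move=> rr rs; move: (rs); rewrite le_eqVlt => /predU1P[->//|rs'].
  have r0' := le_trans r00 rr.
  have vD x : x \in `]r, s[%R -> is_derive x 1 v (dv x).
    rewrite in_itv /= => /andP[rx _]; apply: (v_deriv sv).
    exact: le_lt_trans rx.
  have [x + /eqP] := MVT rs' vD (within_segment_of_ray r0' (v_within sv)).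
  rewrite in_itv /= => /andP[rx _]; rewrite dvz ?(le_lt_trans rr)// mul0r.
  by rewrite subr_eq0 => /eqP.
have v0 r : r0 <= r -> v r = 0.
  move=> rr; apply/eqP; rewrite -normr_le0 leNgt; apply/negP => vr.
  have [s _ sP] := eventually_small vr.
  have m1 : r <= Num.max r s by rewrite le_max lexx.
  have := sP (Num.max r s); rewrite le_max lexx orbT => /(_ isT).
  by rewrite -(vc _ _ rr m1) ltxx.
move=> r rr; split; first exact: v0.
have := ez _ rr; rewrite /energy v0// (Fe_0 nf) addr0 => /eqP.
by rewrite mulf_eq0 sqrf_eq0 invr_eq0 pnatr_eq0 orbF => /eqP.
Unshelve. all: by end_near. Qed.

End one_solution.

(** An increasing branch on ]T, rs[, with rs possibly infinite, running from
    height v T to height E, with inverse g. *)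
Record rising (v dv : R -> R) (T : R) (rs : \bar R) (E : R) (g : R -> R) : Prop :=
  Rising {
  rise_lt : (T%:E < rs)%E;
  rise_dv : forall r : R, T < r -> (r%:E < rs)%E -> 0 < dv r;
  rise_rng : forall r : R, T < r -> (r%:E < rs)%E -> v T < v r < E;
  rise_gv : forall r : R, T < r -> (r%:E < rs)%E -> g (v r) = r;
  rise_g : forall s : R, v T < s < E -> T < g s /\ ((g s)%:E < rs)%E;
  rise_vg : forall s : R, v T < s < E -> v (g s) = s;
  rise_branch : forall s : R, v T < s < E -> branch_at g (dv \o g) s }.

Section one_solution.
Variables v dv : R -> R.
Hypothesis sv : sol v dv.

Local Notation e := (energy v dv).

Lemma v_lt (r s : R) : 0 <= r -> r < s ->
  (forall y : R, r < y < s -> 0 < dv y) -> v r < v s.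
Proof.
move=> r0 rs dvp; apply: (@lt_of_deriv_gt0 R v dv r s rs).
- exact: within_segment_of_ray r0 (v_within sv).
- by move=> y /andP[ry _]; apply: (v_deriv sv); exact: le_lt_trans ry.
- exact: dvp.
Qed.

Lemma rising_of_monotone T (rs : \bar R) E : 0 <= T -> (T%:E < rs)%E ->
  (forall r : R, T < r -> (r%:E < rs)%E -> 0 < dv r /\ 0 < e r) ->
  (forall r : R, T < r -> (r%:E < rs)%E -> v r < E) ->
  (forall s : R, v T < s < E -> exists r : R, [/\ T < r, (r%:E < rs)%E & s < v r]) ->
  exists g, rising v dv T rs E g.
Proof.
move=> T0 Trs pos rng surj.
have incr r s : T <= r -> r < s -> (s%:E < rs)%E -> v r < v s.
  move=> Tr rs' srs; apply: v_lt => //; first exact: le_trans Tr.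
  move=> y /andP[ry ys]; have [] := pos y (le_lt_trans Tr ry) => //.
  by apply: lt_trans srs; rewrite lte_fin.
have ex s : v T < s < E -> exists r : R, [/\ T < r, (r%:E < rs)%E & v r = s].
  move=> /[dup] /surj [r [Tr rrs svr]] /andP[vTs _].
  have [|x] := IVT (f := v) (v := s) (ltW Tr) (within_segment_of_ray T0 (v_within sv)).
    by rewrite ge_min le_max (ltW vTs) (ltW svr) orbT.
  rewrite in_itv /= => /andP[Tx xr] vx; exists x; split => //.
    by rewrite lt_neqAle Tx andbT; apply/eqP => TE; move: vTs; rewrite TE vx ltxx.
  by apply: le_lt_trans rrs; rewrite lee_fin.
pose g s := xget 0 [set r : R | [/\ T < r, (r%:E < rs)%E & v r = s]].
have gP s : v T < s < E -> [/\ T < g s, ((g s)%:E < rs)%E & v (g s) = s].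
  move=> /ex [r rP]; exact: (@xgetPex _ 0 [set r : R | [/\ T < r, (r%:E < rs)%E & v r = s]] (ex_intro _ r rP)).
have rngE r : T < r -> (r%:E < rs)%E -> v T < v r < E.
  by move=> Tr rrs; rewrite rng// andbT; apply: incr.
have gv r : T < r -> (r%:E < rs)%E -> g (v r) = r.
  move=> Tr rrs; have [Tg grs vg] := gP _ (rngE _ Tr rrs).
  by apply/eqP; case: ltgtP => // [gr|rg];
    [have := incr _ _ (ltW Tg) gr rrs | have := incr _ _ (ltW Tr) rg grs];
    rewrite vg ltxx.
exists g; split => //.
- by move=> r Tr rrs; have [] := pos _ Tr rrs.
- by move=> s /gP[].
- by move=> s /gP[].
move=> s sE; have [Tg grs vg] := gP _ sE.
have g0 : 0 < g s by exact: le_lt_trans Tg.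
have [dvp ep] := pos _ Tg grs.
have gD : is_derive s 1 g (dv (g s))^-1.
  rewrite -{1}vg; apply: is_derive_inverse; last by rewrite gt_eqF.
  - have nrs : \forall y \near g s, (y%:E < rs)%E.
      move: grs; case: (rs) => [x| |]//=.
      + by rewrite lte_fin => gx; near=> y; rewrite lte_fin; near: y; exact: lt_nbhsl.
      + by move=> _; near=> y; rewrite ltry.
    near=> y; apply: gv; near: y; [exact: lt_nbhsr|exact: nrs].
  - near=> y; have y0 : 0 < y by near: y; exact: lt_nbhsr.
    exact: is_derive1_continuous (v_deriv sv y0).
  - exact: (v_deriv sv).
split => //.
  split => //=; first by rewrite -vg; apply: (v_dom sv); exact: ltW.
  by move: ep; rewrite /energy vg; lra.
have D := is_derive1_comp (dv_deriv sv g0) gD.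
apply: (is_derive_eq D); rewrite /= vg.
have E1 : forall x y w : R, y != 0 -> (- x * y - w) * y^-1 = - x - w / y.
  by move=> x y w y0; field.
by apply: E1; rewrite gt_eqF.
Unshelve. all: by end_near. Qed.

Lemma qdv_deriv r : 0 < r ->
  is_derive r 1 (fun t => q t * dv t) (- (q r * f (v r))).
Proof.
move=> r0; have D := is_derive1M (q_deriv wq r0) (dv_deriv sv r0).
apply: (is_derive_eq D).
have E1 : forall x x' u w : R, x != 0 ->
    x' * u + x * (- (x' / x) * u - w) = - (x * w).
  by move=> x x' u w x0; field.
by apply: E1; rewrite gt_eqF// (q_gt0 wq).
Qed.

(** (q v')' = - q f(v) > 0 below height - beta, and q v' = 0 at T. *)
Lemma dv_gt0_right T : 0 <= T -> dv T = 0 ->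
  forall z, T < z -> (forall y, T < y < z -> v y < - beta) -> 0 < dv z.
Proof.
move=> T0 dvT z Tz vy.
have b0 := b_gt0 nf; have bb := b_beta nf.
have z0 : 0 < z by exact: le_lt_trans Tz.
suff : q T * dv T < q z * dv z by rewrite dvT mulr0 pmulr_rgt0// (q_gt0 wq).
apply: (@lt_of_deriv_gt0 R (fun r => q r * dv r) (fun r => - (q r * f (v r))) _ _ Tz).
- by apply: withinM; apply: (within_segment_of_ray T0); [exact: q_within wq|exact: dv_within sv].
- by move=> y /andP[Ty _]; apply: qdv_deriv; exact: le_lt_trans Ty.
move=> y yz; have /andP[Ty _] := yz; have y0 : 0 < y by exact: le_lt_trans Ty.
rewrite oppr_gt0 pmulr_rlt0 ?(q_gt0 wq)//.
have vyb := vy _ yz.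
have yd := v_dom sv (ltW y0).
have := f_gt0 nf (s := - v y) ltac:(lra).
rewrite (f_odd nf yd) oppr_gt0; apply.
by move: yd; rewrite /dom /= normrN.
Qed.

Definition decays (g : R -> R) : Prop :=
  forall eps : R, 0 < eps -> exists2 t : R, t < 0 & forall s : R, t < s < 0 ->
    dv (g s) < eps /\ Wb g (dv \o g) s < eps.

Definition turning_branch T : Prop := exists T' g,
  [/\ rising v dv T T'%:E (v T') g, dv T' = 0 & beta < v T'].

Definition decaying_branch T : Prop := exists rs g,
  [/\ rising v dv T rs 0 g, decays g & forall r, T <= r -> v r <= 0].

(** h v' -> 0 is enough: h is bounded below by a positive constant away from T,
    and W <= sqrt H v' <= sqrt A h v' since H <= A h^2 and F <= 0. *)
Lemma decays_of_flux T rs g : 0 <= T -> v T < - beta -> rising v dv T rs 0 g ->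
  (forall eps : R, 0 < eps -> exists r' : R, [/\ T < r', (r'%:E < rs)%E &
     forall r : R, r' < r -> (r%:E < rs)%E -> h q r * dv r < eps]) ->
  decays g.
Proof.
move=> T0 vTb ri small eps eps0.
have b0 := b_gt0 nf; have bb := b_beta nf.
have [r1 [Tr1 r1s _]] := small 1 ltr01.
have r10 := le_lt_trans T0 Tr1.
have h1 := h_gt0 wq r10.
have [A A0 HA] := H_le_h2 wq.
have sA : 0 < Num.sqrt A by rewrite sqrtr_gt0.
pose eps' := Num.min (eps * h q r1) (eps / Num.sqrt A).
have eps'0 : 0 < eps' by rewrite lt_min mulr_gt0// divr_gt0.
have [r2 [Tr2 r2s r2P]] := small _ eps'0.
pose r' := Num.max r1 r2.
have r's : (r'%:E < rs)%E by rewrite /r' maxEge; case: ifP.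
have Tr' : T < r' by rewrite lt_max Tr1.
have /andP[_ vr'0] := rise_rng ri Tr' r's.
pose t := Num.max (v r') (- beta).
exists t => [|s /andP[ts s0]]; first by rewrite gt_max vr'0; lra.
move: ts; rewrite gt_max => /andP[vr's bs].
have sE : v T < s < 0 by rewrite s0 andbT; lra.
have [Tg gs] := rise_g ri sE; have vg := rise_vg ri sE.
have r'g : r' < g s.
  rewrite ltNge; apply/negP => gr'; move: vr's; rewrite ltNge => /negP; apply.
  move: gr'; rewrite le_eqVlt => /predU1P[<-|gr']; first by rewrite vg.
  rewrite -vg; apply/ltW/v_lt => //; first by rewrite (le_trans T0)// ltW.
  move=> y /andP[gy yr']; apply: (rise_dv ri); first exact: lt_trans gy.
  by apply: lt_trans r's; rewrite lte_fin.
have r1g : r1 <= g s by rewrite (le_trans _ (ltW r'g))// le_max lexx.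
have g0 : 0 < g s by exact: lt_le_trans r1g.
have hd : h q (g s) * dv (g s) < eps'.
  by apply: r2P => //; rewrite (le_lt_trans _ r'g)// le_max lexx orbT.
move: (hd); rewrite lt_min => /andP[hd1 hd2].
have dvp := rise_dv ri Tg gs.
split.
  have hh := h_nondec wq r10 r1g.
  rewrite -(ltr_pM2r h1); apply: le_lt_trans hd1.
  by rewrite [leLHS]mulrC; apply: ler_wpM2r => //; exact: ltW.
have Fs : Fe f s <= 0 by apply: (Fe_le0 nf); rewrite ler0_norm; lra.
apply: (@le_lt_trans _ _ (Num.sqrt A * (h q (g s) * dv (g s)))); last first.
  by move: hd2; rewrite ltr_pdivlMr// mulrC.
have hp : 0 <= h q (g s) * dv (g s) by rewrite mulr_ge0 ?(ltW dvp)// ltW ?(h_gt0 wq).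
rewrite -[X in _ * X]ger0_norm// -sqrtr_sqr -sqrtrM ?(ltW A0)// ler_wsqrtr//.
rewrite /W2b /=.
have Hp := H_gt0 wq g0.
apply: (@le_trans _ _ (H q (g s) * dv (g s) ^+ 2)).
  by rewrite ler_wpM2l ?(ltW Hp)//; lra.
by rewrite exprMn [leRHS]mulrA ler_wpM2r ?sqr_ge0// HA.
Qed.

(** Let T' be the first zero of v' after T. It cannot have v T' < - beta, as
    q v' increases at such heights, so by positivity of the energy either
    v T' > beta or the energy is 0 at T', and v = 0 from T' on. If there is
    no T', then v increases to 0; f(v) >= 0 for v in [- b, 0], so q v' is
    bounded and h v' = (h / q) q v' -> 0. *)
Lemma branch_dichotomy T : 0 <= T -> dv T = 0 -> v T < - beta ->
  turning_branch T \/ decaying_branch T.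
Proof.
move=> T0 dvT vTb.
have b0 := b_gt0 nf; have bb := b_beta nf.
have [d d0 dP] : exists2 d : R, 0 < d & forall y, T <= y <= T + d -> v y < - beta.
  have vb : 0 < - beta - v T by rewrite subr_gt0.
  have [d d0 dP] := within_segment_dist
    (within_segment_of_ray (s := T + 1) T0 (v_within sv))
    (ltac:(rewrite lexx /=; lra) : T <= T <= T + 1) vb.
  pose d' := Num.min (d / 2) 1.
  have dd : d' <= d / 2 by rewrite ge_min lexx.
  have d1 : d' <= 1 by rewrite ge_min lexx orbT.
  exists d' => [|y /andP[Ty yd]]; first by rewrite lt_min ltr01 divr_gt0.
  have := dP y ltac:(rewrite Ty /=; lra).
  rewrite ger0_norm ?subr_ge0// => /(_ ltac:(lra)).
  by rewrite ltr_norml => /andP[]; lra.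
have dv_right y : T < y <= T + d -> 0 < dv y.
  move=> /andP[Ty yd]; apply: (dv_gt0_right T0 dvT Ty) => z /andP[Tz zy].
  by apply: dP; apply/andP; split; lra.
have Td : T < T + d by lra.
have [[r [Tr dvr]]|dv_pos] := pselect (exists r, T < r /\ dv r <= 0); last first.
  right.
  have dvp r : T < r -> 0 < dv r.
    by move=> Tr; rewrite ltNge; apply/negP => dvr; apply: dv_pos; exists r.
  have incr r s : T <= r -> r < s -> v r < v s.
    move=> Tr rs; apply: v_lt => //; first exact: le_trans Tr.
    by move=> y /andP[ry _]; apply: dvp; exact: le_lt_trans ry.
  have v_neg r : T <= r -> v r < 0.
    move=> Tr; rewrite ltNge; apply/negP => vr.
    have vr1 := incr r (r + 1) Tr ltac:(lra).
    have vp : 0 < v (r + 1) by lra.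
    have [s s0 sP] := eventually_small sv vp.
    have m1 : s <= Num.max (r + 2) s by rewrite le_max lexx orbT.
    have m2 : r + 2 <= Num.max (r + 2) s by rewrite le_max lexx.
    have := incr (r + 1) (Num.max (r + 2) s) ltac:(lra) ltac:(lra).
    by have := sP _ m1; rewrite ltr_norml => /andP[]; lra.
  have [g ri] : exists g, rising v dv T +oo 0 g.
    apply: (rising_of_monotone T0) => //.
    - by rewrite ltry.
    - move=> r Tr _; have r0 := le_lt_trans T0 Tr; split; first exact: dvp.
      rewrite lt_neqAle (energy_ge0 sv (ltW r0)) andbT eq_sym.
      apply/eqP => er; have [_] := energy_eq0 sv (ltW r0) er (lexx r).
      by have := dvp r Tr => /[swap] ->; rewrite ltxx.
    - by move=> r Tr _; exact: v_neg (ltW Tr).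
    - move=> s /andP[vTs s0].
      have s0' : 0 < - s by rewrite oppr_gt0.
      have [r1 r10 r1P] := eventually_small sv s0'.
      exists (Num.max (T + 1) r1); split.
      + by rewrite lt_max; apply/orP; left; lra.
      + by rewrite ltry.
      + have := r1P (Num.max (T + 1) r1); rewrite le_max lexx orbT => /(_ isT).
        by rewrite ltr_norml => /andP[]; lra.
  exists +oo%E, g; split => //; last by move=> r /v_neg/ltW.
  apply: (decays_of_flux T0 vTb ri) => eps eps0.
  have [rb rb0 rbP] := eventually_small sv b0.
  pose r1 := Num.max (T + 1) rb.
  have Tr1 : T + 1 <= r1 by rewrite le_max lexx.
  have rbr1 : rb <= r1 by rewrite le_max lexx orbT.
  pose M := q r1 * dv r1.
  have M0 : 0 < M by rewrite mulr_gt0 ?dvp ?(q_gt0 wq)//; lra.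
  have Mb r : r1 <= r -> q r * dv r <= M.
    move=> r1r; rewrite -lerN2.
    apply: (@le_of_deriv_ge0 R (fun r => - (q r * dv r))
      (fun r => - - (q r * f (v r))) _ _ r1r).
    - apply: withinN; apply: (within_segment_of_ray (r := r1)); first lra.
      by apply: withinM; [exact: q_within wq|exact: dv_within sv].
    - by move=> y /andP[r1y _]; apply: is_derive1N; apply: qdv_deriv; lra.
    - move=> y /andP[r1y _]; have y0 : 0 < y by lra.
      rewrite opprK mulr_ge0 ?(ltW (q_gt0 wq y0))//.
      have vy := rbP y ltac:(lra); have vy0 := v_neg y ltac:(lra).
      have yd := v_dom sv (ltW y0).
      have := f_le0 nf (s := - v y).
      rewrite (f_odd nf yd) oppr_le0; apply.
      by move: vy; rewrite ltr_norml => /andP[? ?]; apply/andP; split; lra.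
  have epsM : 0 < eps / (2 * M) by rewrite divr_gt0// mulr_gt0.
  have [r0 r00 r0P] := h_le_q wq epsM.
  exists (Num.max r1 r0); split; [by rewrite lt_max; apply/orP; left; lra|by rewrite ltry|].
  move=> r; rewrite gt_max => /andP[r1r r0r] _.
  have hq := r0P r (ltW r0r); have qd := Mb r (ltW r1r).
  have dr := dvp r ltac:(lra).
  apply: (@le_lt_trans _ _ (eps / (2 * M) * q r * dv r)).
    by rewrite ler_wpM2r// ltW.
  rewrite -mulrA; apply: (@le_lt_trans _ _ (eps / (2 * M) * M)).
    by rewrite ler_wpM2l// ltW.
  have -> : eps / (2 * M) * M = eps / 2 by field; rewrite gt_eqF.
  by lra.
have Tdr : T + d <= r.
  rewrite leNgt; apply/negP => rTd; have := dv_right r ltac:(by rewrite Tr ltW).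
  by rewrite ltNge dvr.
have [||T' [/andP[TdT' T'r] dvT' dvp]] :=
  first_zero Tdr (within_segment_of_ray (ltac:(lra) : 0 <= T + d) (dv_within sv)) => //.
  by apply: dv_right; rewrite lexx andbT.
have TT' : T < T' by lra.
have T'0 : 0 < T' by lra.
have dv_pos y : T < y < T' -> 0 < dv y.
  move=> /andP[Ty yT']; have [yd|dy] := leP y (T + d).
    by apply: dv_right; rewrite Ty.
  by apply: dvp; rewrite (ltW dy).
have incr x y : T <= x -> x < y -> y <= T' -> v x < v y.
  move=> Tx xy yT'; apply: v_lt => //; first lra.
  by move=> z /andP[? ?]; apply: dv_pos; apply/andP; split; lra.
have e_pos y : T < y < T' -> 0 < e y.
  move=> /[dup] /dv_pos dvy /andP[Ty _]; have y0 : 0 <= y by lra.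
  rewrite lt_neqAle (energy_ge0 sv y0) andbT eq_sym.
  apply/eqP => er; have [_ E0] := energy_eq0 sv y0 er (lexx y).
  by move: dvy; rewrite E0 ltxx.
have [g ri] : exists g, rising v dv T T'%:E (v T') g.
  apply: (rising_of_monotone T0) => //.
  - by move=> y Ty; rewrite lte_fin => yT'; rewrite dv_pos ?e_pos ?Ty.
  - by move=> y Ty; rewrite lte_fin => yT'; apply: incr => //; exact: ltW.
  - move=> s /andP[vTs svT'].
    have vb : 0 < v T' - s by rewrite subr_gt0.
    have [d' d'0 d'P] := within_segment_dist (within_segment_of_ray T0 (v_within sv))
      (ltac:(rewrite lexx; lra) : T <= T' <= T') vb.
    pose y := Num.max ((T + T') / 2) (T' - d' / 2).
    have y1 : (T + T') / 2 <= y by rewrite le_max lexx.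
    have y2 : T' - d' / 2 <= y by rewrite le_max lexx orbT.
    have y3 : y < T' by rewrite gt_max; apply/andP; split; lra.
    exists y; split; [lra|by rewrite lte_fin|].
    have := d'P y ltac:(apply/andP; split; lra).
    rewrite ler0_norm => [/(_ ltac:(lra))|]; last lra.
    by rewrite ltr_norml => /andP[]; lra.
have eT' := energy_ge0 sv (ltW T'0).
move: (eT'); rewrite le_eqVlt => /predU1P[/esym e0|ep].
  have [vT' _] := energy_eq0 sv (ltW T'0) e0 (lexx T').
  right; exists T'%:E, g; rewrite vT' in ri; split => //; last first.
    move=> y Ty; have [yT'|T'y] := ltP y T'.
      by rewrite -vT' ltW// incr.
    by have [-> _] := energy_eq0 sv (ltW T'0) e0 T'y.
  apply: (decays_of_flux T0 vTb ri) => eps eps0.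
  have hT' := h_gt0 wq T'0.
  have eh : 0 < eps / h q T' by rewrite divr_gt0.
  have [d' d'0 d'P] := within_segment_dist (within_segment_of_ray T0 (dv_within sv))
      (ltac:(rewrite lexx; lra) : T <= T' <= T') eh.
  pose y := Num.max ((T + T') / 2) (T' - d' / 2).
  have y1 : (T + T') / 2 <= y by rewrite le_max lexx.
  have y2 : T' - d' / 2 <= y by rewrite le_max lexx orbT.
  have y3 : y < T' by rewrite gt_max; apply/andP; split; lra.
  exists y; split; [lra|by rewrite lte_fin|] => z yz; rewrite lte_fin => zT'.
  have dz := dv_pos z ltac:(apply/andP; split; lra).
  have := d'P z ltac:(apply/andP; split; lra).
  rewrite ler0_norm => [/(_ ltac:(lra))|]; last lra.
  rewrite dvT' subr0 gtr0_norm// ltr_pdivlMr// mulrC.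
  apply: le_lt_trans; rewrite ler_wpM2r ?(ltW dz)//.
  by apply: (h_nondec wq); lra.
left; exists T', g; split => //.
have FT' : 0 < Fe f (v T').
  by move: ep; rewrite /energy dvT' expr0n /= mul0r add0r.
have vT'b : beta < `|v T'|.
  by rewrite ltNge; apply/negP => /(Fe_le0 nf); rewrite leNgt FT'.
move: vT'b; rewrite ltr_normr => /orP[//|vT'n].
have := dv_gt0_right T0 dvT TT' _; rewrite dvT' ltxx => H.
suff : false by [].
apply: H => y /andP[Ty yT']; have := incr y T' (ltW Ty) yT' (lexx _).
by lra.
Qed.

End one_solution.

(** The function Qb read in the variable r. *)
Definition Qr (v dv : R -> R) (r : R) : R :=
  'H_ r * energy v dv r + 'h_ r * dv r * kap f (v r).

(** From the local minimum at T the solution makes n full turns, alternately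
    reflected so as to be increasing, and then decays. *)
Fixpoint nodes (v dv : R -> R) (n : nat) (T : R) : Prop :=
  if n is n'.+1 then exists T' g,
    [/\ rising v dv T T'%:E (v T') g, dv T' = 0, beta < v T' &
     nodes (fun r => - v r) (fun r => - dv r) n' T']
  else decaying_branch v dv T.

Lemma sol_opp v dv : sol v dv -> sol (fun r => - v r) (fun r => - dv r).
Proof.
move=> sv; split.
- by move=> r r0; rewrite /dom /= normrN; exact: (v_dom sv).
- exact: withinN (v_within sv).
- exact: withinN (dv_within sv).
- by rewrite (dv0 sv) oppr0.
- by move=> r r0; apply: is_derive1N; exact: (v_deriv sv).
- move=> r r0; apply: (is_derive_eq (is_derive1N (dv_deriv sv r0))).
  by rewrite (f_odd nf (v_dom sv (ltW r0))); ring.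
- by rewrite -[X in _ --> X]oppr0; apply: cvgN; exact: v_lim sv.
Qed.

Lemma Qr_opp v dv r : dom c (v r) ->
  Qr (fun r => - v r) (fun r => - dv r) r = Qr v dv r.
Proof.
move=> vd; rewrite /Qr /energy /kap Fe_even sqrrN (f_odd nf vd) invrN; ring.
Qed.

Section one_solution.
Variables v dv : R -> R.
Hypothesis sv : sol v dv.

Lemma Qb_Qr g s : v (g s) = s -> Qb g (dv \o g) s = Qr v dv (g s).
Proof. by move=> vg; rewrite /Qb /Qr /energy /= vg. Qed.

Lemma Qr_deriv r : 0 < r -> b < `|v r| ->
  is_derive r 1 (Qr v dv)
    ('h_ r * dv r ^+ 2 * (dkap (v r) - 'G_ r) - dv r * kap f (v r)).
Proof.
move=> r0 bv; have vd := v_dom sv (ltW r0).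
have D := is_derive1D (is_derive1M (H_deriv wq r0) (energy_deriv sv r0))
  (is_derive1M (is_derive1M (h_deriv wq r0) (dv_deriv sv r0))
     (is_derive1_comp (kap_deriv nf bv vd) (v_deriv sv r0))).
apply: (is_derive_eq D).
have HG := G_eq wq r0.
have fn : f (v r) != 0.
  have [s0|s0] := leP 0 (v r).
    by rewrite gt_eqF// (f_gt0 nf)//; rewrite ger0_norm in bv.
  have := f_gt0 nf (s := - v r); rewrite ltr0_norm in bv => //.
  rewrite (f_odd nf vd) => /(_ bv (dom_le _ vd)).
  by rewrite normrN lexx oppr_gt0 => /(_ isT)/lt_eqF ->.
set a := dq r / q r in HG *.
have fk : f (v r) * kap f (v r) = Fe f (v r) by rewrite /kap mulrC divfK.
have E : forall h e a H d w k K' : R,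
  h * e + H * (- a * d ^+ 2) + (((a * h - 1) * d + h * (- a * d - w)) * k +
    h * d * (K' * d)) =
  h * e - d ^+ 2 * (a * H) - h * (w * k) - d * k + h * K' * d ^+ 2.
  by move=> h e a' H d w k K'; ring.
rewrite E HG fk /energy.
have E2 : forall h d F G k K' : R,
  h * (d ^+ 2 / 2 + F) - d ^+ 2 * (h * (G + 2^-1)) - h * F - d * k + h * K' * d ^+ 2 =
  h * d ^+ 2 * (K' - G) - d * k by move=> h d F G k K'; field.
exact: E2.
Qed.

(** On an arc where the solution stays above beta the term - u' kap(u) is an
    exact derivative, so that it cancels between two passages at the same
    height. *)
Lemma Qr_return r1 r2 m : 0 < r1 -> r1 <= r2 -> beta < m ->
  (forall y, r1 <= y <= r2 -> m <= v y) -> v r1 = v r2 ->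
  Qr v dv r1 <= Qr v dv r2.
Proof.
move=> r10 r12 bm mv v12.
have b0 := b_gt0 nf; have bb := b_beta nf.
have [y yin vM] := EVT_max r12 (within_segment_of_ray (ltW r10) (v_within sv)).
have [y1 y2] : r1 <= y /\ y <= r2 by move: yin; rewrite in_itv /= => /andP[].
have My : dom c (v y) by apply: (v_dom sv); lra.
have my := mv y ltac:(by rewrite y1).
have [M vyM Md] := dom_right (ltac:(lra) : 0 <= v y) My.
have kd s : beta <= s <= M -> is_derive s 1 (kap f) (dkap s).
  move=> /andP[bs sM]; apply: (kap_deriv nf); first by rewrite ger0_norm; lra.
  by apply: dom_le Md; rewrite !ger0_norm; lra.
have ki : (@lebesgue_measure R).-integrable `[beta, M] (EFin \o kap f).
  apply: continuous_compact_integrable; first exact: segment_compact.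
  apply: (@is_derive_within _ _ dkap) => s; rewrite /= in_itv /=; exact: kd.
pose Phi s := (\int[@lebesgue_measure R]_(t in `[beta, s]) kap f t)%R.
have PD s : beta < s -> s < M -> is_derive s 1 Phi (kap f s).
  move=> bs sM.
  have kc := is_derive1_continuous (kd s ltac:(apply/andP; split; lra)).
  have [D1 D2] := continuous_FTC1_closed sM ki bs kc.
  split; first exact: D1.
  by rewrite -derive1E; exact: D2.
pose g r := 'h_ r * dv r ^+ 2 * (dkap (v r) - 'G_ r).
have D z : r1 <= z <= r2 -> is_derive z 1 (fun r => Qr v dv r + Phi (v r)) (g z).
  move=> /[dup] zin /andP[r1z zr2]; have z0 : 0 < z by lra.
  have vz := mv _ zin; have vzy : v z <= v y by apply: vM; rewrite in_itv.
  have D1 := Qr_deriv z0 (ltac:(rewrite ger0_norm; lra) : b < `|v z|).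
  have D2 := is_derive1_comp (PD (v z) ltac:(lra) ltac:(lra)) (v_deriv sv z0).
  by apply: (is_derive_eq (is_derive1D D1 D2)); rewrite /g; ring.
suff : Qr v dv r1 + Phi (v r1) <= Qr v dv r2 + Phi (v r2) by rewrite v12 lerD2r.
apply: (@le_of_deriv_ge0 R (fun r => Qr v dv r + Phi (v r)) g _ _ r12).
- by apply: (@is_derive_within _ _ g) => z; rewrite /= in_itv; exact: D.
- by move=> z /andP[/ltW r1z /ltW zr2]; apply: D; rewrite r1z.
move=> z /andP[r1z zr2]; have z0 : 0 < z by lra.
have vz := mv z ltac:(by rewrite !ltW).
have hz := h_gt0 wq z0; have Gz := G_leC wq z0.
have kz : C <= dkap (v z).
  by apply: (dkap_geC nf); [rewrite ger0_norm; lra|apply: (v_dom sv); lra].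
apply: mulr_ge0; last by lra.
by rewrite mulr_ge0 ?sqr_ge0 ?ltW.
Qed.

End one_solution.

(** At height u T branch 1 starts with P1 = 0 while P2 > 0. Just above, x1 and
    P1 are still small, and Q1 <= H(r) energy(r) <= H(r) F(u T), because
    F / f < 0 at such heights and the energy decreases. *)
Lemma ahead_near_start u du v dv T S rs1 E1 g1 rs2 E2 g2 :
  sol u du -> sol v dv -> 0 <= T -> du T = 0 -> u T < - beta ->
  - beta < E1 -> - beta < E2 ->
  rising u du T rs1 E1 g1 -> rising v dv S rs2 E2 g2 -> v S < u T ->
  'H_ T * Fe f (u T) < Qr v dv (g2 (u T)) ->
  exists s0, [/\ u T < s0, s0 < - beta &
    ahead g1 (du \o g1) g2 (dv \o g2) s0].
Proof.
move=> su sv T0 duT uTb bE1 bE2 ri1 ri2 vuT Q0.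
have b0 := b_gt0 nf; have bb := b_beta nf.
have uE2 : v S < u T < E2 by rewrite vuT /=; lra.
have br2 := rise_branch ri2 uE2.
have uc := cvg_right0 T0 (v_within su).
have dc := cvg_right0 T0 (dv_within su).
have Hc := cvg_right0 T0 (H_within wq).
have utb : b < `|u T| by rewrite ler0_norm; lra.
have [[_ r2p p2 _] _ PD] := br2.
have comp (g : R -> R) : {for u T, continuous g} -> g (u r) @[r --> T^'+] --> g (u T).
  by move=> gc; apply: cvg_comp uc gc.
have Pc := comp _ (is_derive1_continuous PD).
have Qc := comp _ (is_derive1_continuous (Qb_deriv br2 utb)).
have fc : {for u T, continuous (flux g2 (dv \o g2))}.
  apply: is_derive1_continuous.
  exact: is_derive1M (is_derive_comp_branch br2 (h_deriv wq r2p)) PD.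
have xc := comp _ fc.
have T1 : 0 < T + 1 by lra.
have hT1 := h_gt0 wq T1.
have x2p : 0 < flux g2 (dv \o g2) (u T) by rewrite mulr_gt0 ?(h_gt0 wq).
have c1 : \forall r \near T^'+, 0 < (dv \o g2) (u r) - du r.
  by apply: (cvgr_gt _ (cvgB Pc dc)); rewrite duT subr0.
have c2 : \forall r \near T^'+,
    0 < flux g2 (dv \o g2) (u r) - h q (T + 1) * du r.
  apply: (cvgr_gt _ (cvgB xc (cvgM (cvg_cst (h q (T + 1))) dc))).
  by rewrite duT mulr0 subr0.
have c3 : \forall r \near T^'+, 0 < Qb g2 (dv \o g2) (u r) - H q r * Fe f (u T).
  apply: (cvgr_gt _ (cvgB Qc (cvgM Hc (cvg_cst (Fe f (u T)))))).
  by rewrite (Qb_Qr dv (rise_vg ri2 uE2)) subr_gt0.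
have c4 : \forall r \near T^'+, u r < - beta.
  by apply: (cvgr_lt _ uc).
have c5 : \forall r \near T^'+, (r%:E < rs1)%E.
  have := rise_lt ri1; case: (rs1) => [x| |]//=.
    by rewrite lte_fin => Tx; near=> r; rewrite lte_fin; near: r; exact: nbhs_right_lt.
  by move=> _; near=> r; rewrite ltry.
have [r [rc1 rc2 rc3 [rc4 rc5 Tr rT1]]] : exists r, [/\
    0 < (dv \o g2) (u r) - du r,
    0 < flux g2 (dv \o g2) (u r) - h q (T + 1) * du r,
    0 < Qb g2 (dv \o g2) (u r) - H q r * Fe f (u T) &
    [/\ u r < - beta, (r%:E < rs1)%E, T < r & r < T + 1]].
  apply: (@filter_ex _ (T^'+)); near=> r; split.
  - by near: r; exact: c1.
  - by near: r; exact: c2.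
  - by near: r; exact: c3.
  - split; near: r; [exact: c4|exact: c5|exact: nbhs_right_gt|].
    by apply: nbhs_right_lt; lra.
have /andP[uTr urE] := rise_rng ri1 Tr rc5.
have g1r := rise_gv ri1 Tr rc5.
have r0 : 0 < r by exact: le_lt_trans Tr.
have dur := rise_dv ri1 Tr rc5.
exists (u r); split => //; split => /=; rewrite ?g1r.
- by rewrite -subr_gt0.
- rewrite {1}/flux /= g1r; apply: (@le_lt_trans _ _ (h q (T + 1) * du r)).
    by rewrite ler_wpM2r ?(ltW dur)//; apply: (h_nondec wq) => //; exact: ltW.
  by rewrite -subr_gt0.
have ud := v_dom su (ltW r0).
have uabs : `|u r| = - u r by rewrite ler0_norm; lra.
have fn : f (u r) < 0.
  have := f_gt0 nf (s := - u r) ltac:(lra).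
  by rewrite (f_odd nf ud) oppr_gt0; apply; apply: dom_le ud; rewrite normrN.
have Fp : 0 < Fe f (u r) by apply: (Fe_gt0 nf) => //; lra.
have kn : kap f (u r) <= 0.
  by rewrite /kap ler_ndivrMr// mul0r ltW.
have H0r := H_gt0 wq r0; have h0r := h_gt0 wq r0.
have en1 := energy_noninc su T0 (ltW Tr).
have enT : energy u du T = Fe f (u T).
  by rewrite /energy duT expr0n /= mul0r add0r.
rewrite (Qb_Qr du (_ : u (g1 (u r)) = u r)) g1r// /Qr.
have : 'h_ r * du r * kap f (u r) <= 0.
  by rewrite mulr_ge0_le0// mulr_ge0// ltW.
have : 'H_ r * energy u du r <= 'H_ r * Fe f (u T).
  by rewrite -enT ler_wpM2l// ltW.
by lra.
Unshelve. all: by end_near. Qed.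

Lemma rise_gt v dv T rs E g y s : sol v dv -> 0 <= T -> rising v dv T rs E g ->
  T < y -> (y%:E < rs)%E -> v T < s < E -> v y < s -> y < g s.
Proof.
move=> sv T0 ri Ty yrs sE vys; rewrite ltNge; apply/negP => gy.
have [Tg grs] := rise_g ri sE.
move: vys; rewrite -(rise_vg ri sE) ltNge => /negP; apply.
move: gy; rewrite le_eqVlt => /predU1P[->//|gy].
apply/ltW/(v_lt sv) => //; first by rewrite (le_trans T0)// ltW.
move=> z /andP[gz zy]; apply: (rise_dv ri); first exact: lt_trans gz.
by apply: lt_trans yrs; rewrite lte_fin.
Qed.

(** Solution 1 turns first: solution 2 cannot come to rest before it by
    [not_reach_rest_first]. The last inequality is the limit of Q1 + m <= Q2
    at the turning height of solution 1, where Qr reduces to H F. *)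
Lemma turning_step u du v dv T S T' S' g1 g2 :
  sol u du -> sol v dv -> 0 <= T -> 0 <= S -> du T = 0 -> u T < - beta ->
  v S < u T ->
  rising u du T T'%:E (u T') g1 -> du T' = 0 -> beta < u T' ->
  rising v dv S S'%:E (v S') g2 -> dv S' = 0 -> beta < v S' ->
  'H_ T * Fe f (u T) < Qr v dv (g2 (u T)) ->
  u T' < v S' /\ 'H_ T' * Fe f (u T') < Qr v dv (g2 (u T')).
Proof.
move=> su sv T0 S0 duT uTb vuT ri1 duT' buT' ri2 dvS' bvS' Q0.
have b0 := b_gt0 nf; have bb := b_beta nf.
have bE1 : - beta < u T' by lra.
have bE2 : - beta < v S' by lra.
have [s0 [uTs0 s0b ah]] :=
  ahead_near_start su sv T0 duT uTb bE1 bE2 ri1 ri2 vuT Q0.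
have TT' : T < T' by have := rise_lt ri1; rewrite lte_fin.
have SS' : S < S' by have := rise_lt ri2; rewrite lte_fin.
have T'0 : 0 < T' by lra.
have lt_e : u T' < v S'.
  rewrite ltNge; apply/negP => vu.
  have pr s : s0 <= s < v S' ->
      branch_at g1 (du \o g1) s /\ branch_at g2 (dv \o g2) s.
    move=> /andP[s0s se]; split.
      by apply: (rise_branch ri1); apply/andP; split; lra.
    by apply: (rise_branch ri2); apply/andP; split; lra.
  have vd : dom c (v S') by apply: (v_dom sv); lra.
  apply: (not_reach_rest_first (T := S') s0b bvS' vd pr ah).
    move=> s /andP[bs se]; have [|_] := rise_g ri2 (s := s).
      by apply/andP; split; lra.
    by rewrite lte_fin => /ltW.
  move=> eps eps0.
  have SSS : S <= S' <= S' by rewrite lexx ltW.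
  have [d d0 dP] := within_segment_dist (within_segment_of_ray S0 (dv_within sv)) SSS eps0.
  pose y := Num.max ((S + S') / 2) (S' - d / 2).
  have y1 : (S + S') / 2 <= y by rewrite le_max lexx.
  have y2 : S' - d / 2 <= y by rewrite le_max lexx orbT.
  have y3 : y < S' by rewrite gt_max; apply/andP; split; lra.
  have Sy : S < y by lra.
  have yS' : (y%:E < S'%:E)%E by rewrite lte_fin.
  have /andP[vSy vyS'] := rise_rng ri2 Sy yS'.
  exists (v y) => // s /andP[ys se].
  have sE : v S < s < v S' by apply/andP; split; lra.
  have yg := rise_gt sv S0 ri2 Sy yS' sE ys.
  have [_] := rise_g ri2 sE; rewrite lte_fin => gS'.
  have := dP (g2 s) ltac:(apply/andP; split; lra).
  rewrite ler0_norm => [/(_ ltac:(lra))|]; last lra.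
  by rewrite dvS' subr0 ltr_norml => /andP[].
split => //.
have pr s : s0 <= s < u T' ->
    branch_at g1 (du \o g1) s /\ branch_at g2 (dv \o g2) s.
  move=> /andP[s0s se]; split.
    by apply: (rise_branch ri1); apply/andP; split; lra.
  by apply: (rise_branch ri2); apply/andP; split; lra.
have [m m0 mP] := ahead_outer s0b buT' pr ah.
have uE2 : v S < u T' < v S' by apply/andP; split; lra.
have buT : b < `|u T'| by rewrite ger0_norm; lra.
have c1 : Qr u du r @[r --> T'^'-] --> Qr u du T'.
  apply: cvg_at_left_filter.
  exact: is_derive1_continuous (Qr_deriv su T'0 buT).
have uc := cvg_left0 T'0 (v_within su).
have c2 : Qb g2 (dv \o g2) (u r) @[r --> T'^'-] --> Qb g2 (dv \o g2) (u T').
  apply: cvg_comp uc _.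
  exact: is_derive1_continuous (Qb_deriv (rise_branch ri2 uE2) buT).
have c3 : (Qb g2 (dv \o g2) (u r) - Qr u du r) @[r --> T'^'-] -->
    Qb g2 (dv \o g2) (u T') - Qr u du T' by apply: cvgB c2 c1.
have QT' : Qr u du T' = 'H_ T' * Fe f (u T').
  by rewrite /Qr /energy duT' expr0n /= !mul0r add0r mulr0 mul0r addr0.
rewrite -QT' -subr_gt0 -(Qb_Qr dv (rise_vg ri2 uE2)).
apply: lt_le_trans m0 _; rewrite leNgt; apply/negP => lim_lt.
have near_lt := cvgr_lt _ c3 _ lim_lt.
have near_b := cvgr_gt _ uc _ buT'.
have [r [rlt rb Tr rT']] : exists r, [/\
    Qb g2 (dv \o g2) (u r) - Qr u du r < m, beta < u r, T < r & r < T'].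
  apply: (@filter_ex _ (T'^'-)); near=> r; split; near: r.
  - exact: near_lt.
  - exact: near_b.
  - exact: nbhs_left_gt.
  - exact: nbhs_left_lt.
have rT'E : (r%:E < T'%:E)%E by rewrite lte_fin.
have /andP[_ urT'] := rise_rng ri1 Tr rT'E.
have [_] := mP (u r) ltac:(by rewrite (ltW rb)).
have gu := rise_gv ri1 Tr rT'E; rewrite (Qb_Qr (v := u) du (g := g1)) ?gu//.
by rewrite leNgt rlt.
Unshelve. all: by end_near. Qed.

(** Induction on the number of turns. The hypothesis on rho, at which solution 2
    passes the starting height of solution 1, is transported to the next
    branch by [turning_step], and through the turn of solution 2 by
    [Qr_return]. *)
Lemma nodes_comparison n : forall u du v dv T S,
  sol u du -> sol v dv -> 0 <= T -> 0 <= S -> du T = 0 -> dv S = 0 ->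
  u T < - beta -> v S < u T ->
  (forall rho : R, S < rho -> v rho = u T ->
     (forall y, S < y <= rho -> 0 < dv y) ->
     'H_ T * Fe f (u T) < Qr v dv rho) ->
  nodes u du n T -> nodes v dv n S -> False.
Proof.
have b0 := b_gt0 nf; have bb := b_beta nf.
elim: n => [|n IH] u du v dv T S su sv T0 S0 duT dvS uTb vuT HQ.
  move=> [rs1 [g1 [ri1 _ _]]] [rs2 [g2 [ri2 dec _]]].
  have uE2 : v S < u T < 0 by apply/andP; split; lra.
  have [Sg gs] := rise_g ri2 uE2.
  have Q0 : 'H_ T * Fe f (u T) < Qr v dv (g2 (u T)).
    apply: (HQ _ Sg (rise_vg ri2 uE2)).
    move=> y /andP[Sy yg]; apply: (rise_dv ri2) => //.
    by apply: le_lt_trans gs; rewrite lee_fin.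
  have bE : - beta < 0 by lra.
  have [s0 [uTs0 s0b ah]] :=
    ahead_near_start su sv T0 duT uTb bE bE ri1 ri2 vuT Q0.
  apply: (not_both_decay s0b _ ah dec) => s /andP[s0s s0'].
  split; [apply: (rise_branch ri1)|apply: (rise_branch ri2)];
    by apply/andP; split; lra.
move=> [T' [g1 [ri1 duT' buT' n1]]] [S' [g2 [ri2 dvS' bvS' n2]]].
have uE2 : v S < u T < v S' by apply/andP; split; lra.
have [Sg gs] := rise_g ri2 uE2.
have Q0 : 'H_ T * Fe f (u T) < Qr v dv (g2 (u T)).
  apply: (HQ _ Sg (rise_vg ri2 uE2)).
  move=> y /andP[Sy yg]; apply: (rise_dv ri2) => //.
  by apply: le_lt_trans gs; rewrite lee_fin.
have [uv Q1] := turning_step su sv T0 S0 duT uTb vuT ri1 duT' buT' ri2 dvS' bvS' Q0.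
have TT' : T < T' by have := rise_lt ri1; rewrite lte_fin.
have SS' : S < S' by have := rise_lt ri2; rewrite lte_fin.
have uE : v S < u T' < v S' by apply/andP; split; lra.
have [Sg' ] := rise_g ri2 uE; rewrite lte_fin => gS'.
have vg' := rise_vg ri2 uE.
apply: (IH _ _ _ _ T' S' (sol_opp su) (sol_opp sv)) => //; rewrite ?duT' ?dvS' ?oppr0//; [lra|lra|lra|lra|].
move=> rho S'rho /oppr_inj vrho dvn.
have rho0 : 0 < rho by lra.
rewrite (Qr_opp); last by apply: (v_dom sv); lra.
rewrite Fe_even; apply: (lt_le_trans Q1).
apply: (Qr_return sv (m := u T')) => //; [lra|lra| |by rewrite vg'].
move=> y /andP[gy yrho]; have [yS'|S'y] := leP y S'.
  rewrite -vg'; move: gy; rewrite le_eqVlt => /predU1P[->//|gy].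
  apply/ltW/(v_lt sv) => //; first lra.
  move=> z /andP[gz zy]; apply: (rise_dv ri2); first lra.
  by rewrite lte_fin; lra.
rewrite -vrho; move: yrho; rewrite le_eqVlt => /predU1P[->//|yrho].
rewrite -lerN2; apply/ltW/(v_lt (sol_opp sv)) => //; first lra.
by move=> z /andP[yz zr]; apply: dvn; apply/andP; split; lra.
Qed.

(** * Counting sign changes *)

(** Alternations may start at T itself, so that the turning points, where the
    solution is far from 0, can be used as sample points. *)
Definition changes_from (T : R) (u : R -> R) (n : nat) : Prop :=
  exists x : nat -> R, [/\ T <= x 0%N,
    forall i, (i < n)%N -> x i < x i.+1 &
    forall i, (i < n)%N -> u (x i) * u (x i.+1) < 0].

Lemma changes_from_opp T u n : changes_from T (fun r => - u r) n <->
  changes_from T u n.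
Proof.
by split=> -[x [Tx xi xu]]; exists x; split => // i /xu; rewrite mulrNN.
Qed.

Section rise.
Variables (u : R -> R) (T T' : R).
Hypotheses (TT' : T < T') (uT : u T < 0) (uT' : 0 < u T').

(** T is put in front of the samples if the first one is positive, and T, T' if
    it is negative. *)
Lemma changes_from_rise n : changes_from T' u n.+1 -> changes_from T u n.+2.
Proof.
move=> [x [Tx xi xu]].
have := xu 0%N (ltn0Sn n); have [u0|u0|->] := ltgtP (u (x 0%N)) 0.
- move=> _; have T'x : T' < x 0%N.
    by rewrite lt_neqAle Tx andbT; apply/eqP => E; move: u0; rewrite -E ltNge ltW.
  exists (fun i => if i is i'.+1 then if i' is i''.+1 then x i'' else T' else T).
  split=> //.
    move=> [|[|i]] /= ni; [exact: TT'|exact: T'x|].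
    by apply: xi; exact: ltnW.
  move=> [|[|i]] /= ni; [by rewrite nmulr_rlt0|by rewrite pmulr_rlt0|].
  by apply: xu; exact: ltnW.
- move=> _; exists (fun i => if i is i'.+1 then x i' else T).
  split=> //.
    by move=> [|i] /= ni; [exact: lt_le_trans Tx|exact: xi].
  by move=> [|i] /= ni; [rewrite nmulr_rlt0|exact: xu].
- by rewrite mul0r ltxx.
Qed.

Hypothesis incr : forall r s, T <= r -> r < s -> s <= T' -> u r < u s.

(** At most two samples lie before T', as u increases there. If the second one
    is positive and comes before T', it is replaced by T'. *)
Lemma changes_from_after_rise n : changes_from T u n.+1 -> changes_from T' u n.
Proof.
move=> [x [Tx xi xu]].
have [T'x|xT'] := leP T' (x 0%N).
  by exists x; split => // i ni; [apply: xi|apply: xu]; rewrite ltnS ltnW.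
have [T'x1|x1T'] := leP T' (x 1%N).
  by exists (fun i => x i.+1); split => // i ni; [apply: xi|apply: xu].
have x01 := xi 0%N (ltn0Sn n).
have u01 := incr Tx x01 (ltW x1T').
have u1 : 0 < u (x 1%N).
  rewrite ltNge; apply/negP => u1; have := xu 0%N (ltn0Sn n).
  by rewrite nmulr_rlt0 ?(lt_le_trans u01)// ltNge u1.
exists (fun i => if i is i'.+1 then x i'.+2 else T'); split => //.
  move=> [|i] ni; last by apply: xi.
  rewrite ltNge; apply/negP => x2T'.
  have := xu 1%N ni; rewrite pmulr_rlt0// ltNge => /negP; apply.
  apply/ltW/(lt_trans u1)/incr => //; last exact: xi 1%N ni.
  by rewrite (le_trans Tx)// ltW.
move=> [|i] ni; last by apply: xu.
by have := xu 1%N ni; rewrite !pmulr_rlt0.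
Qed.

End rise.

Lemma nodes_of_changes n : forall v dv T, sol v dv -> 0 <= T -> dv T = 0 ->
  v T < - beta -> changes_from T v n -> ~ changes_from T v n.+1 ->
  nodes v dv n T.
Proof.
have b0 := b_gt0 nf; have bb := b_beta nf.
elim: n => [|n IH] v dv T sv T0 dvT vT vn vn1.
  have [|//] := branch_dichotomy sv T0 dvT vT.
  move=> [T' [g [ri dvT' vT']]]; case: vn1.
  have TT' : T < T' by have := rise_lt ri; rewrite lte_fin.
  exists (fun i => if i is 0%N then T else T'); split => // -[|i] //= _.
  by rewrite nmulr_rlt0; lra.
have [|[rs [g [ri _ vneg]]]] := branch_dichotomy sv T0 dvT vT; last first.
  have [x [Tx xi xu]] := vn; have := xu 0%N (ltn0Sn n); have x01 := xi 0%N (ltn0Sn n).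
  by rewrite ltNge mulr_le0 ?vneg// (le_trans Tx)// ltW.
move=> [T' [g [ri dvT' vT']]].
have TT' : T < T' by have := rise_lt ri; rewrite lte_fin.
exists T', g; split => //; apply: IH; rewrite ?dvT' ?oppr0 ?ltrN2//.
- exact: (sol_opp).
- by rewrite ltW// (le_lt_trans T0).
- apply/changes_from_opp; apply: changes_from_after_rise vn; first lra.
  move=> r s Tr rs sT'; apply: (v_lt sv) => //; first exact: le_trans Tr.
  move=> y /andP[ry ys]; apply: (rise_dv ri); first exact: le_lt_trans ry.
  by rewrite lte_fin (lt_le_trans ys).
- by move=> /changes_from_opp H; apply: vn1; apply: changes_from_rise TT' _ _ _ H; lra.
Qed.

Lemma changes_from0 (u du : R -> R) n : sol u du ->
  at_least_sign_changes u n.+1 <-> changes_from 0 u n.+1.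
Proof.
move=> su; split => -[x [x0 xi xu]]; first by exists x; split => //; exact: ltW.
have x01 := xi 0%N (ltn0Sn n).
have uc := cvg_right0 x0 (v_within su).
have uux : u r * u (x 1%N) @[r --> (x 0%N)^'+] --> u (x 0%N) * u (x 1%N).
  by apply: cvgM => //; exact: cvg_cst.
have near_neg := cvgr_lt _ uux _ (xu 0%N (ltn0Sn n)).
have [r [ru xr rx]] : exists r, [/\ u r * u (x 1%N) < 0, x 0%N < r & r < x 1%N].
  apply: (@filter_ex _ ((x 0%N)^'+)); near=> r; split; near: r.
  - exact: near_neg.
  - exact: nbhs_right_gt.
  - exact: nbhs_right_lt.
exists (fun i => if i is 0%N then r else x i); split => /=.
- exact: le_lt_trans xr.
- by move=> [|i] ni; [exact: rx|exact: xi].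
- by move=> [|i] ni; [exact: ru|exact: xu].
Unshelve. all: by end_near. Qed.

Lemma nodes_of_exactly u du n : sol u du -> beta < u 0 ->
  exactly_sign_changes u n -> nodes (fun r => - u r) (fun r => - du r) n 0.
Proof.
move=> su u0 [un un1]; apply: nodes_of_changes.
- exact: (sol_opp).
- by [].
- by rewrite (dv0 su) oppr0.
- by rewrite ltrN2.
- apply/changes_from_opp.
  by case: un => x [x0 xi xu]; exists x; split => //; exact: ltW.
- by move=> /changes_from_opp/(changes_from0 _ su).
Qed.

Lemma amplitude_gt_beta u du : sol u du -> 0 < u 0 -> beta < u 0.
Proof.
move=> su u0; have e0 := energy_ge0 su (lexx 0).
have e0' : 0 < energy u du 0.
  rewrite lt_neqAle e0 andbT eq_sym; apply/eqP => ez.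
  by have [E _] := energy_eq0 su (lexx 0) ez (lexx 0); move: u0; rewrite E ltxx.
have F0 : 0 < Fe f (u 0) by move: e0'; rewrite /energy (dv0 su) expr0n /= mul0r add0r.
rewrite ltNge; apply/negP => ub.
have ub' : `|u 0| <= beta by rewrite ger0_norm// ltW.
by have := Fe_le0 nf ub'; rewrite leNgt F0.
Qed.

(** Qr increases on the first branch, where v' F / f < 0, and its limit at 0 is
    nonnegative: H energy >= 0 and h v' F / f -> 0, as h is bounded near 0. *)
Lemma Qr_first_branch_gt0 v dv rho : sol v dv -> v 0 < - beta -> 0 < rho ->
  v rho < - beta -> (forall y, 0 < y <= rho -> 0 < dv y) -> 0 < Qr v dv rho.
Proof.
move=> sv v0b rho0 vrb dvp.
have b0 := b_gt0 nf; have bb := b_beta nf.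
have incr r s : 0 <= r -> r < s -> s <= rho -> v r < v s.
  move=> r0 rs sr; apply: (v_lt sv) => // y /andP[ry ys].
  by apply: dvp; apply/andP; split; lra.
have vb y : 0 <= y <= rho -> v 0 <= v y <= v rho.
  move=> /andP[y0 yr]; apply/andP; split.
    by move: y0; rewrite le_eqVlt => /predU1P[<-//|y0]; apply/ltW/incr.
  by move: yr; rewrite le_eqVlt => /predU1P[->//|yr]; apply/ltW/incr.
have vd y : 0 <= y -> dom c (v y) by move=> y0; exact: (v_dom sv).
have kneg s : s < - beta -> dom c s -> kap f s < 0.
  move=> sb sd; have sabs : `|s| = - s by rewrite ler0_norm; lra.
  have fn : f s < 0.
    have := f_gt0 nf (s := - s) ltac:(lra).
    by rewrite (f_odd nf sd) oppr_gt0; apply; apply: dom_le sd; rewrite normrN.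
  have Fp : 0 < Fe f s by apply: (Fe_gt0 nf) => //; lra.
  by rewrite /kap ltr_ndivrMr// mul0r.
pose g r := 'h_ r * dv r ^+ 2 * (dkap (v r) - 'G_ r) - dv r * kap f (v r).
have D y : 0 < y <= rho -> is_derive y 1 (Qr v dv) (g y).
  move=> /andP[y0 yr]; apply: (Qr_deriv sv y0).
  have /andP[_ ?] := vb y ltac:(by rewrite ltW).
  by rewrite ler0_norm; lra.
have gp y : 0 < y <= rho -> 0 < g y.
  move=> /[dup] yin /andP[y0 yr].
  have /andP[_ vy] := vb y ltac:(by rewrite ltW).
  have dvy := dvp _ yin.
  have kn : kap f (v y) < 0 by apply: kneg; [lra|apply: vd; exact: ltW].
  have hy := h_gt0 wq y0; have Gy := G_leC wq y0.
  have ky : C <= dkap (v y).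
    by apply: (dkap_geC nf); [rewrite ler0_norm; lra|apply: vd; exact: ltW].
  have t1 : 0 <= 'h_ y * dv y ^+ 2 * (dkap (v y) - 'G_ y).
    apply: mulr_ge0; last by lra.
    by rewrite mulr_ge0 ?sqr_ge0// ltW.
  have t2 : dv y * kap f (v y) < 0 by rewrite pmulr_rlt0.
  by rewrite /g; lra.
have Qincr r s : 0 < r -> r < s -> s <= rho -> Qr v dv r < Qr v dv s.
  move=> r0 rs sr; apply: (@lt_of_deriv_gt0 R (Qr v dv) g r s rs).
  - apply: (@is_derive_within _ _ g) => y; rewrite /= in_itv /= => /andP[ry ys].
    by apply: D; apply/andP; split; lra.
  - by move=> y /andP[ry ys]; apply: D; apply/andP; split; lra.
  - by move=> y /andP[ry ys]; apply: gp; apply/andP; split; lra.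
have m0 : 0 < Qr v dv rho - Qr v dv (rho / 2) by rewrite subr_gt0; apply: Qincr; lra.
set m := Qr v dv rho - Qr v dv (rho / 2) in m0.
have v0r : v 0 <= v rho by have /andP[] := vb rho ltac:(by rewrite lexx ltW).
have kc : {within `[v 0, v rho], continuous (kap f)}.
  apply: (@is_derive_within _ _ dkap) => s; rewrite /= in_itv /= => /andP[s1 s2].
  apply: (kap_deriv nf); first by rewrite ler0_norm; lra.
  by apply: dom_le (vd 0 (lexx 0)); rewrite !ler0_norm; lra.
have [z _ zP] := EVT_min v0r kc.
have hr := h_gt0 wq rho0.
pose A := 'h_ rho * (1 + `|kap f z|).
have A0 : 0 < A by rewrite mulr_gt0// ltr_pwDl.
have dc := cvg_right0 (lexx 0) (dv_within sv); rewrite (dv0 sv) in dc.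
have near_small := cvgr_lt _ dc _ (divr_gt0 m0 A0).
have [r [rs r0 rr]] : exists r, [/\ dv r < m / A, 0 < r & r < rho / 2].
  apply: (@filter_ex _ (0^'+)); near=> r; split; near: r.
  - exact: near_small.
  - exact: nbhs_right_gt.
  - by apply: nbhs_right_lt; lra.
have Qr2 : Qr v dv r < Qr v dv (rho / 2) by apply: Qincr; lra.
have rin : 0 < r <= rho by apply/andP; split; lra.
have dvr := dvp _ rin.
have H0 := H_gt0 wq r0; have h0 := h_gt0 wq r0.
have e0 := energy_ge0 sv (ltW r0).
have He : 0 <= 'H_ r * energy v dv r by rewrite mulr_ge0// ltW.
have hh : 'h_ r <= 'h_ rho by apply: (h_nondec wq) => //; lra.
have kz : - (1 + `|kap f z|) <= kap f (v r).
  apply: (@le_trans _ _ (kap f z)); first by have := lerNnormlW (lexx `|kap f z|); lra.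
  by apply: zP; rewrite in_itv /=; apply: vb; apply/andP; split; lra.
have : dv r * A < m by rewrite -ltr_pdivlMr.
have k1 : 0 < 1 + `|kap f z| by rewrite ltr_pwDl.
have : - (dv r * A) <= 'h_ r * dv r * kap f (v r).
  apply: (@le_trans _ _ ('h_ r * dv r * - (1 + `|kap f z|))).
    rewrite mulrN lerN2 /A mulrCA mulrA; apply: ler_wpM2r; first exact: ltW.
    by apply: ler_wpM2r => //; exact: ltW.
  by apply: ler_wpM2l kz; rewrite mulr_ge0// ltW.
have : Qr v dv r = 'H_ r * energy v dv r + 'h_ r * dv r * kap f (v r) by [].
by rewrite /m; lra.
Unshelve. all: by end_near. Qed.

(** The solutions - u and - v start at r = 0 with H = 0, so the comparison
    hypothesis reduces to [Qr_first_branch_gt0]. *)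
Lemma amplitude_not_lt u du v dv k : sol u du -> sol v dv ->
  0 < u 0 -> exactly_sign_changes u k -> exactly_sign_changes v k ->
  ~ (u 0 < v 0).
Proof.
move=> su sv u0 uk vk uv.
have b0 := b_gt0 nf; have bb := b_beta nf.
have ub := amplitude_gt_beta su u0.
have vb : beta < v 0 by apply: lt_trans uv.
have nu := nodes_of_exactly su ub uk; have nv := nodes_of_exactly sv vb vk.
apply: (nodes_comparison (sol_opp su) (sol_opp sv) (lexx 0) (lexx 0)
  _ _ _ _ _ nu nv).
- by rewrite (dv0 su) oppr0.
- by rewrite (dv0 sv) oppr0.
- by rewrite ltrN2.
- by rewrite ltrN2.
move=> rho rho0 vrho dvp; rewrite (H_at0 wq) mul0r.
by apply: (Qr_first_branch_gt0 (sol_opp sv)) => //; rewrite ?vrho ltrN2.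
Qed.

(** * Uniqueness for the initial value problem *)

Section two_solutions.
Variables u du v dv : R -> R.
Hypotheses (su : sol u du) (sv : sol v dv).

(** f is Lipschitz near u z. The term - (q' / q) (u' - v')^2 has the good sign,
    so the unbounded coefficient q' / q at r = 0 is harmless. *)
Lemma local_unique_off_zero z : 0 <= z -> u z = v z -> du z = dv z ->
  u z != 0 -> exists2 d : R, 0 < d & forall r, z <= r <= z + d -> u r = v r.
Proof.
move=> z0 uv duv uz.
have [K [d0 [K0 d00 lip]]] := f_lipschitz nf uz (v_dom su z0).
have [d1 d10 d1P] := within_ball_right z0 (v_within su) d00.
have [d2 d20 d2P] := within_ball_right z0 (v_within sv) d00.
have m1 : Num.min d1 d2 <= d1 by rewrite ge_min lexx.
have m2 : Num.min d1 d2 <= d2 by rewrite ge_min lexx orbT.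
exists (Num.min d1 d2) => [|r /andP[zr rd]]; first by rewrite lt_min d10.
pose m t := (u t - v t) ^+ 2 + (du t - dv t) ^+ 2.
pose dm t := 2 * (u t - v t) * (du t - dv t) + 2 * (du t - dv t) *
  ((- (dq t / q t) * du t - f (u t)) - (- (dq t / q t) * dv t - f (v t))).
have m0 t : 0 <= m t by rewrite addr_ge0 ?sqr_ge0.
have cB (g k : R -> R) : {within `[0, +oo[, continuous g} ->
    {within `[0, +oo[, continuous k} ->
    {within `[0, +oo[, continuous (fun t => (g t - k t) ^+ 2)}.
  move=> gc kc; have gk := withinD gc (withinN kc).
  exact: (withinM gk gk).
suff : m r = 0.
  move/eqP; rewrite paddr_eq0 ?sqr_ge0// sqrf_eq0 subr_eq0.
  by move=> /andP[/eqP].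
apply: (@gronwall_zero R m dm (1 + K) z r zr).
- apply: (within_segment_of_ray z0); apply: withinD.
    by apply: cB; [exact: v_within su|exact: v_within sv].
  by apply: cB; [exact: dv_within su|exact: dv_within sv].
- move=> t /andP[zt _]; have t0 : 0 < t by lra.
  apply: is_derive1D; apply: is_derive1X2; apply: is_derive1B.
  + exact: (v_deriv su).
  + exact: (v_deriv sv).
  + exact: (dv_deriv su).
  + exact: (dv_deriv sv).
- move=> t /andP[zt tr]; have t0 : 0 < t by lra.
  have fl : `|f (u t) - f (v t)| <= K * `|u t - v t|.
    apply: lip; first by apply: d1P; apply/andP; split; lra.
    by rewrite uv; apply: d2P; apply/andP; split; lra.
  have a0 : 0 <= dq t / q t by rewrite divr_ge0 ?ltW ?(dq_gt0 wq) ?(q_gt0 wq).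
  have E : forall a b d w w' K aa : R, 0 <= aa -> 0 < K -> `|w - w'| <= K * `|a - b| ->
      forall d', 2 * (a - b) * (d - d') + 2 * (d - d') *
       ((- aa * d - w) - (- aa * d' - w')) <= (1 + K) * ((a - b) ^+ 2 + (d - d') ^+ 2).
    move=> x y p w w' L aa aa0 L0 Hw p'.
    have H1 : 2 * (p - p') * (w' - w) <= L * ((x - y) ^+ 2 + (p - p') ^+ 2).
      apply: (@le_trans _ _ (2 * (`|p - p'| * (L * `|x - y|)))).
        rewrite -mulrA ler_pM2l//; apply: le_trans (ler_norm _) _.
        by rewrite normrM distrC ler_wpM2l// distrC.
      rewrite -(real_normK (num_real (x - y))) -(real_normK (num_real (p - p'))).
      have := sqr_ge0 (`|x - y| - `|p - p'|); nra.
    have H2 : 0 <= aa * (p - p') ^+ 2 by rewrite mulr_ge0 ?sqr_ge0.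
    have := sqr_ge0 ((x - y) - (p - p')); nra.
  exact: E.
- by move=> t _; exact: m0.
- by rewrite /m uv duv !subrr expr0n /= addr0.
Qed.

Lemma Fe_lipschitz0 : exists2 eta : R, 0 < eta & forall x y : R,
  `|x| < eta -> `|y| < eta -> `|Fe f x - Fe f y| <= `|x - y|.
Proof.
have d0 : dom c 0.
  by apply: dom_le (beta_dom nf); rewrite normr0.
have f0 : f 0 = 0.
  have := f_odd nf d0; rewrite oppr0 => /eqP; rewrite -addr_eq0 -mulr2n.
  by rewrite mulrn_eq0 => /eqP.
have /cvgrPdist_lt /(_ _ (@ltr01 R)) [d /= dp dP] := f_continuous nf d0.
have b0 := b_gt0 nf; have bb := b_beta nf.
pose eta := Num.min d beta.
have e1 : eta <= d by rewrite ge_min lexx.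
have e2 : eta <= beta by rewrite ge_min lexx orbT.
exists eta; first by rewrite lt_min dp; lra.
have key x y : x <= y -> `|x| < eta -> `|y| < eta -> `|Fe f x - Fe f y| <= `|x - y|.
  rewrite le_eqVlt => /predU1P[-> _ _|xy xe ye]; first by rewrite !subrr.
  have zd s : x <= s <= y -> `|s| < eta.
    move: xe ye; rewrite !ltr_norml => /andP[? ?] /andP[? ?] /andP[? ?].
    by apply/andP; split; lra.
  have FD s : x <= s <= y -> is_derive s 1 (Fe f) (f s).
    move=> /zd se; apply: (Fe_deriv nf); apply: dom_le (beta_dom nf).
    by rewrite [leRHS]ger0_norm; lra.
  have FD' s : s \in `]x, y[%R -> is_derive s 1 (Fe f) (f s).
    by rewrite in_itv /= => /andP[? ?]; apply: FD; rewrite !ltW.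
  have Fc : {within `[x, y], continuous (Fe f)}.
    by apply: (@is_derive_within _ _ f) => s; rewrite /= in_itv; exact: FD.
  have [s] := MVT xy FD' Fc.
  rewrite in_itv /= => /andP[xs sy] E.
  rewrite distrC E normrM [leRHS]distrC -[leRHS]mul1r ler_wpM2r//.
  have se : `|s| < d by apply: lt_le_trans e1; apply: zd; rewrite !ltW.
  have /= := dP s; rewrite sub0r normrN => /(_ se).
  by rewrite f0 sub0r normrN => /ltW.
move=> x y xe ye; have [xy|/ltW yx] := leP x y; first exact: key.
by rewrite distrC [leRHS]distrC; exact: key.
Qed.

(** f need not be Lipschitz at 0, but the pair (u, energy) solves a system with
    Lipschitz right-hand side as long as u' <> 0: u'^2 = 2 (energy - F(u))
    and energy' = - (q' / q) u'^2. *)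
Lemma local_unique_crossing z : 0 < z -> u z = v z -> du z = dv z ->
  u z = 0 -> du z != 0 ->
  exists2 d : R, 0 < d & forall r, z <= r <= z + d -> u r = v r.
Proof.
move=> z0 uv duv uz duz; have z0' := ltW z0.
have [eta eta0 FL] := Fe_lipschitz0.
pose p := `|du z|; have p0 : 0 < p by rewrite normr_gt0.
have p2 : 0 < p / 2 by lra.
have [d1 d10 d1P] := within_ball_right z0' (v_within su) eta0.
have [d2 d20 d2P] := within_ball_right z0' (v_within sv) eta0.
have [d3 d30 d3P] := within_ball_right z0' (dv_within su) p2.
have [d4 d40 d4P] := within_ball_right z0' (dv_within sv) p2.
pose d := Num.min (Num.min d1 d2) (Num.min d3 d4).
have [m1 m2 m3 m4] : [/\ d <= d1, d <= d2, d <= d3 & d <= d4].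
  by rewrite /d !ge_min !lexx !orbT.
exists d => [|r /andP[zr rd]]; first by rewrite !lt_min d10 d20 d30 d40.
pose A := dq z / q z.
have A0 : 0 < A by rewrite divr_gt0 ?(dq_gt0 wq) ?(q_gt0 wq).
pose m t := (u t - v t) ^+ 2 + (energy u du t - energy v dv t) ^+ 2.
pose dm t := 2 * (u t - v t) * (du t - dv t) + 2 * (energy u du t - energy v dv t) *
  (- (dq t / q t) * du t ^+ 2 - - (dq t / q t) * dv t ^+ 2).
have cB (g k : R -> R) : {within `[0, +oo[, continuous g} ->
    {within `[0, +oo[, continuous k} ->
    {within `[0, +oo[, continuous (fun t => (g t - k t) ^+ 2)}.
  move=> gc kc; have gk := withinD gc (withinN kc).
  exact: (withinM gk gk).
suff : m r = 0.
  move/eqP; rewrite paddr_eq0 ?sqr_ge0// sqrf_eq0 subr_eq0.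
  by move=> /andP[/eqP].
apply: (@gronwall_zero R m dm (8 / p + 8 * A) z r zr).
- apply: (within_segment_of_ray z0'); apply: withinD.
    by apply: cB; [exact: v_within su|exact: v_within sv].
  by apply: cB; [exact: (energy_within su)|exact: (energy_within sv)].
- move=> t /andP[zt _]; have t0 : 0 < t by lra.
  apply: is_derive1D; apply: is_derive1X2; apply: is_derive1B.
  + exact: (v_deriv su).
  + exact: (v_deriv sv).
  + exact: (energy_deriv su).
  + exact: (energy_deriv sv).
- move=> t /andP[zt tr]; have t0 : 0 < t by lra.
  have inn e : d <= e -> z <= t <= z + e.
    move=> de; rewrite (ltW zt) (le_trans (ltW tr))// (le_trans rd)//.
    by rewrite lerD2l.
  have ut : `|u t| < eta.
    by have := d1P t (inn _ m1); rewrite uz subr0.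
  have vt : `|v t| < eta.
    by have := d2P t (inn _ m2); rewrite -uv uz subr0.
  have F12 := FL _ _ ut vt.
  have dut := d3P t (inn _ m3).
  have dvt := d4P t (inn _ m4); rewrite -duv in dvt.
  have sum_ge : p <= `|du t + dv t|.
    have -> : du t + dv t = 2 * du z - ((du z - du t) + (du z - dv t)) by ring.
    apply: le_trans (lerB_dist _ _).
    rewrite normrM (ger0_norm (ler0n _ 2)) -/p lerBrDl.
    have := ler_normD (du z - du t) (du z - dv t).
    rewrite (distrC (du z)) (distrC (du z) (dv t)).
    by lra.
  pose x := `|u t - v t|; pose y := `|energy u du t - energy v dv t|.
  have sq_diff : `|du t ^+ 2 - dv t ^+ 2| <= 2 * (x + y).
    have -> : du t ^+ 2 - dv t ^+ 2 =
        2 * ((energy u du t - energy v dv t) - (Fe f (u t) - Fe f (v t))).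
      by rewrite /energy; field.
    rewrite normrM (ger0_norm (ler0n _ 2)) ler_pM2l//.
    have := ler_normB (energy u du t - energy v dv t) (Fe f (u t) - Fe f (v t)).
    by rewrite /x /y; lra.
  have diff : `|du t - dv t| <= 2 / p * (x + y).
    have -> : 2 / p * (x + y) = 2 * (x + y) / p by rewrite mulrAC.
    rewrite ler_pdivlMr//; apply: le_trans sq_diff.
    by rewrite subr_sqr normrM ler_wpM2l.
  have x0 : 0 <= x := normr_ge0 _; have y0 : 0 <= y := normr_ge0 _.
  have a0 : 0 <= dq t / q t by rewrite divr_ge0 ?ltW ?(dq_gt0 wq) ?(q_gt0 wq).
  have aA : dq t / q t <= A by apply: (dlogq_noninc wq) => //; exact: ltW.
  have mE : m t = x ^+ 2 + y ^+ 2 by rewrite /m -(real_normK (num_real (u t - v t))) -(real_normK (num_real (energy u du t - energy v dv t))).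
  have t1 : 2 * (u t - v t) * (du t - dv t) <= 2 * x * (2 / p * (x + y)).
    rewrite -mulrA -[leRHS]mulrA ler_pM2l//; apply: le_trans (ler_norm _) _.
    by rewrite normrM ler_wpM2l.
  have t2 : 2 * (energy u du t - energy v dv t) *
      (- (dq t / q t) * du t ^+ 2 - - (dq t / q t) * dv t ^+ 2) <=
      2 * y * (A * (2 * (x + y))).
    rewrite -mulrA -[leRHS]mulrA ler_pM2l//; apply: le_trans (ler_norm _) _.
    rewrite normrM ler_wpM2l//.
    have -> : - (dq t / q t) * du t ^+ 2 - - (dq t / q t) * dv t ^+ 2 =
      - ((dq t / q t) * (du t ^+ 2 - dv t ^+ 2)) by ring.
    by rewrite normrN normrM (ger0_norm a0); apply: ler_pM.
  rewrite mE; apply: le_trans (lerD t1 t2) _.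
  have xy1 := mulrD_le_sumsq x y.
  have xy2 : y * (x + y) <= 2 * (x ^+ 2 + y ^+ 2).
    by rewrite (addrC x) (addrC (x ^+ 2)) mulrD_le_sumsq.
  have -> : 2 * x * (2 / p * (x + y)) = 4 / p * (x * (x + y)) by ring.
  have -> : 2 * y * (A * (2 * (x + y))) = 4 * A * (y * (x + y)) by ring.
  have -> : (8 / p + 8 * A) * (x ^+ 2 + y ^+ 2) =
    4 / p * (2 * (x ^+ 2 + y ^+ 2)) + 4 * A * (2 * (x ^+ 2 + y ^+ 2)) by ring.
  by apply: lerD; apply: ler_wpM2l => //; [rewrite divr_ge0// ltW|rewrite mulr_ge0// ltW].
- by move=> t _; rewrite addr_ge0 ?sqr_ge0.
- by rewrite /m /energy uv duv !subrr expr0n /= addr0.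
Qed.

Lemma local_unique z : 0 <= z -> u z = v z -> du z = dv z ->
  exists2 d : R, 0 < d & forall r, z <= r <= z + d -> u r = v r.
Proof.
move=> z0 uv duv; have [uz|uz] := eqVneq (u z) 0; last exact: local_unique_off_zero.
have [duz|duz] := eqVneq (du z) 0; last first.
  apply: local_unique_crossing => //; rewrite lt_neqAle z0 andbT eq_sym.
  by apply: contra duz => /eqP ->; rewrite (dv0 su).
have eu : energy u du z = 0 by rewrite /energy uz duz (Fe_0 nf) expr0n /= mul0r addr0.
have ev : energy v dv z = 0 by rewrite /energy -uv -duv uz duz (Fe_0 nf) expr0n /= mul0r addr0.
exists 1 => // r /andP[zr _].
have [-> _] := energy_eq0 su z0 eu zr.
by have [-> _] := energy_eq0 sv z0 ev zr.
Qed.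

Lemma sol_unique : u 0 = v 0 -> forall r, 0 <= r -> u r = v r.
Proof.
move=> uv0 r r0; apply: contrapT => uvr.
pose S := [set t | 0 <= t /\ u t <> v t].
have Sr : S r by [].
have S0 : has_inf S by split; [exists r|exists 0 => t []].
pose z := inf S.
have z0 : 0 <= z by apply: lb_le_inf; [exists r|move=> t []].
have before t : 0 <= t -> t < z -> u t = v t.
  move=> t0 tz; apply: contrapT => ne.
  by have := ge_inf (proj2 S0) (conj t0 ne : S t); rewrite leNgt tz.
have left_eq (g k : R -> R) : {within `[0, +oo[, continuous g} ->
    {within `[0, +oo[, continuous k} -> 0 < z ->
    (forall t, 0 < t < z -> g t = k t) -> g z = k z.
  move=> gc kc zp gk.
  apply: (@cvg_unique _ (@Rhausdorff R) (g @ z^'-)); first exact: cvg_left0.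
  apply: cvg_trans (cvg_left0 zp kc); apply: near_eq_cvg.
  by near=> t; apply/esym/gk; apply/andP; split; near: t;
    [exact: nbhs_left_gt|exact: nbhs_left_lt].
have [uz duz] : u z = v z /\ du z = dv z.
  move: z0; rewrite le_eqVlt => /predU1P[<-|zp].
    by rewrite (dv0 su) (dv0 sv).
  split.
    apply: left_eq (v_within su) (v_within sv) zp _ => t /andP[t0 tz].
    by apply: before => //; exact: ltW.
  apply: left_eq (dv_within su) (dv_within sv) zp _ => t /andP[t0 tz].
  have [_ <-] := v_deriv su t0; have [_ <-] := v_deriv sv t0.
  apply: near_eq_derive; near=> s; apply: before.
    by apply: ltW; near: s; exact: lt_nbhsr.
  by near: s; exact: lt_nbhsl.
have [d d0 dP] := local_unique z0 uz duz.
have [t [t0 ut] tz] := inf_lt (proj1 S0) (ltac:(by rewrite ltrDl) : inf S < z + d).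
apply: ut; have [tz'|zt] := ltP t z; first exact: before.
by apply: dP; rewrite zt ltW.
Unshelve. all: by end_near. Qed.

End two_solutions.

End shooting.

(** * Derivation of the facts on the solution, f and q *)

Section regularity.
Context {R : realType}.
Implicit Types (r s t x y z : R).

(** At 0, the difference quotient has a limit, hence is bounded. *)
Lemma C1_within (g dg : R -> R) : C1_Rplus g dg ->
  {within `[0, +oo[, continuous g}.
Proof.
move=> [_ gD g0]; apply/subspace_continuousP => x; rewrite /= in_itv /= andbT.
rewrite le_eqVlt => /predU1P[<-|x0]; last first.
  apply: cvg_within_filter.
  exact: is_derive1_continuous (gD _ x0).
apply/cvgrPdist_lt => eps eps0.
have /cvgrPdist_lt /(_ _ (@ltr01 R)) [d /= d0 dP] := g0.
pose A := `|dg 0| + 1.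
have A0 : 0 < A by rewrite ltr_wpDl.
have eA : 0 < eps / A by rewrite divr_gt0.
rewrite near_withinE; near=> y; rewrite /= in_itv /= andbT.
rewrite le_eqVlt => /predU1P[<-|y0]; first by rewrite subrr normr0.
have yd : `|0 - y| < d.
  by near: y; exists d.
have := dP y yd y0 => q1.
have gy : `|(g y - g 0) / y| < A.
  have := ler_normB (dg 0) (dg 0 - (g y - g 0) / y).
  by rewrite opprB addrCA subrr addr0 /A; lra.
have yA : `|0 - y| < eps / A by near: y; exists (eps / A).
rewrite sub0r normrN in yA.
have -> : g 0 - g y = - ((g y - g 0) / y * y) by rewrite divfK ?gt_eqF// opprB.
rewrite normrN normrM; rewrite ltr_pdivlMr// in yA.
apply: le_lt_trans yA; rewrite mulrC; apply: ler_wpM2l => //; exact: ltW.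
Unshelve. all: by end_near. Qed.

Lemma C1_derive1 (g dg : R -> R) r : C1_Rplus g dg -> 0 < r ->
  derive1 g r = dg r.
Proof. by move=> [_ gD _] /gD[_ <-]; rewrite derive1E. Qed.

Lemma sol_of_is_solution (c : \bar R) (f q dq u : R -> R) :
  C1_Rplus q dq -> (forall r, 0 < r -> 0 < q r) ->
  is_solution c f q u -> exists du, sol c f q dq u du.
Proof.
move=> qC qp [[du uC du0] ud quD quE ulim]; exists du.
have [duc uD _] := uC; have [_ qD _] := qC.
split => //; first exact: C1_within uC.
move=> r r0.
have D1 : is_derive r 1 (q \* derive1 u) (- (q r * f (u r))).
  split; first exact: quD.
  by apply/eqP; rewrite -derive1E -addr_eq0; apply/eqP/quE.
have q0 : q r != 0 by rewrite gt_eqF ?qp.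
have D2 := is_derive1M D1 (is_derive1V q0 (qD r r0)).
have D3 : is_derive r 1 du (- (q r * f (u r)) * (q r)^-1 +
    (q r * derive1 u r) * (- dq r / q r ^+ 2)).
  apply: near_eq_is_derive D2; near=> t.
  have t0 : 0 < t by near: t; exact: lt_nbhsr.
  by rewrite /= (C1_derive1 uC t0) mulrAC divff ?mul1r// gt_eqF ?qp.
apply: (is_derive_eq D3); rewrite (C1_derive1 uC r0).
have E : forall k w d k' : R, k != 0 ->
   - (k * w) * k^-1 + k * d * (- k' / k ^+ 2) = - (k' / k) * d - w.
  by move=> k w d k' k0; field.
exact: E.
Unshelve. all: by end_near. Qed.

End regularity.

Section nonlinear.
Context {R : realType}.
Variables (c : \bar R) (f : R -> R) (b beta C : R).
Hypotheses (f_cont : forall s : R, dom c s -> {for s, continuous f})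
  (f1 : cond_f1 c f b beta) (f2 : cond_f2 c f) (f7 : cond_f7 c f beta C).
Implicit Types (r s t x y z : R).

Let b0 : 0 < b. Proof. by case: f1 => _ _ []. Qed.
Let bb : b < beta. Proof. by case: f1 => _ _ []. Qed.
Let betac : dom c beta.
Proof. by case: f1 => _ _ [_ _ bc] _ _; rewrite /dom /= gtr0_norm// (lt_trans b0). Qed.
Let f_odd' s : dom c s -> f (- s) = - f s. Proof. by case: f1 => + _ _ _ _; apply. Qed.

Lemma dom_open s : dom c s -> \forall t \near s, dom c t.
Proof.
rewrite /dom /=; case: (c) => [x| |]//=.
  rewrite lte_fin => sx; near=> t; rewrite /= lte_fin.
  have ts : `|s - t| < x - `|s|.
    by near: t; apply: cvgr_dist_lt; [exact: cvg_id|rewrite subr_gt0].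
  by have := ler_normB s (s - t); rewrite opprB addrCA subrr addr0; lra.
by move=> _; near=> t; rewrite /= ltry.
Unshelve. all: by end_near. Qed.

Lemma F_integrable x : dom c x -> 0 <= x ->
  (@lebesgue_measure R).-integrable `[0, x] (EFin \o f).
Proof.
move=> xc x0; apply: continuous_compact_integrable; first exact: segment_compact.
apply/continuous_in_subspaceT => s; rewrite inE /= in_itv /= => /andP[s0 sx].
by apply: f_cont; apply: dom_le xc; rewrite !ger0_norm.
Qed.

Lemma F_deriv x : 0 < x -> dom c x -> is_derive x 1 (F f) (f x).
Proof.
move=> x0 xc; have [y xy yc] := dom_right (ltW x0) xc.
have [D1 D2] := continuous_FTC1_closed xy (F_integrable yc (ltW (lt_trans x0 xy)))
  x0 (f_cont xc).
split; first exact: D1.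
by rewrite -derive1E; exact: D2.
Qed.

Lemma F_0 : F f 0 = 0.
Proof. by rewrite /F set_itv1 Rintegral_set1. Qed.

Lemma F_within x : 0 <= x -> dom c x -> {within `[0, x], continuous (F f)}.
Proof.
by move=> x0 xc; apply: parameterized_integral_continuous => //; exact: F_integrable.
Qed.

Lemma Fe_continuous0 eps : 0 < eps -> exists2 d : R, 0 < d & forall s,
  `|s| < d -> `|Fe f s| <= eps * `|s|.
Proof.
move=> eps0.
have d0 : dom c 0 by apply: dom_le betac; rewrite normr0.
have f00 : f 0 = 0 by case: f1.
have /cvgrPdist_lt /(_ _ eps0) [d /= dp dP] := f_cont d0.
exists (Num.min d beta) => [|s]; first by rewrite lt_min dp (lt_trans b0).
rewrite lt_min => /andP[sd sb].
have [->|s0] := eqVneq s 0; first by rewrite /Fe normr0 F_0 normr0 mulr0.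
have sp : 0 < `|s| by rewrite normr_gt0.
have sc : dom c `|s| by apply: dom_le betac; rewrite normr_id (ltW (lt_le_trans sb (ler_norm _))).
have FD x : x \in `]0, `|s|[%R -> is_derive x 1 (F f) (f x).
  rewrite in_itv /= => /andP[x0 xs]; apply: F_deriv => //.
  by apply: dom_le sc; rewrite normr_id ger0_norm ltW.
have [x] := MVT sp FD (F_within (ltW sp) sc).
rewrite in_itv /= F_0 !subr0 => /andP[x0 xs] E.
rewrite /Fe E normrM normr_id ler_wpM2r//.
have /= := dP x; rewrite sub0r normrN gtr0_norm// => /(_ (lt_trans xs sd)).
by rewrite f00 sub0r normrN => /ltW.
Qed.

(** At 0 the two one-sided derivatives agree because F(x) = o(x). *)
Lemma Fe_is_derive s : dom c s -> is_derive s 1 (Fe f) (f s).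
Proof.
move=> sc; have [s0|s0|s0] := ltgtP s 0.
- have nsc : dom c (- s) by apply: dom_le sc; rewrite normrN.
  have D1 := F_deriv (ltac:(by rewrite oppr_gt0) : 0 < - s) nsc.
  have D := is_derive1_comp D1 (is_derive1N (is_derive_id s (1 : R))).
  have D' : is_derive s 1 (Fe f) (f (- s) * - 1).
    apply: near_eq_is_derive D; near=> t; rewrite /Fe ler0_norm//.
    by apply: ltW; near: t; exact: lt_nbhsl.
  by apply: (is_derive_eq D'); rewrite f_odd' // mulrN1 opprK.
- apply: near_eq_is_derive (F_deriv s0 sc); near=> t; rewrite /Fe ger0_norm//.
  by apply: ltW; near: t; exact: lt_nbhsr.
rewrite s0; have f00 : f 0 = 0 by case: f1.
have Fe00 : Fe f 0 = 0 by rewrite /Fe normr0 F_0.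
apply/is_derive1_caratheodory; exists (fun t => Fe f t / t); split.
- move=> t; rewrite Fe00 !subr0; have [->|t0] := eqVneq t 0.
    by rewrite mulr0 Fe00.
  by rewrite divfK.
- apply/cvgrPdist_le => eps eps0; have [d d0 dP] := Fe_continuous0 eps0.
  exists d => //= t; rewrite /= sub0r normrN => td; rewrite Fe00 mul0r sub0r normrN normrM normfV.
  have [->|t0] := eqVneq t 0; first by rewrite normr0 invr0 mulr0 ltW.
  by rewrite ler_pdivrMr ?normr_gt0//; apply: dP.
- by rewrite Fe00 mul0r f00.
Unshelve. all: by end_near. Qed.

Lemma F_le0 x : 0 <= x <= beta -> F f x <= 0.
Proof.
have [_ _ _ [fpos fneg _] Fb] := f1; have b_0 := b0; have b_b := bb.
move=> /andP[x0 xb]; have xdom y : 0 <= y <= beta -> dom c y.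
  by move=> /andP[y0 yb]; apply: dom_le betac; rewrite !ger0_norm//; lra.
have [xlb|bx] := leP x b.
  rewrite -oppr_ge0 -[0]oppr0 -F_0.
  apply: (@le_of_deriv_ge0 R (fun t => - F f t) (fun t => - f t) _ _ x0).
  - by apply: withinN; apply: F_within => //; apply: xdom; rewrite x0.
  - move=> y /andP[y0 yx]; apply: is_derive1N; apply: F_deriv => //.
    by apply: xdom; apply/andP; split; lra.
  - by move=> y /andP[y0 yx]; rewrite oppr_ge0; apply: fneg; apply/andP; split; lra.
rewrite -Fb; apply: (@le_of_deriv_ge0 R (F f) f _ _ xb).
- apply: (@is_derive_within _ _ f) => y; rewrite /= in_itv /= => /andP[xy yb].
  by apply: F_deriv; [lra|apply: xdom; apply/andP; split; lra].
- move=> y /andP[xy yb]; apply: F_deriv; [lra|apply: xdom; apply/andP; split; lra].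
- move=> y /andP[xy yb]; apply/ltW/fpos; [lra|apply: xdom; apply/andP; split; lra].
Qed.

Lemma F_gt0 x : beta < x -> dom c x -> 0 < F f x.
Proof.
have [_ _ _ [fpos fneg _] Fb] := f1; have b_0 := b0; have b_b := bb.
move=> bx xc; rewrite -Fb.
have ydom y : beta <= y <= x -> dom c y.
  by move=> /andP[? ?]; apply: dom_le xc; rewrite !ger0_norm//; lra.
apply: (@lt_of_deriv_gt0 R (F f) f _ _ bx).
- apply: (@is_derive_within _ _ f) => y; rewrite /= in_itv /= => yin.
  by apply: F_deriv (ydom _ yin); case/andP: yin => ? ?; lra.
- move=> y /andP[xy yb]; apply: F_deriv; [lra|apply: ydom; apply/andP; split; lra].
- move=> y /andP[xy yb]; apply: fpos; [lra|apply: ydom; apply/andP; split; lra].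
Qed.

Definition dkap_of s : R := derive1 (fun t => F f t / f t) `|s|.

Lemma kap_pos_deriv s : b < s -> dom c s ->
  is_derive s 1 (fun t => F f t / f t) (derive1 (fun t => F f t / f t) s).
Proof.
move=> bs sc; have [_ _ _ [fpos _ _] _] := f1; have b_0 := b0; have [fD _ _] := f2.
have s0 : 0 < s by exact: lt_trans bs.
have fs : f s != 0 by rewrite gt_eqF// fpos.
have D := is_derive1M (F_deriv s0 sc) (is_derive1V fs (derivableP (fD _ s0 sc))).
by rewrite derive1E; apply: derivableP; case: D.
Qed.

Lemma kap_is_derive s : b < `|s| -> dom c s -> is_derive s 1 (kap f) (dkap_of s).
Proof.
move=> bs sc; have b_0 := b0; rewrite /dkap_of; have [s0|s0] := leP 0 s.
  have sE : `|s| = s by rewrite ger0_norm.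
  rewrite sE in bs *.
  apply: near_eq_is_derive (kap_pos_deriv bs sc); near=> t.
  by rewrite /kap /Fe ger0_norm//; apply: ltW; near: t; apply: lt_nbhsr; lra.
rewrite ltr0_norm// in bs *.
have nsc : dom c (- s) by apply: dom_le sc; rewrite normrN.
have D := is_derive1N (is_derive1_comp (kap_pos_deriv bs nsc)
  (is_derive1N (is_derive_id s (1 : R)))).
rewrite mulrN1 opprK in D.
apply: near_eq_is_derive D; near=> t.
have td : dom c t by near: t; exact: dom_open.
have t0 : t <= 0 by apply: ltW; near: t; exact: lt_nbhsl.
by rewrite /kap /Fe ler0_norm//= f_odd'// invrN mulrN opprK.
Unshelve. all: by end_near. Qed.

(** The mean value theorem, the derivative of f being continuous at s. *)
Lemma f_lip_pos s : 0 < s -> dom c s -> exists K d : R,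
    [/\ 0 < K, 0 < d & forall x y, `|x - s| < d -> `|y - s| < d ->
      [/\ dom c x, dom c y & `|f x - f y| <= K * `|x - y|]].
Proof.
move=> s0 sc; have [fD fC _] := f2.
have /cvgrPdist_lt /(_ _ (@ltr01 R)) [d1 /= d10 d1P] := fC s s0 sc.
have [d2 /= d20 d2P] := dom_open sc.
pose d := Num.min (Num.min d1 d2) s.
have d0 : 0 < d by rewrite !lt_min d10 d20.
have [m1 m2 m3] : [/\ d <= d1, d <= d2 & d <= s].
  by rewrite /d !ge_min !lexx !orbT.
have K0 : 0 < `|derive1 f s| + 1 by rewrite ltr_wpDl.
exists (`|derive1 f s| + 1), d; split => //.
have inb x : `|x - s| < d -> [/\ 0 < x, dom c x & `|derive1 f x| <= `|derive1 f s| + 1].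
  move=> xs; have xs' := xs; rewrite distrC in xs'; split.
  - by move: xs; rewrite ltr_norml => /andP[? ?]; lra.
  - by apply: d2P; exact: lt_le_trans m2.
  - have := d1P x (lt_le_trans xs' m1) => H.
    have := ler_normB (derive1 f s) (derive1 f s - derive1 f x).
    by rewrite opprB addrCA subrr addr0; lra.
have key x y : x <= y -> `|x - s| < d -> `|y - s| < d ->
    `|f x - f y| <= (`|derive1 f s| + 1) * `|x - y|.
  rewrite le_eqVlt => /predU1P[->|xy] xs ys; first by rewrite !subrr normr0 mulr0.
  have zs z : x <= z <= y -> `|z - s| < d.
    move: xs ys; rewrite !ltr_norml => /andP[? ?] /andP[? ?] /andP[? ?].
    by apply/andP; split; lra.
  have FD z : x <= z <= y -> is_derive z 1 f (derive1 f z).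
    by move=> /zs/inb[z0 zc _]; rewrite derive1E; apply: derivableP; exact: fD.
  have FD' z : z \in `]x, y[%R -> is_derive z 1 f (derive1 f z).
    by rewrite in_itv /= => /andP[? ?]; apply: FD; rewrite !ltW.
  have Fc : {within `[x, y], continuous f}.
    by apply: (@is_derive_within _ _ (derive1 f)) => z; rewrite /= in_itv; exact: FD.
  have [z] := MVT xy FD' Fc.
  rewrite in_itv /= => /andP[xz zy] E.
  rewrite distrC E normrM [`|x - y|]distrC ler_wpM2r//.
  by have [] := inb z (zs z ltac:(by rewrite !ltW)).
move=> x y xs ys; have [_ xc _] := inb _ xs; have [_ yc _] := inb _ ys.
split => //; have [xy|/ltW yx] := leP x y; first exact: key.
by rewrite distrC [`|x - y|]distrC; exact: key.
Qed.

Lemma nonlinearity_of_cond : nonlinearity c f dkap_of b beta C.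
Proof.
have [_ f00 _ [fpos fneg _] Fb] := f1.
split => //.
- exact: Fe_is_derive.
- by move=> s sb; apply: F_le0; rewrite sb normr_ge0.
- by move=> s sb; rewrite /Fe sb.
- by move=> s bs sc; apply: F_gt0 => //; apply: dom_le sc; rewrite normr_id.
- exact: kap_is_derive.
- by move=> s bs sc; apply: f7 => //; apply: dom_le sc; rewrite normr_id.
- by rewrite /Fe normr0 F_0.
move=> s s0 sc; have [sn|sp|E] := ltgtP s 0; last by rewrite E eqxx in s0.
  have nsc : dom c (- s) by apply: dom_le sc; rewrite normrN.
  have [|K [d [K0 d0 H]]] := f_lip_pos (s := - s) _ nsc.
    by rewrite oppr_gt0.
  exists K, d; split => // x y xs ys.
  have [||xc yc] := H (- x) (- y).
  - by rewrite -opprD normrN.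
  - by rewrite -opprD normrN.
  have xc' : dom c x by apply: dom_le xc; rewrite normrN.
  have yc' : dom c y by apply: dom_le yc; rewrite normrN.
  by rewrite !f_odd'// -!opprD !normrN.
have [K [d [K0 d0 H]]] := f_lip_pos sp sc.
by exists K, d; split => // x y xs ys; have [] := H x y xs ys.
Qed.

End nonlinear.

Lemma integrable_setU_disjoint d (T : measurableType d) (R : realType)
    (mu : {measure set T -> \bar R}) (A B : set T) (f : T -> \bar R) :
  measurable A -> measurable B -> [disjoint A & B] ->
  mu.-integrable A f -> mu.-integrable B f -> mu.-integrable (A `|` B) f.
Proof.
move=> mA mB AB /integrableP[mfA iA] /integrableP[mfB iB].
have mf : measurable_fun (A `|` B) f by apply/measurable_funU.
apply/integrableP; split => //.
rewrite ge0_integral_setU//; first exact: lte_add_pinfty.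
by apply: measurableT_comp => //; exact: abse_measurable.
Qed.

Section weights.
Context {R : realType}.
Variables (q dq : R -> R) (C : R).
Hypotheses (qC : C1_Rplus q dq) (q1 : cond_q1 q) (q2 : cond_q2 q)
  (q4 : cond_q4 q) (q6 : cond_q6 q) (q7 : cond_q7 q C).
Implicit Types (r s t x y z : R).

Local Notation mu := (@lebesgue_measure R).

Let q_pos r : 0 < r -> 0 < q r.
Proof.
move=> r0; have [_ _ q00 dqp] := q1.
rewrite -q00; apply: (@lt_of_deriv_gt0 R q dq 0 r r0).
- exact: within_segment_of_ray (lexx 0) (C1_within qC).
- by move=> x /andP[x0 _]; case: qC => _ + _; apply.
- by move=> x /andP[x0 _]; rewrite -(C1_derive1 qC x0); exact: dqp.
Qed.

Let q_der r : 0 < r -> is_derive r 1 q (dq r).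
Proof. by case: qC => _ + _; apply. Qed.

Let dq_pos r : 0 < r -> 0 < dq r.
Proof. by move=> r0; rewrite -(C1_derive1 qC r0); case: q1 => _ _ _; apply. Qed.

Let qV_der r : 0 < r -> is_derive r 1 (fun t => (q t)^-1) (- dq r / q r ^+ 2).
Proof. by move=> r0; apply: is_derive1V; rewrite ?gt_eqF ?q_pos//; exact: q_der. Qed.

Let qV_integrable r s : 0 < r ->
  mu.-integrable `[r, s] (EFin \o (fun t => (q t)^-1)).
Proof.
move=> r0; apply: continuous_compact_integrable; first exact: segment_compact.
apply: (@is_derive_within _ _ (fun r => - dq r / q r ^+ 2)) => t.
by rewrite /= in_itv /= => /andP[rt _]; apply: qV_der; exact: lt_le_trans rt.
Qed.

Let qV_integrable_tail r : 0 < r ->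
  mu.-integrable `]r, +oo[ (EFin \o (fun t => (q t)^-1)).
Proof.
move=> r0; have [int1 _ _ _ _] := q4.
have [r1|r1] := leP 1 r.
  apply: integrableS int1 => //; apply: subset_itvr; by rewrite bnd_simp.
rewrite (@itv_bndbnd_setU _ _ _ (BRight 1)) ?bnd_simp//; last exact: ltW.
apply: integrable_setU_disjoint => //.
  apply/disj_setPS => y [/=]; rewrite !in_itv/= andbT => /andP[_ y1].
  by rewrite ltNge y1.
apply: integrableS (qV_integrable 1 r0) => //.
by apply: subset_itvr; rewrite bnd_simp.
Qed.

(** The factor of q in the definition of h. *)
Definition tail r : R := \int[mu]_(s in `]r, +oo[) (q s)^-1.

Lemma tailB r s : 0 < r -> r <= s ->
  tail s = tail r - \int[mu]_(t in `]r, s]) (q t)^-1.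
Proof.
move=> r0 rs; rewrite /tail -(@Rintegral_itvB _ _ (BRight r) (BInfty _ false) s) //.
- exact: qV_integrable_tail.
Qed.

Lemma tail_deriv r : 0 < r -> is_derive r 1 tail (- (q r)^-1).
Proof.
move=> r0; pose a := r / 2.
have a0 : 0 < a by rewrite divr_gt0.
have ar : a < r by rewrite /a; lra.
have rr : r < r + 1 by lra.
have qc : {for r, continuous (fun t => (q t)^-1)}.
  exact: is_derive1_continuous (qV_der r0).
have ia : mu.-integrable [set` Interval (BRight a) (BRight (r + 1))] (EFin \o (fun t => (q t)^-1)).
  apply: integrableS (qV_integrable (r + 1) a0) => //.
  by apply: subset_itvr; rewrite bnd_simp.
have [D1 D2] := continuous_FTC1 rr ia (ltac:(by rewrite bnd_simp) : (BRight a < BRight r)%O) qc.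
have D : is_derive r 1 (fun y => \int[mu]_(t in `]a, y]) (q t)^-1) (q r)^-1.
  split; first exact: D1.
  by rewrite -derive1E; exact: D2.
have D' := is_derive1B (is_derive_cst (tail a : R) r (1 : R)) D.
rewrite sub0r in D'.
apply: near_eq_is_derive D'; near=> s; rewrite /= -tailB//.
by apply: ltW; near: s; exact: lt_nbhsr.
Unshelve. all: by end_near. Qed.

Lemma tail_lt r s : 0 < r -> r < s -> tail s < tail r.
Proof.
move=> r0 rs; rewrite -ltrN2.
apply: (@lt_of_deriv_gt0 R (fun t => - tail t) (fun t => - - (q t)^-1) _ _ rs).
- apply: (@is_derive_within _ _ (fun t => - - (q t)^-1)) => t.
  rewrite /= in_itv /= => /andP[rt _]; apply: is_derive1N; apply: tail_deriv.
  exact: lt_le_trans rt.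
- move=> t /andP[rt _]; apply: is_derive1N; apply: tail_deriv.
  exact: lt_trans rt.
- by move=> t /andP[rt _]; rewrite opprK invr_gt0 q_pos// (lt_trans r0).
Qed.

Lemma tail_gt0 r : 0 < r -> 0 < tail r.
Proof.
move=> r0; apply: le_lt_trans (tail_lt r0 (ltac:(lra) : r < r + 1)).
apply: Rintegral_ge0 => t; rewrite /= in_itv /= andbT => rt.
by rewrite invr_ge0 ltW// q_pos//; lra.
Qed.

(** F below is the integral of 1 / q over [1, x]; it increases to a limit l,
    which the fundamental theorem on [1, +oo[ identifies with tail 1. *)
Lemma tail_small eps : 0 < eps -> exists2 r0, 0 < r0 &
  forall r, r0 <= r -> tail r <= eps.
Proof.
move=> eps0.
pose F x := tail 1 - tail (Num.max 1 x).
have tail_le r s : 1 <= r -> r <= s -> tail s <= tail r.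
  move=> r1; rewrite le_eqVlt => /predU1P[->//|rs].
  by apply/ltW/tail_lt => //; lra.
have maxl x : 1 <= Num.max 1 x by rewrite le_max lexx.
have Fmono : {homo F : n m / n <= m}.
  move=> x y xy; rewrite lerD2l lerN2; apply: tail_le => //.
  by rewrite ge_max maxl le_max xy orbT.
have Fub : has_ubound (range F).
  exists (tail 1) => _ [x _ <-]; rewrite gerBl; apply/ltW/tail_gt0.
  by have := maxl x; lra.
have Fl := nondecreasing_cvgr Fmono Fub.
set l := sup _ in Fl.
have FE x : 1 <= x -> F x = tail 1 - tail x by move=> x1; rewrite /F max_r.
have FD x : 1 < x -> is_derive x 1 F (q x)^-1.
  move=> x1; have x0 : 0 < x by lra.
  have D := is_derive1B (is_derive_cst (tail 1 : R) x (1 : R)) (tail_deriv x0).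
  rewrite sub0r opprK in D; apply: near_eq_is_derive D; near=> y.
  by rewrite /= FE//; apply: ltW; near: y; exact: lt_nbhsr.
have tail1E : tail 1 = l.
  rewrite /tail Rintegral_itv_obnd_cbnd; last exact: qV_integrable_tail.
  rewrite (@Rintegral_ge0_continuous_FTC2y _ (fun s => (q s)^-1) F 1 l).
  - by rewrite FE// subrr subr0.
  - by move=> x x1; rewrite invr_ge0 ltW// q_pos//; lra.
  - apply: (@is_derive_within _ _ (fun r => - dq r / q r ^+ 2)) => t.
    by rewrite /= in_itv /= andbT => t1; apply: qV_der; lra.
  - exact: Fl.
  - by move=> x /FD[].
  - rewrite (FE 1 (lexx 1)).
    have tc := is_derive1_continuous (tail_deriv (@ltr01 R)).
    have : (tail 1 - tail x) @[x --> (1:R)^'+] --> tail 1 - tail 1.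
      apply: cvgB; first exact: cvg_cst.
      exact: cvg_at_right_filter tc.
    apply: cvg_trans; apply: near_eq_cvg; near=> x.
    by rewrite FE//; apply: ltW; near: x; exact: nbhs_right_gt.
  - move=> x; rewrite in_itv /= andbT => /FD[_ <-].
    by rewrite derive1E.
have /cvgrPdist_lt /(_ _ eps0) [M [_ MP]] := Fl.
exists (Num.max 1 (M + 1)) => [|r]; first by rewrite lt_max ltr01.
rewrite ge_max => /andP[r1 Mr]; have := MP r ltac:(lra).
rewrite /= FE// -tail1E opprB addrCA subrr addr0 => H.
by apply: ltW; apply: le_lt_trans H; exact: ler_norm.
Unshelve. all: by end_near. Qed.

Let hE r : h q r = q r * tail r. Proof. by []. Qed.

Let h_pos r : 0 < r -> 0 < h q r.
Proof. by move=> r0; rewrite hE mulr_gt0 ?q_pos ?tail_gt0. Qed.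

Let h_der r : 0 < r -> is_derive r 1 (h q) (dq r / q r * h q r - 1).
Proof.
move=> r0; apply: (is_derive_eq (is_derive1M (q_der r0) (tail_deriv r0))).
have q0 : q r != 0 by rewrite gt_eqF ?q_pos.
by rewrite hE mulrN divff// mulrA divfK.
Qed.

Let h'E r : 0 < r -> derive1 (h q) r = dq r / q r * h q r - 1.
Proof. by move=> /h_der[_ <-]; rewrite derive1E. Qed.

Let h'_pos r : 0 < r -> 0 < derive1 (h q) r.
Proof. by case: q4 => _ _ + _ _; apply. Qed.

Let h'_noninc r s : 0 < r -> r <= s -> derive1 (h q) s <= derive1 (h q) r.
Proof. by case: q4 => _ _ _ + _; apply. Qed.

Let h_D r : 0 < r -> is_derive r 1 (h q) (derive1 (h q) r).
Proof. by move=> r0; rewrite h'E//; exact: h_der. Qed.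

Let h_nd r s : 0 < r -> r <= s -> h q r <= h q s.
Proof.
move=> r0 rs; apply: (@le_of_deriv_ge0 R (h q) (derive1 (h q)) _ _ rs).
- apply: (@is_derive_within _ _ (derive1 (h q))) => t.
  by rewrite /= in_itv /= => /andP[rt _]; apply: h_D; exact: lt_le_trans rt.
- by move=> t /andP[rt _]; apply: h_D; exact: lt_trans rt.
- by move=> t /andP[rt _]; apply/ltW/h'_pos; exact: lt_trans rt.
Qed.

Let h_integrable x : mu.-integrable `]0, x] (EFin \o h q).
Proof.
apply: measurable_bounded_integrable => //.
- by rewrite /= lebesgue_measure_itv /= lte_fin; case: ifP => // _; rewrite -EFinB ltry.
- have sub : `]0, x] `<=` `]0, +oo[ by apply: subset_itvl; rewrite bnd_simp.
  apply: (measurable_funS _ sub) => //.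
  apply: open_continuous_measurable_fun; first exact: interval_open.
  move=> y; rewrite inE /= in_itv /= andbT => y0.
  exact: is_derive1_continuous (h_D y0).
exists `|h q x|; split; first exact: num_real.
move=> M xM y; rewrite /= in_itv /= => /andP[y0 yx].
rewrite ger0_norm ?(ltW (h_pos y0))//; apply: le_trans (ltW xM).
by apply: le_trans (h_nd y0 yx) (ler_norm _).
Qed.

Let h_integrable_c x : 0 <= x -> mu.-integrable `[0, x] (EFin \o h q).
Proof.
move=> x0; have -> : `[0, x]%classic = [set 0] `|` `]0, x]%classic.
  by rewrite setU1itv// bnd_simp.
apply: integrable_setU_disjoint => //.
- apply/disj_setPS => y [/= ->]; by rewrite in_itv /= ltxx.
- rewrite -set_itv1; apply: continuous_compact_integrable.
    exact: segment_compact.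
  by rewrite set_itv1; exact: continuous_subspace1.
Qed.

Let HE x : 0 <= x -> H q x = \int[mu]_(s in `[0, x]) h q s.
Proof.
move=> x0; rewrite /H -Rintegral_itv_obnd_cbnd; last exact: h_integrable.
rewrite Rintegral_itv_bndo_bndc//; apply: integrableS (h_integrable x) => //.
by apply: subset_itvl; rewrite bnd_simp.
Qed.

Let H_der r : 0 < r -> is_derive r 1 (H q) (h q r).
Proof.
move=> r0; have rr : r < r + 1 by lra.
have hc := is_derive1_continuous (h_D r0).
have [D1 D2] := continuous_FTC1_closed rr (h_integrable_c (ltac:(lra) : 0 <= r + 1)) r0 hc.
have D : is_derive r 1 (fun x => \int[mu]_(s in `[0, x]) h q s) (h q r).
  split; first exact: D1.
  by rewrite -derive1E; exact: D2.
apply: near_eq_is_derive D; near=> s; rewrite HE//.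
by apply: ltW; near: s; exact: lt_nbhsr.
Unshelve. all: by end_near. Qed.

Let H_0 : H q 0 = 0.
Proof. by rewrite HE// set_itv1 Rintegral_set1. Qed.

Let H_wi : {within `[0, +oo[, continuous (H q)}.
Proof.
apply/subspace_continuousP => x; rewrite /= in_itv /= andbT.
rewrite le_eqVlt => /predU1P[<-|x0]; last first.
  by apply: cvg_within_filter; exact: is_derive1_continuous (H_der x0).
have pc := parameterized_integral_continuous (@ler01 R) (h_integrable_c (@ler01 R)).
apply/cvgrPdist_lt => eps eps0.
have [d d0 dP] := within_segment_dist pc (ltac:(by rewrite lexx ler01) : 0 <= 0 <= 1) eps0.
rewrite near_withinE; near=> y; rewrite /= in_itv /= andbT => y0.
rewrite /from_subspace H_0 HE// distrC.
have y1 : `|0 - y| < 1 by near: y; exists 1 => //=.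
have yd : `|0 - y| < d by near: y; exists d.
rewrite sub0r normrN ger0_norm// in y1 yd.
have := dP y; rewrite y0 (ltW y1) subr0 ger0_norm// => /(_ isT yd).
by rewrite /parameterized_integral set_itv1 Rintegral_set1.
Unshelve. all: by end_near. Qed.

Let H_pos r : 0 < r -> 0 < H q r.
Proof.
move=> r0; rewrite -H_0; apply: (@lt_of_deriv_gt0 R (H q) (h q) _ _ r0).
- exact: within_segment_of_ray (lexx 0) H_wi.
- by move=> t /andP[t0 _]; exact: H_der.
- by move=> t /andP[t0 _]; exact: h_pos.
Qed.

Let H_nd r s : 0 < r -> r <= s -> H q r <= H q s.
Proof.
move=> r0 rs; apply: (@le_of_deriv_ge0 R (H q) (h q) _ _ rs).
- exact: within_segment_of_ray (ltW r0) H_wi.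
- by move=> t /andP[rt _]; apply: H_der; exact: lt_trans rt.
- by move=> t /andP[rt _]; apply/ltW/h_pos; exact: lt_trans rt.
Qed.

(** h^2 is the integral of 2 h h', up to a nonnegative constant, and h' is
    nonincreasing. *)
Lemma h'H_le r : 0 < r -> 2 * derive1 (h q) r * H q r <= h q r ^+ 2.
Proof.
move=> r0; set k := derive1 (h q) r.
have k0 : 0 < k := h'_pos r0.
have mono t : 0 < t -> t <= r ->
    h q t ^+ 2 - 2 * k * H q t <= h q r ^+ 2 - 2 * k * H q r.
  move=> t0 tr.
  pose g y := 2 * h q y * derive1 (h q) y - 2 * k * h q y.
  have D y : t <= y -> is_derive y 1 (fun y => h q y ^+ 2 - 2 * k * H q y) (g y).
    move=> ty; have y0 : 0 < y by exact: lt_le_trans ty.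
    exact: is_derive1B (is_derive1X2 (h_D y0)) (is_derive1Z (2 * k) (H_der y0)).
  apply: (@le_of_deriv_ge0 R (fun y => h q y ^+ 2 - 2 * k * H q y) g _ _ tr).
  - apply: (@is_derive_within _ _ g) => y; rewrite /= in_itv /= => /andP[ty _].
    exact: D.
  - by move=> y /andP[/ltW ty _]; exact: D.
  - move=> y /andP[ty yr]; have y0 : 0 < y by exact: lt_trans ty.
    have := h'_noninc y0 (ltW yr); have := h_pos y0.
    by rewrite /g -/k; nra.
rewrite leNgt; apply/negP => lt_h.
have e0 : 0 < (2 * k * H q r - h q r ^+ 2) / (2 * k).
  by rewrite divr_gt0 ?mulr_gt0// subr_gt0.
have Hc := cvg_right0 (lexx 0) H_wi; rewrite H_0 in Hc.
have near_small := cvgr_lt _ Hc _ e0.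
have [t [tH t0 tr]] : exists t, [/\ H q t < (2 * k * H q r - h q r ^+ 2) / (2 * k),
    0 < t & t < r].
  apply: (@filter_ex _ (0^'+)); near=> t; split; near: t.
  - exact: near_small.
  - exact: nbhs_right_gt.
  - exact: nbhs_right_lt.
rewrite ltr_pdivlMr ?mulr_gt0// in tH.
have := mono _ t0 (ltW tr); have := sqr_ge0 (h q t).
by lra.
Unshelve. all: by end_near. Qed.

Let h2H r s : 0 < r -> r <= s -> h q s ^+ 2 * H q r <= h q r ^+ 2 * H q s.
Proof.
move=> r0 rs; have s0 : 0 < s by exact: lt_le_trans rs.
have Hr := H_pos r0; have Hs := H_pos s0.
rewrite -ler_pdivlMr// mulrAC -ler_pdivrMr//.
pose g y := 2 * h q y * derive1 (h q) y * (H q y)^-1 + h q y ^+ 2 * (- h q y / H q y ^+ 2).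
have D y : r <= y -> is_derive y 1 (fun y => h q y ^+ 2 * (H q y)^-1) (g y).
  move=> ry; have y0 : 0 < y by exact: lt_le_trans ry.
  apply: is_derive1M; first exact: is_derive1X2 (h_D y0).
  by apply: is_derive1V (H_der y0); rewrite gt_eqF// H_pos.
rewrite -lerN2.
apply: (@le_of_deriv_ge0 R (fun y => - (h q y ^+ 2 * (H q y)^-1)) (fun y => - g y) _ _ rs).
- apply: (@is_derive_within _ _ (fun y => - g y)) => y; rewrite /= in_itv /= => /andP[ty _].
  by apply: is_derive1N; exact: D.
- by move=> y /andP[/ltW ty _]; apply: is_derive1N; exact: D.
- move=> y /andP[ty yr]; have y0 : 0 < y by exact: lt_trans ty.
  have hy := h_pos y0; have Hy := H_pos y0.
  have -> : - g y = h q y / H q y ^+ 2 * (h q y ^+ 2 - 2 * derive1 (h q) y * H q y).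
    by rewrite /g; field; rewrite gt_eqF.
  apply: mulr_ge0; first by rewrite divr_ge0 ?sqr_ge0// ltW.
  by rewrite subr_ge0 h'H_le.
Qed.

Let G_eq' r : 0 < r -> dq r / q r * H q r = h q r * (G q r + 2^-1).
Proof.
move=> r0; rewrite /G subrK (C1_derive1 qC r0); field.
by rewrite !gt_eqF ?q_pos ?h_pos.
Qed.

Let G_le r : 0 < r -> G q r <= C.
Proof.
move=> r0; have [a [_ [GC _] _]] := q7.
rewrite -lee_fin; apply: le_trans GC; apply: ereal_sup_ubound.
by exists r => //=; rewrite in_itv /= r0.
Qed.

Let GhH r s : 0 < r -> r <= s ->
  G q r * h q r / Num.sqrt (H q r) <= G q s * h q s / Num.sqrt (H q s).
Proof. by case: q6 => _ _; apply. Qed.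

Let G_nonneg r : 0 < r -> 0 <= G q r.
Proof. by case: q6 => + _ _; apply. Qed.

(** G = (G h / sqrt H) (sqrt H / h) is a product of nondecreasing functions. *)
Let G_nd r s : 0 < r -> r <= s -> G q r <= G q s.
Proof.
move=> r0 rs; have s0 : 0 < s by exact: lt_le_trans rs.
have hr := h_pos r0; have hs := h_pos s0; have Hr := H_pos r0; have Hs := H_pos s0.
have Gs := G_nonneg s0.
have sr : 0 < Num.sqrt (H q r) by rewrite sqrtr_gt0.
have ss : 0 < Num.sqrt (H q s) by rewrite sqrtr_gt0.
have le1 : h q s * Num.sqrt (H q r) <= h q r * Num.sqrt (H q s).
  have nn x y : 0 < x -> 0 < y -> x * y \is Num.nneg.
    by move=> x0 y0; rewrite nnegrE ltW// mulr_gt0.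
  rewrite -(@ler_pXn2r _ 2) ?nn//.
  rewrite (exprMn _ (h q s) (Num.sqrt _)) (exprMn _ (h q r) (Num.sqrt _)).
  by rewrite (sqr_sqrtr (ltW Hr)) (sqr_sqrtr (ltW Hs)); exact: h2H.
have le2 := GhH r0 rs.
rewrite ler_pdivrMr// mulrAC ler_pdivlMr// in le2.
have k : 0 < h q r * Num.sqrt (H q s) by rewrite mulr_gt0.
rewrite -(ler_pM2r k); apply: (@le_trans _ _ (G q s * (h q s * Num.sqrt (H q r)))).
  by rewrite (mulrA (G q r)) (mulrA (G q s)).
by rewrite ler_wpM2l.
Qed.

Let hCG r s : 0 < r -> r <= s -> h q r * (C - G q r) <= h q s * (C - G q s).
Proof.
move=> r0 rs; have s0 : 0 < s by exact: lt_le_trans rs.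
have [a [/andP[a0 a1] _ mono]] := q7.
have hr := h_pos r0; have hs := h_pos s0.
have split_h t : 0 < t -> h q t = h q t `^ a * h q t `^ (1 - a).
  move=> t0; have e1 : a + (1 - a) = 1 by ring.
  have ht := ltW (h_pos t0); rewrite -powRD; last by rewrite e1 oner_eq0.
  by rewrite e1 powRr1.
rewrite (split_h r r0) (split_h s s0).
have ler3 (x y z x' y' z' : R) : 0 <= x -> 0 <= y * z -> x <= x' ->
    y * z <= y' * z' -> x * y * z <= x' * y' * z'.
  by move=> *; rewrite -!mulrA; exact: ler_pM.
apply: ler3.
- exact: powR_ge0.
- by rewrite mulr_ge0 ?powR_ge0// subr_ge0 G_le.
- by apply: ge0_ler_powR; [exact: ltW|rewrite nnegrE ltW|rewrite nnegrE ltW|exact: h_nd].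
- exact: mono.
Qed.

Lemma weight_of_cond : weight q dq C.
Proof.
have q'E r : 0 < r -> derive1 q r = dq r := C1_derive1 qC.
have h_lin : exists2 l, 0 < l & forall r, 0 < r -> l <= derive1 (h q) r.
  have [_ _ _ _ [l l0 hl]] := q4; exists l => // r r0.
  rewrite -(cvg_lim (@Rhausdorff R) hl); apply: limr_le; first by apply/cvg_ex; exists l.
  by near=> s; apply: h'_noninc => //; near: s; exact: nbhs_pinfty_ge.
split => //.
- move=> r s r0; rewrite le_eqVlt => /predU1P[->//|rs].
  by rewrite -(q'E r r0) -(q'E s (lt_trans r0 rs)); exact: ltW (q2 r0 rs).
- exact: C1_within qC.
- have [l l0 hl] := h_lin; exists (2 * l)^-1 => [|r r0]; first by rewrite invr_gt0 mulr_gt0.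
  rewrite mulrC ler_pdivlMr ?mulr_gt0//; apply: le_trans (h'H_le r0).
  rewrite mulrC; apply: ler_wpM2r; first by rewrite ltW// H_pos.
  by rewrite ler_pM2l// hl.
- move=> eps eps0; have [r0 r00 r0P] := tail_small eps0.
  exists r0 => // r r0r; rewrite hE mulrC ler_wpM2r ?r0P// ltW// q_pos//.
  exact: lt_le_trans r0r.
Unshelve. all: by end_near. Qed.

End weights.

Theorem theorem4 (R : realType) (k : nat) (c : \bar R) (f q : R -> R)
    (b beta C : R)
    (c_gt0 : (0 < c)%E)
    (f_cont : forall s : R, dom c s -> {for s, continuous f})
    (f1 : cond_f1 c f b beta)
    (f2 : cond_f2 c f)
    (q1 : cond_q1 q)
    (q2 : cond_q2 q)
    (q4 : cond_q4 q)
    (q6 : cond_q6 q)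
    (q7 : cond_q7 q C)
    (f7 : cond_f7 c f beta C)
    (u v : R -> R)
    (u_sol : is_solution c f q u) (v_sol : is_solution c f q v)
    (u0 : 0 < u 0) (v0 : 0 < v 0)
    (u_k : exactly_sign_changes u k) (v_k : exactly_sign_changes v k) :
  forall r : R, 0 <= r -> u r = v r.
Proof.
have [dq qC] : exists dq, C1_Rplus q dq by case: q1.
have wq := weight_of_cond qC q1 q2 q4 q6 q7.
have nf := nonlinearity_of_cond f_cont f1 f2 f7.
have [du su] := sol_of_is_solution qC (q_gt0 wq) u_sol.
have [dv sv] := sol_of_is_solution qC (q_gt0 wq) v_sol.
apply: (sol_unique wq nf su sv); case: (ltgtP (u 0) (v 0)) => // uv.
  by have := amplitude_not_lt wq nf su sv u0 u_k v_k.
by have := amplitude_not_lt wq nf sv su v0 v_k u_k.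
Qed.
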